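(* Let $d\in\mathbb N$, $\alpha\in(0,2)$, $m\ge0$, and $v,a>0$ be such that $\mathcal H_{m,\alpha}=\Phi_{m,\alpha}(-\Delta)-v\mathbf 1_{B_a}$ has a ground state $\varphi$. Let $\chi:[0,\infty)\to\mathbb R$ be such that $\varphi(x)=\chi(|x|)$. Then $\chi$ is non-increasing on $[a,\infty)$.
   Context: $B_a$ is the ball of radius $a$ centred at the origin in $\mathbb R^d$. $\Phi_{m,\alpha}(z)=(z+m^{2/\alpha})^{\alpha/2}-m$, $z>0$, and $\Phi_{m,\alpha}(-\Delta)$ is the self-adjoint operator on $L^2(\mathbb R^d)$ given by the Fourier multiplier $\Phi_{m,\alpha}(|\xi|^2)$. $\mathcal H_{m,\alpha}=\Phi_{m,\alpha}(-\Delta)+V$ with $V=-v\mathbf 1_{B_a}$ is self-adjoint on $L^2(\mathbb R^d)$ with essential spectrum $[0,\infty)$. $\mathcal H_{m,\alpha}$ has a ground state if its discrete spectrum is non-empty; then $\lambda=\min\mathrm{Spec}_{\rm d}(\mathcal H_{m,\alpha})$ is a simple eigenvalue (the ground state eigenvalue), and the ground state $\varphi$ is the unique corresponding eigenfunction that is strictly positive with $\|\varphi\|_{L^2}=1$; it is taken in its continuous version, and it is rotationally symmetric. Standing assumption: $v$ is such that the ground state exists. *)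

(* Defs.v *)
From HB Require Import structures.
From mathcomp Require Import all_boot all_order all_algebra.
From mathcomp Require Import all_classical all_reals all_analysis.
From mathcomp Require Import complex.

Set Implicit Arguments.
Unset Strict Implicit.
Unset Printing Implicit Defensive.

Import Order.TTheory GRing.Theory Num.Def Num.Theory.
Import numFieldNormedType.Exports.

Local Open Scope classical_set_scope.
Local Open Scope ring_scope.
Local Open Scope complex_scope.

(* R^d is 'rV[R]_d, with its library topology and with the product
   sigma-algebra of the Borel sets of R, i.e. the Borel sigma-algebra of R^d.
   Lebesgue measure on it is the iterated product, moved along rV_cons. *)
Section rV_measurable.
Context {R : realType} (n : nat).

Let coors : 'I_n -> 'rV[R]_n -> R := fun i x => x ord0 i.

Let rV_set0 : g_sigma_preimage coors set0.
Proof. exact: sigma_algebra0. Qed.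

Let rV_setC A : g_sigma_preimage coors A -> g_sigma_preimage coors (~` A).
Proof. exact: sigma_algebraC. Qed.

Let rV_bigcup (F : (set 'rV[R]_n)^nat) :
  (forall i, g_sigma_preimage coors (F i)) ->
  g_sigma_preimage coors (\bigcup_i (F i)).
Proof. exact: sigma_algebra_bigcup. Qed.

HB.instance Definition _ := @isMeasurable.Build
  (measure_tuple_display default_measure_display)
  ('rV[R]_n) (g_sigma_preimage coors) rV_set0 rV_setC rV_bigcup.

End rV_measurable.

Section rV_measurable_fun.
Context {R : realType}.

Lemma measurable_rV_coord n (i : 'I_n) :
  measurable_fun [set: 'rV[R]_n] (fun x : 'rV[R]_n => x ord0 i : R).
Proof.
move=> _ Y mY; rewrite setTI; apply: sub_sigma_algebra => /=.
rewrite -bigcup_seq/=; exists i => /=; first by rewrite mem_index_enum.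
by exists Y => //; rewrite setTI.
Qed.

Lemma measurable_fun_rVP d (T : measurableType d) n (f : T -> 'rV[R]_n) :
  (forall i, measurable_fun setT (fun t => f t ord0 i : R)) ->
  measurable_fun setT f.
Proof.
move=> mf _ A; rewrite setTI => mA.
suff : preimage_set_system setT f measurable `<=` measurable.
  by apply; exists A => //; rewrite setTI.
rewrite [X in preimage_set_system _ _ X](_ : _ = <<s \big[setU/set0]_(i < n)
    preimage_set_system setT (fun x : 'rV[R]_n => x ord0 i : R) measurable >>)//.
rewrite -g_sigma_preimageE.
apply: smallest_sub; first exact: sigma_algebra_measurable.
move=> _ [B + <-]; rewrite -bigcup_seq => -[i _] [C mC <-].
by rewrite !setTI; rewrite -[X in measurable X]setTI; exact: mf.
Qed.

Definition rV_cons n (p : measurableTypeR R * 'rV[R]_n) : 'rV[R]_n.+1 :=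
  \row_i oapp (p.2 ord0) p.1 (unlift ord0 i).

Definition rV_uncons n (x : 'rV[R]_n.+1) : measurableTypeR R * 'rV[R]_n :=
  (x ord0 ord0, \row_i x ord0 (lift ord0 i)).

Lemma rV_consK n : cancel (@rV_cons n) (@rV_uncons n).
Proof.
case=> a v; rewrite /rV_uncons /rV_cons /= mxE unlift_none/=; congr pair.
by apply/rowP => i; rewrite !mxE liftK.
Qed.

Lemma measurable_rV_cons n : measurable_fun setT (@rV_cons n).
Proof.
apply: measurable_fun_rVP => i.
under eq_fun do rewrite mxE.
case: unliftP => [j _|_] /=; last exact: measurable_fst.
exact: (measurableT_comp (measurable_rV_coord j) measurable_snd).
Qed.

Lemma measurable_rV_uncons n : measurable_fun setT (@rV_uncons n).
Proof.
apply/measurable_fun_pairP; split; first exact: measurable_rV_coord.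
apply: measurable_fun_rVP => i /=.
under eq_fun do rewrite mxE.
exact: measurable_rV_coord.
Qed.

End rV_measurable_fun.

Section lebesgue_rV.
Context {R : realType}.
Local Open Scope ereal_scope.

Section succ.
Context n (mu : {sigma_finite_measure set 'rV[R]_n -> \bar R}).

Definition lebesgue_rV_succ : set 'rV[R]_n.+1 -> \bar R :=
  pushforward ((@lebesgue_measure R) \x mu) (@rV_cons R n).

Let mcons := @measurable_rV_cons R n.

Let succ0 : lebesgue_rV_succ set0 = 0.
Proof. exact: measure0. Qed.

Let succ_ge0 A : 0 <= lebesgue_rV_succ A.
Proof. exact: measure_ge0. Qed.

Let succ_sigma_additive : semi_sigma_additive lebesgue_rV_succ.
Proof. exact: measure_semi_sigma_additive. Qed.

HB.instance Definition _ := isMeasure.Build _ _ _ lebesgue_rV_succ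
  succ0 succ_ge0 succ_sigma_additive.

Let succ_sigma_finite : sigma_finite setT lebesgue_rV_succ.
Proof.
have /sigma_finiteP[F [TF ndF Foo]] := sigma_finiteT (@lebesgue_measure R).
have /sigma_finiteP[G [TG ndG Goo]] := sigma_finiteT mu.
exists (fun k => @rV_uncons R n @^-1` (F k `*` G k)).
  rewrite -preimage_bigcup (_ : \bigcup_i _ = setT) ?preimage_setT//.
  apply/seteqP; split=> // -[x y] _.
  have [i _ Fix] : (\bigcup_i F i) x by rewrite -TF.
  have [j _ Gjy] : (\bigcup_i G i) y by rewrite -TG.
  exists (maxn i j) => //; split.
  - by move: x Fix; exact/subsetPset/ndF/leq_maxl.
  - by move: y Gjy; exact/subsetPset/ndG/leq_maxr.
move=> k; have [mF Fk] := Foo k; have [mG Gk] := Goo k; split.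
  rewrite -[X in measurable X]setTI; apply: measurable_rV_uncons => //.
  exact: measurableX.
rewrite /lebesgue_rV_succ /pushforward -comp_preimage.
rewrite (_ : _ \o _ = id) ?preimage_id; last by apply/funext => p; exact: rV_consK.
by rewrite product_measure1E// lte_mul_pinfty// ge0_fin_numE.
Qed.

HB.instance Definition _ := Measure_isSigmaFinite.Build _ _ _
  lebesgue_rV_succ succ_sigma_finite.

End succ.

Fixpoint lebesgue_rV n : {sigma_finite_measure set 'rV[R]_n -> \bar R} :=
  if n is k.+1 then lebesgue_rV_succ (lebesgue_rV k) else \d_(0 : 'rV[R]_0)%R.

End lebesgue_rV.

Section complex_L2.
Context {R : realType} (d : nat).
Local Notation Rd := 'rV[R]_d.
Local Notation mu := (@lebesgue_rV R d).

Definition cmeasurable (f : Rd -> R[i]) :=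
  measurable_fun setT (fun x => complex.Re (f x) : R) /\
  measurable_fun setT (fun x => complex.Im (f x) : R).

Definition cLnorm (p : \bar R) (f : Rd -> R[i]) : \bar R :=
  'N[mu]_p[EFin \o @Normc.normc R \o f].

Definition inLp (p : \bar R) (f : Rd -> R[i]) :=
  cmeasurable f /\ (cLnorm p f < +oo)%E.

Definition aeq (f g : Rd -> R[i]) := {ae mu, forall x, f x = g x}.

Definition cintegral (f : Rd -> R[i]) : R[i] :=
  (\int[mu]_x complex.Re (f x)) +i* (\int[mu]_x complex.Im (f x)).

End complex_L2.

Section fourier.
Context {R : realType} (d : nat).
Local Notation Rd := 'rV[R]_d.
Implicit Types (x xi : Rd) (f g : Rd -> R[i]).

Definition dotp x xi : R := \sum_i x ord0 i * xi ord0 i.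

(* The library norm on 'rV[R]_d is the sup norm. *)
Definition enorm x : R := Num.sqrt (dotp x x).

Definition fourier1 f : Rd -> R[i] := fun xi =>
  ((Num.sqrt (2 * pi) ^+ d)^-1)%:C *
  cintegral (fun x => (cos (dotp x xi) -i* sin (dotp x xi)) * f x).

(* [is_fourier2 f F]: F is (a version of) the Plancherel transform of f, the
   closure in L^2 of the integral transform on the intersection of L^1, L^2. *)
Definition is_fourier2 f (F : Rd -> R[i]) :=
  [/\ inLp 2%:E f, inLp 2%:E F &
   exists u : nat -> Rd -> R[i],
   [/\ forall n, inLp 1%:E (u n) /\ inLp 2%:E (u n),
       cLnorm 2%:E (fun x => u n x - f x) @[n --> \oo] --> 0%E &
       cLnorm 2%:E (fun xi => fourier1 (u n) xi - F xi) @[n --> \oo] --> 0%E]].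

(* Unbounded operators on L^2 are given by their graphs, as relations between
   representatives; the domain of T is {f | exists g, T f g}. *)
Definition multiplier (s : Rd -> R) f g :=
  exists F G : Rd -> R[i],
  [/\ is_fourier2 f F, is_fourier2 g G & aeq G (fun xi => (s xi)%:C * F xi)].

Definition add_potential (T : (Rd -> R[i]) -> (Rd -> R[i]) -> Prop)
    (V : Rd -> R) f g :=
  inLp 2%:E g /\
  exists h, T f h /\ aeq g (fun x => h x + (V x)%:C * f x).

End fourier.

Section spectrum.
Context {R : realType} (d : nat).
Local Notation Rd := 'rV[R]_d.
Context (T : (Rd -> R[i]) -> (Rd -> R[i]) -> Prop).

(* T - z is a bijection from its domain onto L^2 with bounded inverse; the norm
   bound also gives injectivity. *)
Definition resolvent_set : set R[i] := [set z |
  (forall g, inLp 2%:E g ->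
    exists f h, T f h /\ aeq (fun x => h x - z * f x) g) /\
  exists M : R, forall f h, T f h ->
    (cLnorm 2%:E f <= M%:E * cLnorm 2%:E (fun x => h x - z * f x)%R)%E].

Definition spectrum : set R[i] := ~` resolvent_set.

Definition in_eigenspace (z : R[i]) (f : Rd -> R[i]) := T f (fun x => z * f x).

Definition is_eigenvalue (z : R[i]) :=
  exists2 f, in_eigenspace z f & ~ aeq f (fun=> 0).

Definition finite_multiplicity (z : R[i]) :=
  exists (n : nat) (e : 'I_n -> Rd -> R[i]), forall f, in_eigenspace z f ->
  exists c : 'I_n -> R[i], aeq f (fun x => \sum_i c i * e i x).

Definition discrete_spectrum : set R[i] := [set z |
  [/\ isolated (spectrum : set R[i]^o) z, is_eigenvalue z & finite_multiplicity z]].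

(* z <= w in R[i] means that w - z is a nonnegative real number. *)
Definition is_min_discrete_spectrum (lambda : R) :=
  discrete_spectrum lambda%:C /\
  forall z, discrete_spectrum z -> lambda%:C <= z.

Definition is_ground_state (phi : Rd -> R) :=
  exists2 lambda : R, is_min_discrete_spectrum lambda &
  [/\ continuous phi, forall x, 0 < phi x,
      cLnorm 2%:E (fun x => (phi x)%:C) = 1%E &
      in_eigenspace lambda%:C (fun x => (phi x)%:C)].

End spectrum.

Section relativistic_well.
Context {R : realType} (d : nat).

(* 0 `^ p = 0 for p != 0, so m = 0 gives z `^ (alpha / 2). *)
Definition rel_symbol (m alpha z : R) : R :=
  (z + m `^ (2 / alpha)) `^ (alpha / 2) - m.

Definition eball (a : R) : set 'rV[R]_d := [set x | enorm x < a].

Definition rel_hamiltonian (m alpha v a : R) :=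
  add_potential
    (multiplier (fun xi : 'rV[R]_d => rel_symbol m alpha (enorm xi ^+ 2)))
    (fun x => - v * \1_(eball a) x).

End relativistic_well.

(* Main.v *)
Require Import Defs.
From HB Require Import structures.
From mathcomp Require Import all_boot all_order all_algebra.
From mathcomp Require Import all_classical all_reals all_analysis.
From mathcomp Require Import measurable_realfun complex ring lra.

Set Implicit Arguments.
Unset Strict Implicit.
Unset Printing Implicit Defensive.

Import Order.TTheory GRing.Theory Num.Theory.
Import numFieldNormedType.Exports.

Local Open Scope ring_scope.

(** Write sigma for the reflection in the hyperplane x_1 = c, c > 0, and P_t for
    the heat semigroup. The theorem follows from the inequality
    phi (sigma x) <= phi x for x_1 < c (ground_state_mirror), applied with
    c = (r + s) / 2 to the point (r, 0), whose image is (s, 0).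

    Let E be the set of points with x_1 <= c at which the inequality fails. If it
    fails at some point with x_1 < c, E has positive measure by continuity.
    The eigenvalue equation, in the form
      (Phi(-Laplacian) + m) phi = (lambda + m + v 1_B) phi,
    is tested against f = zeta (phi o sigma), where zeta is 1 on E, -1 on
    sigma E and 0 elsewhere (mirror_test):
    - <f, phi> = 0, since zeta is odd under sigma and phi (phi o sigma) is even
      (mirror_test_orth);
    - <f, P_t phi> >= 0 for all t > 0, with a positive lower bound uniform in
      1 <= t <= e: summing the integrand zeta(x) phi(sigma x) p_t(x - y) phi(y)
      over the eight symmetries generated by the reflections of x and y and by
      their exchange leaves a nonnegative function, because
      p_t(x - y) >= p_t(x - sigma y) on the same side of the mirror, and a
      positive one on E x E (mirror_test_heat_ge0, mirror_test_heat_ge);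
    - <f, (lambda + m + v 1_B) phi> >= 0, since the well lies on the side of the
      origin (mirror_test_potential).
    On the other hand Phi(|xi|^2) + m = (|xi|^2 + M)^b with b = alpha / 2 and
    M = m^(2 / alpha), and
      z^b = C int (1 - exp(- e^s z)) e^(- b s) ds,   C > 0 (powR_levy),
    so that formally
      <f, (Phi(-Laplacian) + m) phi> =
        C int (<f, phi> - exp(- M e^s) <f, P_(e^s) phi>) e^(- b s) ds < 0,
    a contradiction.

    To make the last step rigorous f is replaced by truncations g in L^1 and L^2,
    and s is restricted to a bounded window (operator_test). For such g the
    pairing with a function and with its heat averages is computed on the
    frequency side by a Parseval identity (parseval). It comes from
    Gaussian-regularised Fourier inversion (heat_inversion, fourier2_heat),
    in which the regularised function is a heat average; the regularisation is
    removed because the heat averages of phi and of (Phi(-Laplacian)) phi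
    converge almost everywhere (heat_cvg) and g is supported where they are
    bounded (good_truncation). *)

(** * Square-integrable functions on a measure space *)

Section L1L2.
Context d (T : measurableType d) (R : realType).
Variable mu : {measure set T -> \bar R}.
Implicit Types f g h : T -> R.

Definition L1 f := mu.-integrable setT (EFin \o f).
Definition L2 f := measurable_fun setT f /\ L1 (fun x => f x ^+ 2).
Definition nrm2 f := Num.sqrt (\int[mu]_x (f x ^+ 2)).

Lemma L1_meas f : L1 f -> measurable_fun setT f.
Proof. by move=> /measurable_int/measurable_EFinP. Qed.

Lemma L1_le f g : measurable_fun setT f -> (forall x, `|f x| <= g x) ->
  L1 g -> L1 f.
Proof.
move=> mf fg; apply: le_integrable => //; first exact/measurable_EFinP.
by move=> x _ /=; rewrite lee_fin (le_trans (fg x))// ler_norm.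
Qed.

Lemma L1D f g : L1 f -> L1 g -> L1 (fun x => f x + g x).
Proof. by move=> lf lg; exact: (integrableD measurableT lf lg). Qed.

Lemma L1B f g : L1 f -> L1 g -> L1 (fun x => f x - g x).
Proof. by move=> lf lg; exact: (integrableB measurableT lf lg). Qed.

Lemma L1Z k f : L1 f -> L1 (fun x => k * f x).
Proof. by move=> lf; exact: (integrableZl measurableT k lf). Qed.

Lemma L1_norm f : L1 f -> L1 (fun x => `|f x|).
Proof. exact: integrable_norm. Qed.

Lemma L1_bndM k f g : measurable_fun setT f -> (forall x, `|f x| <= k) ->
  L1 g -> L1 (fun x => f x * g x).
Proof.
move=> mf fk lg; apply: (@L1_le _ (fun x => k * `|g x|)).
- by apply: measurable_funM => //; exact: L1_meas.
- by move=> x; rewrite normrM ler_wpM2r.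
- exact/L1Z/L1_norm.
Qed.

Lemma L1_L2M f g : L2 f -> L2 g -> L1 (fun x => f x * g x).
Proof.
move=> [mf lf] [mg lg]; apply: L1_le (L1D lf lg); first exact: measurable_funM.
move=> x; rewrite ler_norml; apply/andP; split; nra.
Qed.

Lemma L2_bndM k f g : measurable_fun setT f -> (forall x, `|f x| <= k) ->
  L2 g -> L2 (fun x => f x * g x).
Proof.
move=> mf fk [mg lg]; split; first exact: measurable_funM.
under eq_fun do rewrite exprMn.
apply: (@L1_bndM (k ^+ 2)) => //; first exact: measurable_funX.
by move=> x; rewrite normrX lerXn2r// ?nnegrE// (le_trans _ (fk x)).
Qed.

Lemma L2_le f g : measurable_fun setT f -> (forall x, `|f x| <= g x) ->
  L2 g -> L2 f.
Proof.
move=> mf fg [mg lg]; split => //; apply: L1_le lg; first exact: measurable_funX.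
by move=> x; rewrite normrX lerXn2r// ?nnegrE// (le_trans _ (fg x)).
Qed.

Lemma L2Z k f : L2 f -> L2 (fun x => k * f x).
Proof. by apply: (@L2_bndM `|k|). Qed.

Lemma L2D f g : L2 f -> L2 g -> L2 (fun x => f x + g x).
Proof.
move=> lf lg; have lfg := L1_L2M lf lg.
case: lf lg => mf lf [mg lg]; split; first exact: measurable_funD.
apply: (@L1_le _ (fun x => f x ^+ 2 + (2 * (f x * g x) + g x ^+ 2))).
- by apply: measurable_funX; exact: measurable_funD.
- by move=> x; rewrite ger0_norm ?sqr_ge0// le_eqVlt; apply/orP; left; apply/eqP; ring.
- by apply/L1D => //; apply: L1D => //; exact: L1Z.
Qed.

Lemma L2B f g : L2 f -> L2 g -> L2 (fun x => f x - g x).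
Proof.
move=> lf /(L2Z (-1)) lg; have := L2D lf lg.
by under eq_fun do rewrite mulN1r.
Qed.

Lemma nrm2_ge0 f : 0 <= nrm2 f. Proof. exact: sqrtr_ge0. Qed.

Lemma nrm2_sqr f : nrm2 f ^+ 2 = \int[mu]_x (f x ^+ 2).
Proof. by rewrite sqr_sqrtr// Rintegral_ge0// => x _; exact: sqr_ge0. Qed.

Lemma le_Rint f g : L1 f -> L1 g -> (forall x, f x <= g x) ->
  \int[mu]_x f x <= \int[mu]_x g x.
Proof. by move=> lf lg fg; apply: le_Rintegral. Qed.

Lemma nrm2_le f g : measurable_fun setT f -> (forall x, `|f x| <= g x) ->
  L2 g -> nrm2 f <= nrm2 g.
Proof.
move=> mf fg lg; have lf := L2_le mf fg lg.
apply: ler_wsqrtr; apply: le_Rint; [exact: lf.2|exact: lg.2|move=> x].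
by rewrite -(real_normK (num_real (f x))) lerXn2r// ?nnegrE// (le_trans _ (fg x)).
Qed.

(** Integrating |st| <= (s^2 + t^2) / 2 after normalising both functions. *)
Lemma cauchy_schwarz f g : L2 f -> L2 g ->
  `|\int[mu]_x (f x * g x)| <= nrm2 f * nrm2 g.
Proof.
move=> lf lg; have lfg := L1_L2M lf lg.
have key k : 0 < k -> `|\int[mu]_x (f x * g x)| <=
    (k * nrm2 f ^+ 2 + k^-1 * nrm2 g ^+ 2) / 2.
  move=> k0; apply: (le_trans (le_normr_Rintegral measurableT lfg)).
  have l1 := L1Z k lf.2; have l2 := L1Z k^-1 lg.2.
  have e1 : k * nrm2 f ^+ 2 = \int[mu]_x (k * f x ^+ 2).
    by rewrite nrm2_sqr RintegralZl//; exact: lf.2.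
  have e2 : k^-1 * nrm2 g ^+ 2 = \int[mu]_x (k^-1 * g x ^+ 2).
    by rewrite nrm2_sqr RintegralZl//; exact: lg.2.
  rewrite e1 e2 -RintegralD// -RintegralZr//; last exact: L1D.
  apply: le_Rint; [exact: L1_norm| |move=> x].
    have := L1Z 2^-1 (L1D l1 l2); rewrite /L1.
    by under [X in _ -> mu.-integrable _ (EFin \o X)]eq_fun do rewrite mulrC.
  rewrite ler_pdivlMr// normrM.
  have -> : k * f x ^+ 2 + k^-1 * g x ^+ 2 =
     2 * `|f x| * `|g x| + k * (`|f x| - k^-1 * `|g x|) ^+ 2.
    rewrite -(real_normK (num_real (f x))) -(real_normK (num_real (g x))).
    by field; rewrite gt_eqF.
  have := mulr_ge0 (ltW k0) (sqr_ge0 (`|f x| - k^-1 * `|g x|)); lra.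
have F0 := nrm2_ge0 f; have G0 := nrm2_ge0 g.
have [f0|fn0] := eqVneq (nrm2 f) 0; last first.
  have [g0|gn0] := eqVneq (nrm2 g) 0; last first.
    have fp : 0 < nrm2 f by rewrite lt0r fn0.
    have gp : 0 < nrm2 g by rewrite lt0r gn0.
    have := key (nrm2 g / nrm2 f) (divr_gt0 gp fp).
    suff -> : (nrm2 g / nrm2 f * nrm2 f ^+ 2 +
      (nrm2 g / nrm2 f)^-1 * nrm2 g ^+ 2) / 2 = nrm2 f * nrm2 g by [].
    by field; rewrite fn0 gn0.
  rewrite g0 mulr0; apply/ler_addgt0Pl => e e0; rewrite addr0.
  have fp : 0 < nrm2 f ^+ 2 by rewrite exprn_gt0// lt0r fn0.
  have := key (e / nrm2 f ^+ 2) (divr_gt0 e0 fp).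
  rewrite g0 expr0n/= mulr0 addr0 divfK ?gt_eqF//; lra.
rewrite f0 mul0r; apply/ler_addgt0Pl => e e0; rewrite addr0.
have := key (nrm2 g ^+ 2 / e + 1).
rewrite f0 expr0n/= mulr0 add0r => h.
have p : 0 < nrm2 g ^+ 2 / e + 1.
  by rewrite ltr_wpDl// divr_ge0 ?sqr_ge0// ltW.
apply: (le_trans (h p)); rewrite ler_pdivrMr// mulrC ler_pdivrMr//.
have -> : e * 2 * (nrm2 g ^+ 2 / e + 1) = 2 * nrm2 g ^+ 2 + 2 * e.
  by field; rewrite gt_eqF.
by have := sqr_ge0 (nrm2 g); lra.
Qed.

Lemma cvg_nrm2 (f_ : nat -> T -> R) f : measurable_fun setT f ->
  (forall n, measurable_fun setT (f_ n)) -> forall g, L2 g ->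
  (forall n x, `|f_ n x - f x| <= g x) ->
  {ae mu, forall x, (f_ n x @[n --> \oo] --> f x)%classic} ->
  (nrm2 (fun x => f_ n x - f x) @[n --> \oo] --> (0 : R))%classic.
Proof.
move=> mf mf_ g lg h c.
have : (\int[mu]_x ((f_ n x - f x) ^+ 2)%:E @[n --> \oo] -->
  \int[mu]_x (cst 0 x))%E%classic.
  have [] := @dominated_convergence _ T R mu setT measurableT
    (fun n x => ((f_ n x - f x) ^+ 2)%:E) (cst 0%E) (EFin \o (fun x => g x ^+ 2)) => //.
  - by move=> n; apply/measurable_EFinP/measurable_funX/measurable_funB.
  - apply: filterS c => x c _ /=; apply: cvg_EFin; first by near=> n.
    rewrite /comp /= [X in (_ --> X)%classic](_ : _ = (f x - f x) * (f x - f x)).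
      by apply: cvgM; apply: cvgB => //; exact: cvg_cst.
    by rewrite subrr mulr0.
  - exact: lg.2.
  - apply: aeW => x n _ /=; rewrite lee_fin normrX lerXn2r// ?nnegrE//.
    by rewrite (le_trans _ (h n x)).
rewrite integral0 => /fine_cvg/= cf.
rewrite -(@sqrtr0 R); apply: continuous_cvg cf; exact: sqrt_continuous.
Unshelve. all: end_near. Qed.

Lemma Rdominated (f_ : nat -> T -> R) f g :
  (forall n, measurable_fun setT (f_ n)) -> measurable_fun setT f ->
  {ae mu, forall x, (f_ n x @[n --> \oo] --> f x)%classic} ->
  L1 g -> (forall n x, `|f_ n x| <= g x) ->
  L1 f /\ (\int[mu]_x f_ n x @[n --> \oo] --> \int[mu]_x f x)%classic.
Proof.
move=> mf_ mf c lg h.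
have [] := @dominated_convergence _ T R mu setT measurableT
    (fun n x => (f_ n x)%:E) (EFin \o f) (EFin \o g) => //.
- by move=> n; apply/measurable_EFinP.
- exact/measurable_EFinP.
- by apply: filterS c => x cx _; apply: cvg_EFin => //; near=> n.
- by apply: aeW => x n _ /=; rewrite lee_fin.
move=> lf _ cc; split => //.
have fin : (\int[mu]_x (EFin \o f) x)%E \is a fin_num.
  exact: integrable_fin_num.
by apply: fine_cvg; rewrite fineK//; exact: cc.
Unshelve. all: end_near. Qed.

Lemma Rint_ae f g : measurable_fun setT f -> measurable_fun setT g ->
  {ae mu, forall x, f x = g x} -> \int[mu]_x f x = \int[mu]_x g x.
Proof.
move=> mf mg fg; congr fine; apply: ae_eq_integral => //; try exact/measurable_EFinP.
by apply: filterS fg => x fg _ /=; rewrite fg.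
Qed.

Lemma L2_ae f g : L2 f -> measurable_fun setT g ->
  {ae mu, forall x, f x = g x} -> L2 g.
Proof.
move=> [mf lf] mg fg; split => //; apply/integrableP; split.
  by apply/measurable_EFinP; exact: measurable_funX.
have /integrableP[_] := lf; congr (_ < _)%E.
apply: ae_eq_integral => //.
- by apply: measurableT_comp => //; apply/measurable_EFinP; exact: measurable_funX.
- by apply: measurableT_comp => //; apply/measurable_EFinP; exact: measurable_funX.
- by apply: filterS fg => x fg _ /=; rewrite fg.
Qed.

End L1L2.

#[local] Hint Resolve nrm2_ge0 : core.

Section fubini.
Context d1 d2 (T1 : measurableType d1) (T2 : measurableType d2) (R : realType).
Variables (m1 : {sigma_finite_measure set T1 -> \bar R})
          (m2 : {sigma_finite_measure set T2 -> \bar R}).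
Implicit Type F : T1 * T2 -> R.

Lemma measurable_Rint2 F : measurable_fun setT F ->
  measurable_fun setT (fun x => \int[m2]_y F (x, y)).
Proof.
move=> mF; apply: (measurableT_comp (fine_measurable measurableT)).
under eq_fun do rewrite integralE.
apply: emeasurable_funB.
  under eq_fun do rewrite (funepos_comp (EFin \o F) (fun y => (_, y))).
  apply: (measurable_fun_fubini_tonelli_F ((EFin \o F)^\+%E)) => //.
  exact/measurable_funepos/measurable_EFinP.
under eq_fun do rewrite (funeneg_comp (EFin \o F) (fun y => (_, y))).
apply: (measurable_fun_fubini_tonelli_F ((EFin \o F)^\-%E)) => //.
exact/measurable_funeneg/measurable_EFinP.
Qed.

End fubini.

(** * Fubini's theorem for real-valued integrals *)

Section fubini_real.
Context d1 d2 (T1 : measurableType d1) (T2 : measurableType d2) (R : realType).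
Variables (m1 : {sigma_finite_measure set T1 -> \bar R})
          (m2 : {sigma_finite_measure set T2 -> \bar R}).
Implicit Type F : T1 * T2 -> R.

Lemma L1_prod1 F : L1 (m1 \x m2)%E F -> L1 m1 (fun x => \int[m2]_y F (x, y)).
Proof.
move=> lF; have mF := L1_meas lF.
apply: le_integrable (integrable_fubini_F lF) => //.
  by apply/measurable_EFinP; exact: measurable_Rint2.
by move=> x _ /=; rewrite /Rintegral /fubini_F/=; case: (integral _ _ _) => [r| |]/=; rewrite ?lexx ?normr0 ?leey.
Qed.

Lemma Rint_prod1 F : L1 (m1 \x m2)%E F ->
  \int[m1]_x \int[m2]_y F (x, y) = \int[(m1 \x m2)%E]_z F z.
Proof.
move=> lF; have mF := L1_meas lF.
rewrite [in RHS]/Rintegral -(integral12_prod_meas1 lF) [LHS]/Rintegral.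
congr fine; apply: ae_eq_integral => //.
- by apply/measurable_EFinP; exact: measurable_Rint2.
- exact: measurable_fubini_F lF.
- have := integrable_ae measurableT (integrable_fubini_F lF).
  move=> ae; apply: (filterS _ ae) => x /= fin xT; rewrite /= fineK//; exact: fin.
Qed.

Lemma L1_swap F : L1 (m1 \x m2)%E F -> L1 (m2 \x m1)%E (F \o @swap_pair _ _).
Proof.
move=> lF; have mF := L1_meas lF; apply/integrable12ltyP => /=.
  apply/measurable_EFinP; apply: (measurableT_comp mF).
  by apply: measurable_fun_pair; [exact: measurable_snd|exact: measurable_fst].
have mE : measurable_fun setT (EFin \o F) by exact/measurable_EFinP.
by have [+ _] := integrable21ltyP m1 m2 mE; apply.
Qed.

(** Tonelli's criterion. *)
Lemma L1_prodP F : measurable_fun setT F -> (forall x, L1 m2 (fun y => F (x, y))) ->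
  L1 m1 (fun x => \int[m2]_y `|F (x, y)|) -> L1 (m1 \x m2)%E F.
Proof.
move=> mF lF l1; apply/integrable12ltyP; first exact/measurable_EFinP.
have /integrableP[_] := l1; apply: le_lt_trans; rewrite le_eqVlt; apply/orP; left.
apply/eqP/eq_integral => x _ /=.
rewrite ger0_norm ?Rintegral_ge0// /Rintegral fineK//.
exact: (integrable_fin_num measurableT (L1_norm (lF x))).
Qed.

Lemma L1_prodM (f : T1 -> R) (g : T2 -> R) : L1 m1 f -> L1 m2 g ->
  L1 (m1 \x m2)%E (fun z => f z.1 * g z.2).
Proof.
move=> lf lg; apply: L1_prodP => /=.
- apply: measurable_funM.
    exact: (measurableT_comp (L1_meas lf) measurable_fst).
  exact: (measurableT_comp (L1_meas lg) measurable_snd).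
- by move=> x; exact: L1Z.
- under eq_fun do (under eq_Rintegral do rewrite normrM).
  have := L1Z (\int[m2]_y `|g y|) (L1_norm lf).
  congr (L1 _ _); apply/funext => x; rewrite RintegralZl 1?mulrC//.
  exact: L1_norm.
Qed.

End fubini_real.

Section fubini_swap.
Context d1 d2 (T1 : measurableType d1) (T2 : measurableType d2) (R : realType).
Variables (m1 : {sigma_finite_measure set T1 -> \bar R})
          (m2 : {sigma_finite_measure set T2 -> \bar R}).
Implicit Type F : T1 * T2 -> R.

Lemma L1_prod2 F : L1 (m1 \x m2)%E F -> L1 m2 (fun y => \int[m1]_x F (x, y)).
Proof. by move=> /L1_swap/L1_prod1. Qed.

Lemma Rint_prod2 F : L1 (m1 \x m2)%E F ->
  \int[m2]_y \int[m1]_x F (x, y) = \int[(m1 \x m2)%E]_z F z.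
Proof.
move=> lF; have mF := L1_meas lF.
rewrite [in RHS]/Rintegral -(integral21_prod_meas1 lF) [LHS]/Rintegral.
congr fine; apply: ae_eq_integral => //.
- by apply: (measurable_int m2); exact: L1_prod2 lF.
- exact: measurable_fubini_G lF.
- have := integrable_ae measurableT (integrable_fubini_F (L1_swap lF)).
  move=> ae; apply: (filterS _ ae) => x /= fin xT; rewrite /= fineK//; exact: fin.
Qed.

Lemma Rint_swap F : L1 (m1 \x m2)%E F ->
  \int[m1]_x \int[m2]_y F (x, y) = \int[m2]_y \int[m1]_x F (x, y).
Proof. by move=> lF; rewrite Rint_prod1// Rint_prod2. Qed.

End fubini_swap.

(** * The Fourier transform of Gaussians on the line *)

Section gauss1.
Context {R : realType}.
Local Notation leb := (@lebesgue_measure R).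
Implicit Types (t a b x : R).

Lemma normal_fun_sqrt t b x : 0 < t ->
  normal_fun b (Num.sqrt (2 * t)^-1) x = expR (- t * (x - b) ^+ 2).
Proof.
move=> t0; rewrite /normal_fun sqr_sqrtr ?invr_ge0 ?mulr_ge0 ?ltW//.
by congr expR; field; rewrite gt_eqF.
Qed.

Lemma sqrt_half_neq0 t : 0 < t -> Num.sqrt (2 * t)^-1 != 0 :> R.
Proof. by move=> t0; rewrite gt_eqF// sqrtr_gt0 invr_gt0 mulr_gt0. Qed.

Lemma normal_peak_sqrt t : 0 < t ->
  normal_peak (Num.sqrt (2 * t)^-1) = (Num.sqrt (pi / t))^-1.
Proof.
move=> t0; rewrite /normal_peak sqr_sqrtr ?invr_ge0 ?mulr_ge0 ?ltW//.
by congr ((Num.sqrt _)^-1); field; rewrite gt_eqF.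
Qed.

Lemma sqrt_pi_gt0 t : 0 < t -> 0 < Num.sqrt (pi / t).
Proof. by move=> t0; rewrite sqrtr_gt0 divr_gt0// pi_gt0. Qed.

Lemma normal_pdf_gauss1 t b : 0 < t -> normal_pdf b (Num.sqrt (2 * t)^-1) =
  fun x => (Num.sqrt (pi / t))^-1 * expR (- t * (x - b) ^+ 2).
Proof.
move=> t0; apply/funext => x; rewrite normal_pdfE ?sqrt_half_neq0//.
by rewrite /= normal_peak_sqrt// normal_fun_sqrt.
Qed.

Lemma L1_gauss1 t b : 0 < t -> L1 leb (fun x => expR (- t * (x - b) ^+ 2)).
Proof.
move=> t0; have := @integrable_normal_pdf R b (Num.sqrt (2 * t)^-1).
rewrite normal_pdf_gauss1// => /(L1Z (Num.sqrt (pi / t))).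
by under eq_fun do rewrite mulrA divff ?mul1r ?gt_eqF ?sqrt_pi_gt0//.
Qed.

Lemma Rint_gauss1 t b : 0 < t ->
  \int[leb]_x expR (- t * (x - b) ^+ 2) = Num.sqrt (pi / t).
Proof.
move=> t0; have /(congr1 fine) := @integral_normal_pdf R b (Num.sqrt (2 * t)^-1).
rewrite normal_pdf_gauss1// -/(Rintegral _ _ _) RintegralZl//; last exact: L1_gauss1.
move=> /(congr1 ( *%R (Num.sqrt (pi / t)))).
by rewrite mulrA divff ?mul1r ?mulr1//= gt_eqF ?sqrt_pi_gt0.
Qed.

Lemma measurable_cos_lin a b : measurable_fun setT (fun x => cos (a * x + b)).
Proof.
by apply: continuous_measurable_fun => x; apply: continuous_comp;
  [apply: cvgD; [apply: cvgM|]; try exact: cvg_cst; exact: cvg_id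
  |exact: continuous_cos].
Qed.

(** The moment |x| exp(-t x^2) is dominated by a wider Gaussian. *)
Lemma abs_gauss1_le t x : 0 < t ->
  `|x| * expR (- t * x ^+ 2) <= (1 + t^-1) * expR (- (t / 2) * (x - 0) ^+ 2).
Proof.
move=> t0; rewrite subr0.
have -> : - t * x ^+ 2 = - (t / 2) * x ^+ 2 + - (t / 2 * x ^+ 2) by field.
rewrite expRD mulrCA mulrC ler_pM2r ?expR_gt0//.
rewrite expRN ler_pdivrMr ?expR_gt0//.
have h := expR_ge1Dx (t / 2 * x ^+ 2).
apply: le_trans (ler_wpM2l _ h); last by rewrite addr_ge0// invr_ge0 ltW.
have -> : (1 + t^-1) * (1 + t / 2 * x ^+ 2) =
  1 + t^-1 + t / 2 * x ^+ 2 + x ^+ 2 / 2 by field; rewrite gt_eqF.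
have p1 : 0 < t^-1 by rewrite invr_gt0.
have p2 : 0 <= t / 2 * x ^+ 2 by rewrite mulr_ge0 ?sqr_ge0// divr_ge0// ltW.
have := sqr_ge0 (`|x| - 1); rewrite sqrrB1 real_normK ?num_real// -mulr_natl; lra.
Qed.

(** A function with an antiderivative vanishing at both infinities has integral
    zero; used below as integration by parts on the whole line. *)
Lemma Rint_total_derivative (F f : R -> R) :
  (forall x, is_derive x 1 F (f x)) -> continuous f -> L1 leb f ->
  (F n.+1%:R @[n --> \oo] --> (0 : R))%classic ->
  (F (- n.+1%:R) @[n --> \oo] --> (0 : R))%classic ->
  \int[leb]_x f x = 0.
Proof.
move=> dF cf lf c1 c2.
pose I n := `[- n.+1%:R, n.+1%:R : R]%classic.
have mI n : measurable (I n) by exact: measurable_itv.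
have cF : continuous F.
  by move=> x; apply: differentiable_continuous; apply/derivable1_diffP; exact: ex_derive.
have key n : \int[leb]_x (\1_(I n) x * f x) = F n.+1%:R - F (- n.+1%:R).
  have h : (\int[leb]_(x in I n) (f x)%:E = (F n.+1%:R)%:E - (F (- n.+1%:R))%:E)%E.
    apply: continuous_FTC2.
    - by rewrite ltrNl (lt_trans _ (ltr0Sn _ _))// oppr_lt0 ltr0Sn.
    - exact: continuous_subspaceT.
    - split; last by apply: cvg_at_left_filter; exact: cF.
        by move=> x _; exact: ex_derive.
      by apply: cvg_at_right_filter; exact: cF.
    - by move=> x _; rewrite derive1E; exact: derive_val.
  rewrite /Rintegral -[RHS]/(fine ((F n.+1%:R)%:E - (F (- n.+1%:R))%:E)%E) -h.
  rewrite [in RHS]integral_mkcond; congr fine; apply: eq_integral => x _.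
  by rewrite patchE indicE; case: ifP => _; rewrite ?mul1r ?mul0r.
pose fn n x := \1_(I n) x * f x.
have mfn n : measurable_fun setT (fn n).
  by apply: measurable_funM => //; exact: L1_meas lf.
have cfn x : (fn n x @[n --> \oo] --> f x)%classic.
  apply: cvg_near_cst; near=> n; rewrite /fn indicE mem_set ?mul1r//=.
  rewrite /I/= in_itv/= -ler_norml.
  suff : `|x| <= n%:R by move=> h; apply: (le_trans h); rewrite ler_nat.
  by near: n; exact: nbhs_infty_ger.
have bfn n x : `|fn n x| <= `|f x|.
  by rewrite /fn normrM ler_piMl// indicE; case: (_ \in _); rewrite ?normr1 ?normr0.
have [_] := @Rdominated _ _ _ leb fn f _ mfn (L1_meas lf) (aeW leb cfn) (L1_norm lf) bfn.
under eq_fun do rewrite key.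
move=> h; have /= := cvg_unique (@Rhausdorff R) h (cvgB c1 c2).
by rewrite subr0 => e; rewrite -e.
Unshelve. all: end_near. Qed.

Lemma is_derive_gauss1 t x :
  is_derive x 1 (fun x => expR (- t * x ^+ 2)) (- 2 * t * x * expR (- t * x ^+ 2)).
Proof.
have h : is_derive x 1 (fun x : R => - t * x ^+ 2) (- t * (2 * x)).
  apply: (@is_derive_eq _ _ _ ((- t) \*: (@id R) ^+ 2)).
  rewrite /GRing.scale/=; ring.
apply: (@is_derive_eq _ _ _ (expR \o (fun x => - t * x ^+ 2))); ring.
Qed.

Lemma is_derive_mulr a x : is_derive x 1 (fun x => a * x) a.
Proof.
apply: (@is_derive_eq _ _ _ (a \*: (@id R))).
by rewrite /GRing.scale/= mulr1.
Qed.

Lemma is_derive_sinM a x : is_derive x 1 (fun x => sin (a * x)) (a * cos (a * x)).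
Proof.
have h := is_derive_mulr a x.
apply: (@is_derive_eq _ _ _ (sin \o (fun x => a * x))); ring.
Qed.

Lemma is_derive_cosMl x a : is_derive a 1 (fun a => cos (a * x)) (- x * sin (a * x)).
Proof.
have h : is_derive a 1 (fun a => a * x) x.
  by under eq_fun do rewrite mulrC; exact: is_derive_mulr.
apply: (@is_derive_eq _ _ _ (cos \o (fun a => a * x))); ring.
Qed.

Lemma continuous_gauss1 t : continuous (fun x => expR (- t * x ^+ 2)).
Proof.
move=> x; apply: differentiable_continuous; apply/derivable1_diffP.
exact: (@ex_derive _ _ _ _ _ _ _ (is_derive_gauss1 t x)).
Qed.

Lemma L1_gauss1_0 t : 0 < t -> L1 leb (fun x => expR (- t * x ^+ 2)).
Proof. by move=> t0; have := L1_gauss1 0 t0; under eq_fun do rewrite subr0. Qed.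

Lemma L1_cos_gauss1 t a b : 0 < t ->
  L1 leb (fun x => cos (a * x + b) * expR (- t * x ^+ 2)).
Proof.
move=> t0; apply: (@L1_bndM _ _ _ leb 1); last exact: L1_gauss1_0.
  exact: measurable_cos_lin.
by move=> x; rewrite ler_norml cos_geN1 cos_le1.
Qed.

Lemma L1_abs_gauss1 t : 0 < t -> L1 leb (fun x => `|x| * expR (- t * x ^+ 2)).
Proof.
move=> t0; have t20 : 0 < t / 2 by rewrite divr_gt0.
apply: (@L1_le _ _ _ leb _ _ _ _ (L1Z (1 + t^-1) (L1_gauss1 0 t20))).
  apply: measurable_funM => //; exact: (L1_meas (L1_gauss1_0 t0)).
by move=> x; rewrite ger0_norm ?abs_gauss1_le// mulr_ge0// expR_ge0.
Qed.

Lemma L1_sin_gauss1 t a : 0 < t ->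
  L1 leb (fun x => x * sin (a * x) * expR (- t * x ^+ 2)).
Proof.
move=> t0; apply: (@L1_le _ _ _ leb _ _ _ _ (L1_abs_gauss1 t0)).
  apply: measurable_funM; last exact: (L1_meas (L1_gauss1_0 t0)).
  apply: measurable_funM => //; apply: continuous_measurable_fun => x.
  apply: differentiable_continuous; apply/derivable1_diffP.
  exact: (@ex_derive _ _ _ _ _ _ _ (is_derive_sinM a x)).
move=> x; rewrite !normrM (ger0_norm (expR_ge0 _)) ler_wpM2r ?expR_ge0//.
by rewrite ler_piMr// ler_norml sin_geN1 sin_le1.
Qed.

Lemma cvg_expR_gauss1 t : 0 < t ->
  (expR (- t * n.+1%:R ^+ 2) @[n --> \oo] --> (0 : R))%classic.
Proof.
move=> t0; have e1 : `|expR (- t)| < 1 by rewrite ger0_norm ?expR_ge0// expR_lt1 oppr_lt0.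
apply: (@squeeze_cvgr _ _ _ _ (cst 0) (fun n => expR (- t) ^+ n)); last exact: cvg_expr.
  apply: nearW => n; rewrite expR_ge0/= -expRM_natr ler_expR.
  rewrite !mulNr lerN2 ler_pM2l// -natrX ler_nat.
  by rewrite (leq_trans (leqnSn n))// expnS expn1 leq_pmulr.
exact: cvg_cst.
Qed.

(** The integral over the line of the derivative of exp(-t x^2) sin (a x). *)
Lemma Rint_gauss1_parts t a : 0 < t ->
  a * \int[leb]_x (cos (a * x + 0) * expR (- t * x ^+ 2)) =
  2 * t * \int[leb]_x (x * sin (a * x) * expR (- t * x ^+ 2)).
Proof.
move=> t0; apply/eqP; rewrite -subr_eq0; apply/eqP.
have l1 := L1Z a (L1_cos_gauss1 a 0 t0).
have l2 := L1Z (2 * t) (L1_sin_gauss1 a t0).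
rewrite -!RintegralZl//; [|exact: L1_sin_gauss1|exact: L1_cos_gauss1].
rewrite -RintegralB//.
apply: (@Rint_total_derivative ((fun x => expR (- t * x ^+ 2)) * (fun x => sin (a * x)))).
- move=> x.
  have h1 := is_derive_gauss1 t x; have h2 := is_derive_sinM a x.
  apply: is_derive_eq; rewrite /GRing.scale/= addr0; ring.
- move=> x; apply: cvgB; apply: cvgM; try exact: cvg_cst; apply: cvgM; try exact: continuous_gauss1.
    apply: continuous_comp; last exact: continuous_cos.
    by apply: cvgD; [apply: cvgM; [exact: cvg_cst|exact: cvg_id]|exact: cvg_cst].
  apply: cvgM; first exact: cvg_id.
  apply: differentiable_continuous; apply/derivable1_diffP.
  exact: (@ex_derive _ _ _ _ _ _ _ (is_derive_sinM a x)).
- exact: L1B.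
- apply: norm_cvg0; apply: (@squeeze_cvgr _ _ _ _ (cst 0) _ _ _ _ _ (cvg_expR_gauss1 t0)); last exact: cvg_cst.
  apply: nearW => n; rewrite normr_ge0/= normrM (ger0_norm (expR_ge0 _)) ler_piMr ?expR_ge0//.
  by rewrite ler_norml sin_geN1 sin_le1.
- apply: norm_cvg0; apply: (@squeeze_cvgr _ _ _ _ (cst 0) _ _ _ _ _ (cvg_expR_gauss1 t0)); last exact: cvg_cst.
  apply: nearW => n; rewrite normr_ge0/= normrM (ger0_norm (expR_ge0 _)) sqrrN ler_piMr ?expR_ge0//.
  by rewrite ler_norml sin_geN1 sin_le1.
Qed.

(** Differentiating under the integral produces the sine moment, which
    integration by parts turns back into the cosine integral. *)
Lemma is_derive_gauss1_fourier t a : 0 < t ->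
  is_derive a 1 (fun a => \int[leb]_x (cos (a * x + 0) * expR (- t * x ^+ 2)))
    (- (a / (2 * t)) * \int[leb]_x (cos (a * x + 0) * expR (- t * x ^+ 2))).
Proof.
move=> t0.
have Ia : (`]a - 1, a + 1[%classic : set R) a by rewrite /= in_itv/= gtrBl ltrDl !ltr01.
pose f a x := cos (a * x + 0) * expR (- t * x ^+ 2).
have df a' x : is_derive a' 1 (f ^~ x) (- x * sin (a' * x) * expR (- t * x ^+ 2)).
  have h := is_derive_cosMl x a'.
  rewrite (_ : f ^~ x = (expR (- t * x ^+ 2)) \*: (fun a' => cos (a' * x))); last first.
    by apply/funext => b; rewrite /f /= /GRing.scale/= addr0 mulrC.
  apply: is_derive_eq; rewrite /GRing.scale/=; ring.
have intf x : (`]a - 1, a + 1[%classic : set R) x -> leb.-integrable setT (EFin \o f x).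
  by move=> _; exact: L1_cos_gauss1.
have derf x y : (`]a - 1, a + 1[%classic : set R) x -> (setT : set R) y -> derivable (f ^~ y) x 1.
  move=> _ _; exact: (@ex_derive _ _ _ _ _ _ _ (df x y)).
have G0 y : 0 <= `|y| * expR (- t * y ^+ 2) :> R by rewrite mulr_ge0 ?expR_ge0.
have bnd x y : (`]a - 1, a + 1[%classic : set R) x -> (setT : set R) y ->
  `| partial1of2 f x y| <= `|y| * expR (- t * y ^+ 2).
  move=> _ _; rewrite /partial1of2 derive1E (@derive_val _ _ _ _ _ _ _ (df x y)).
  rewrite !normrM normrN (ger0_norm (expR_ge0 _)) ler_wpM2r ?expR_ge0//.
  by rewrite ler_piMr// ler_norml sin_geN1 sin_le1.
have d1 := @derivable_under_integral R _ _ leb f setT measurableT a _ _ Ia intf derf _ G0 (L1_abs_gauss1 t0) bnd.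
have d2 := @differentiation_under_integral R _ _ leb f setT measurableT a _ _ Ia intf derf _ G0 (L1_abs_gauss1 t0) bnd.
apply: DeriveDef; first exact: d1.
rewrite -derive1E d2.
have e : \int[leb]_x partial1of2 f a x =
    \int[leb]_x (- 1 * (x * sin (a * x) * expR (- t * x ^+ 2))).
  apply: eq_Rintegral => x _; rewrite /partial1of2 derive1E.
  by rewrite (@derive_val _ _ _ _ _ _ _ (df a x)); ring.
rewrite e RintegralZl//; last exact: L1_sin_gauss1.
have := Rint_gauss1_parts a t0.
set J := Rintegral _ _ _; set S := Rintegral _ _ _ => h.
have -> : S = a * J / (2 * t) by rewrite h; field; rewrite gt_eqF.
by field; rewrite gt_eqF.
Qed.

(** Both sides solve the linear differential equation J' = - a / (2 t) J in the
    frequency a, so that their quotient, K up to a constant, has derivative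
    zero. *)
Lemma Rint_cos_gauss1_0 t a : 0 < t ->
  \int[leb]_x (cos (a * x + 0) * expR (- t * x ^+ 2)) =
  Num.sqrt (pi / t) * expR (- a ^+ 2 / (4 * t)).
Proof.
move=> t0.
pose J a := \int[leb]_x (cos (a * x + 0) * expR (- t * x ^+ 2)).
have dJ a' := is_derive_gauss1_fourier a' t0.
pose K := J * (fun a => expR (- (- (4 * t)^-1) * a ^+ 2)).
have dK a' : is_derive a' 1 K 0.
  have h := is_derive_gauss1 (- (4 * t)^-1) a'; have h' := dJ a'.
  apply: is_derive_eq; rewrite /GRing.scale/= /J; field.
  by rewrite gt_eqF.
have : K a = K 0 by exact: is_derive_0_is_cst.
rewrite /K /= !fctE expr0n/= mulr0 expR0 mulr1.
have -> : J 0 = Num.sqrt (pi / t).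
  rewrite -(Rint_gauss1 0 t0); apply: eq_Rintegral => x _.
  by rewrite mul0r addr0 cos0 mul1r subr0.
move=> e; rewrite -/(J a) -e -mulrA -expRD.
rewrite (_ : _ + _ = 0) ?expR0 ?mulr1//.
by field; rewrite gt_eqF.
Qed.

End gauss1.

(** * Measure-preserving maps *)

Section preserving.
Context d (T : measurableType d) (R : realType).
Variable mu : {measure set T -> \bar R}.
Variable phi : T -> T.
Hypothesis mphi : measurable_fun setT phi.
Hypothesis pphi : forall A, measurable A -> mu (phi @^-1` A)%classic = mu A.
Implicit Type f : T -> R.

Lemma ge0_integral_preserving (f : T -> \bar R) : measurable_fun setT f ->
  (forall x, (0 <= f x)%E) -> (\int[mu]_x f (phi x) = \int[mu]_x f x)%E.
Proof.
move=> mf f0; have := @ge0_integral_pushforward _ _ _ _ _ _ mphi mu setT f measurableT mf.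
rewrite preimage_setT => <-; last by move=> x _; exact: f0.
by apply: eq_measure_integral => A mA _; exact: pphi.
Qed.

Lemma integral_preserving (f : T -> \bar R) : measurable_fun setT f ->
  (\int[mu]_x f (phi x) = \int[mu]_x f x)%E.
Proof.
move=> mf; rewrite integralE [RHS]integralE.
congr (_ - _)%E.
  rewrite (funepos_comp f phi).
  exact: (ge0_integral_preserving (measurable_funepos mf) (@funepos_ge0 _ _ f)).
rewrite (funeneg_comp f phi).
exact: (ge0_integral_preserving (measurable_funeneg mf) (@funeneg_ge0 _ _ f)).
Qed.

Lemma L1_preserving f : L1 mu f -> L1 mu (f \o phi).
Proof.
move=> lf; have mf := L1_meas lf; apply/integrableP; split.
  by apply/measurable_EFinP; exact: measurableT_comp.
rewrite (@integral_preserving (fun x => `|(f x)%:E|%E)).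
  by have /integrableP[] := lf.
by apply: measurableT_comp => //; exact/measurable_EFinP.
Qed.

Lemma Rint_preserving f : measurable_fun setT f ->
  \int[mu]_x f (phi x) = \int[mu]_x f x.
Proof.
by move=> mf; congr fine; rewrite (@integral_preserving (EFin \o f))//; exact/measurable_EFinP.
Qed.

End preserving.

Section line_isometries.
Context {R : realType}.
Local Notation leb := (@lebesgue_measure R).
Local Notation mR := (measurableTypeR R).

Lemma measurable_refl1 (c : R) : measurable_fun setT (fun x : R => c - x).
Proof. exact: measurable_funB. Qed.

(** Reflections permute the half-open intervals and preserve their lengths. *)
Lemma lebesgue_refl1 (c : R) (A : set mR) : measurable A ->
  leb ((fun x : mR => c - x) @^-1` A)%classic = leb A.
Proof.
move=> mA; pose phi : mR -> mR := fun x => c - x.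
have mphi : measurable_fun setT phi by exact: measurable_refl1.
rewrite -[LHS]/(pushforward leb phi A).
apply/esym/lebesgue_measure_unique => //= _ [[a b]] _ <-.
rewrite /pushforward.
rewrite (_ : (phi @^-1` _)%classic = `[c - b, c - a[%classic); last first.
  by apply/seteqP; split => x; rewrite /phi/= !in_itv/=; lra.
rewrite !lebesgue_measure_itv/= !lte_fin ltrD2l ltrN2 !EFinB.
by case: ifPn => // _; congr EFin; rewrite /=; ring.
Qed.

End line_isometries.

(** * Shifted Gaussians with a phase *)

Section gauss1_shift.
Context {R : realType}.
Local Notation leb := (@lebesgue_measure R).
Implicit Types (t a b c x : R).

Lemma Rint_refl1 (f : R -> R) c : measurable_fun setT f ->
  \int[leb]_x f (c - x) = \int[leb]_x f x.
Proof.
exact: (@Rint_preserving _ (measurableTypeR R) R leb _ (measurable_refl1 c) (@lebesgue_refl1 R c)).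
Qed.

Lemma Rint_shift1 (f : R -> R) c : measurable_fun setT f ->
  \int[leb]_x f (x + c) = \int[leb]_x f x.
Proof.
move=> mf; rewrite -(Rint_refl1 0); last first.
  by apply: (measurableT_comp mf); exact: measurable_funD.
rewrite -(Rint_refl1 c mf); apply: eq_Rintegral => x _.
by congr f; ring.
Qed.

Lemma L1_refl1 (f : R -> R) c : L1 leb f -> L1 leb (fun x => f (c - x)).
Proof.
exact: (@L1_preserving _ (measurableTypeR R) R leb _ (measurable_refl1 c) (@lebesgue_refl1 R c)).
Qed.

Lemma L1_shift1 (f : R -> R) c : L1 leb f -> L1 leb (fun x => f (x + c)).
Proof.
move=> lf.
have := L1_refl1 0 (L1_refl1 c lf).
by congr (L1 _ _); apply/funext => x; congr f; ring.
Qed.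

(** A shift centres the Gaussian; the addition formula then leaves the centred
    cosine integral and a sine integral that vanishes by oddness. The phase
    c is what makes the induction on the dimension go through. *)
Lemma Rint_cos_gauss1 t a b c : 0 < t ->
  \int[leb]_x (cos (a * x + c) * expR (- t * (x - b) ^+ 2)) =
  cos (a * b + c) * (Num.sqrt (pi / t) * expR (- a ^+ 2 / (4 * t))).
Proof.
move=> t0.
have lg k : L1 leb (fun x => cos (a * x + k) * expR (- t * x ^+ 2)).
  exact: L1_cos_gauss1.
rewrite -(@Rint_shift1 _ b); last first.
  apply: measurable_funM; first exact: measurable_cos_lin.
  exact: (L1_meas (L1_gauss1 b t0)).
have sin0 : \int[leb]_x (cos (a * x + (- (pi / 2))) * expR (- t * x ^+ 2)) = 0.
  have := Rint_refl1 0 (L1_meas (lg (- (pi / 2)))).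
  have -> : \int[leb]_x (cos (a * (0 - x) + (- (pi / 2))) * expR (- t * (0 - x) ^+ 2)) =
     \int[leb]_x (- 1 * (cos (a * x + (- (pi / 2))) * expR (- t * x ^+ 2))).
    apply: eq_Rintegral => x _; rewrite sub0r sqrrN.
    rewrite (_ : cos (a * - x + _) = - sin (a * x)) ?cosBpihalf; first ring.
    by rewrite mulrN sinN.
  rewrite RintegralZl//; [lra|exact: lg].
rewrite -Rint_cos_gauss1_0//.
have -> : \int[leb]_x (cos (a * (x + b) + c) * expR (- t * (x + b - b) ^+ 2)) =
   \int[leb]_x (cos (a * b + c) * (cos (a * x + 0) * expR (- t * x ^+ 2)) -
      sin (a * b + c) * (cos (a * x + (- (pi / 2))) * expR (- t * x ^+ 2))).
  apply: eq_Rintegral => x _; rewrite addrK addr0 cosBpihalf.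
  rewrite (_ : a * (x + b) + c = (a * x) + (a * b + c)); last by ring.
  rewrite cosD; ring.
rewrite RintegralB ?RintegralZl//; try exact: lg; try exact: L1Z.
by rewrite sin0 mulr0 subr0.
Qed.

End gauss1_shift.

(** * Lebesgue measure on row vectors *)

Section rV_integration.
Context {R : realType}.
Local Notation leb := (@lebesgue_measure R).
Local Notation mu := (@lebesgue_rV R).

Lemma lebesgue_rVS n (A : set 'rV[R]_n.+1) :
  mu n.+1 A = (leb \x mu n)%E (@rV_cons R n @^-1` A)%classic.
Proof. by []. Qed.

Lemma ge0_integral_rVS n (f : 'rV[R]_n.+1 -> \bar R) : measurable_fun setT f ->
  (forall x, (0 <= f x)%E) ->
  (\int[mu n.+1]_x f x = \int[leb \x mu n]_p f (rV_cons p))%E.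
Proof.
move=> mf f0.
have := @ge0_integral_pushforward _ _ _ _ _ _ (@measurable_rV_cons R n) (leb \x mu n)%E setT f measurableT mf.
rewrite preimage_setT; apply; by move=> x _.
Qed.

Lemma integral_rVS n (f : 'rV[R]_n.+1 -> \bar R) : measurable_fun setT f ->
  (\int[mu n.+1]_x f x = \int[leb \x mu n]_p f (rV_cons p))%E.
Proof.
move=> mf; rewrite integralE [RHS]integralE; congr (_ - _)%E.
  rewrite (funepos_comp f (@rV_cons R n)).
  exact: (ge0_integral_rVS (measurable_funepos mf) (@funepos_ge0 _ _ f)).
rewrite (funeneg_comp f (@rV_cons R n)).
exact: (ge0_integral_rVS (measurable_funeneg mf) (@funeneg_ge0 _ _ f)).
Qed.

Lemma Rint_rVS n (f : 'rV[R]_n.+1 -> R) : measurable_fun setT f ->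
  \int[mu n.+1]_x f x = \int[(leb \x mu n)%E]_p f (rV_cons p).
Proof.
by move=> mf; congr fine; rewrite (@integral_rVS _ (EFin \o f))//; exact/measurable_EFinP.
Qed.

Lemma L1_rVS n (f : 'rV[R]_n.+1 -> R) : measurable_fun setT f ->
  L1 (leb \x mu n)%E (fun p => f (rV_cons p)) -> L1 (mu n.+1) f.
Proof.
move=> mf /integrableP[_ h]; apply/integrableP; split; first exact/measurable_EFinP.
rewrite integral_rVS//; apply: measurableT_comp => //; exact/measurable_EFinP.
Qed.

Lemma integral_rV0 (f : 'rV[R]_0 -> \bar R) : measurable_fun setT f ->
  (\int[mu 0]_x f x = f 0%R)%E.
Proof. by move=> mf; rewrite /= integral_dirac// diracT mul1e. Qed.

Lemma rV_unconsK n : cancel (@rV_uncons R n) (@rV_cons R n).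
Proof.
move=> x; apply/rowP => i; rewrite mxE; case: unliftP => [j ->|->]//=.
by rewrite mxE.
Qed.

Lemma dotp_cons n (p q : measurableTypeR R * 'rV[R]_n) :
  dotp (rV_cons p) (rV_cons q) = p.1 * q.1 + dotp p.2 q.2.
Proof.
rewrite /dotp big_ord_recl !mxE unlift_none/=; congr (_ + _).
by apply: eq_bigr => i _; rewrite !mxE liftK.
Qed.

Lemma rV_consB n (p q : measurableTypeR R * 'rV[R]_n) :
  rV_cons p - rV_cons q = rV_cons ((p.1 : R) - q.1, p.2 - q.2).
Proof. by apply/rowP => i; rewrite !mxE; case: unliftP => [j _|_]//=; rewrite !mxE. Qed.

Lemma dotpC n (x y : 'rV[R]_n) : dotp x y = dotp y x.
Proof. by apply: eq_bigr => i _; rewrite mulrC. Qed.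

Lemma dotpBr n (x y z : 'rV[R]_n) : dotp x (y - z) = dotp x y - dotp x z.
Proof. by rewrite /dotp -sumrB; apply: eq_bigr => i _; rewrite !mxE mulrBr. Qed.

Lemma dotpBl n (x y z : 'rV[R]_n) : dotp (y - z) x = dotp y x - dotp z x.
Proof. by rewrite dotpC dotpBr !(dotpC x). Qed.

Lemma dotp_ge0 n (x : 'rV[R]_n) : 0 <= dotp x x.
Proof. by apply: sumr_ge0 => i _; exact: sqr_ge0. Qed.

Lemma dotp_sym n (x y : 'rV[R]_n) : dotp (x - y) (x - y) = dotp (y - x) (y - x).
Proof. by apply: eq_bigr => i _; rewrite !mxE; ring. Qed.

Lemma enorm_sqr n (x : 'rV[R]_n) : enorm x ^+ 2 = dotp x x.
Proof. by rewrite /enorm sqr_sqrtr// dotp_ge0. Qed.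

Lemma measurable_dotp d (T : measurableType d) n (f g : T -> 'rV[R]_n) :
  measurable_fun setT f -> measurable_fun setT g ->
  measurable_fun setT (fun x => dotp (f x) (g x)).
Proof.
move=> mf mg; apply: measurable_sum => i; apply: measurable_funM.
  exact: (measurableT_comp (measurable_rV_coord i) mf).
exact: (measurableT_comp (measurable_rV_coord i) mg).
Qed.

Lemma measurable_rVB d (T : measurableType d) n (f g : T -> 'rV[R]_n) :
  measurable_fun setT f -> measurable_fun setT g ->
  measurable_fun setT (fun x => f x - g x).
Proof.
move=> mf mg; apply: measurable_fun_rVP => i; under eq_fun do rewrite !mxE.
apply: measurable_funB.
  exact: (measurableT_comp (measurable_rV_coord i) mf).
exact: (measurableT_comp (measurable_rV_coord i) mg).
Qed.

Lemma measurable_sqdist d (T : measurableType d) n (f g : T -> 'rV[R]_n) :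
  measurable_fun setT f -> measurable_fun setT g ->
  measurable_fun setT (fun x => dotp (f x - g x) (f x - g x)).
Proof. by move=> mf mg; apply: measurable_dotp; exact: measurable_rVB. Qed.

Lemma measurable_expRM d (T : measurableType d) (k : R) (f : T -> R) :
  measurable_fun setT f -> measurable_fun setT (fun x => expR (k * f x)).
Proof.
by move=> mf; apply: (measurableT_comp (@measurable_expR R)); exact: measurable_funM.
Qed.

Lemma measurable_cosR d (T : measurableType d) (f : T -> R) :
  measurable_fun setT f -> measurable_fun setT (fun x => cos (f x)).
Proof.
move=> mf; apply: (measurableT_comp _ mf).
exact: (continuous_measurable_fun (@continuous_cos R)).
Qed.

Lemma measurable_rV_gauss n (t : R) (b : 'rV[R]_n) :
  measurable_fun setT (fun x : 'rV[R]_n => expR (- t * dotp (x - b) (x - b))).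
Proof. by apply: measurable_expRM; exact: measurable_sqdist. Qed.

Lemma rV_gauss_cons n (t : R) (b : 'rV[R]_n.+1) p :
  expR (- t * dotp (rV_cons p - b) (rV_cons p - b)) =
  expR (- t * ((p.1 : R) - (rV_uncons b).1) ^+ 2) *
  expR (- t * dotp (p.2 - (rV_uncons b).2) (p.2 - (rV_uncons b).2)).
Proof. by rewrite -(rV_unconsK b) rV_consB dotp_cons rV_consK mulrDr expRD. Qed.

Lemma L1_rV_gauss n (t : R) (b : 'rV[R]_n) : 0 < t ->
  L1 (mu n) (fun x : 'rV[R]_n => expR (- t * dotp (x - b) (x - b))).
Proof.
move=> t0; elim: n b => [|n IHn] b.
  apply/integrableP; split; first by apply/measurable_EFinP; apply: measurable_rV_gauss.
  rewrite integral_rV0 ?ltry//.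
  by apply: measurableT_comp => //; apply/measurable_EFinP; apply: measurable_rV_gauss.
apply: L1_rVS; first exact: measurable_rV_gauss.
under eq_fun do rewrite rV_gauss_cons.
apply: (@L1_prodM _ _ (measurableTypeR R) _ R leb (mu n)
  (fun x => expR (- t * (x - (rV_uncons b).1) ^+ 2)) _ _ (IHn _)).
exact: L1_gauss1.
Qed.

Lemma L1_rV_cos_gauss n (t : R) (a b : 'rV[R]_n) c : 0 < t ->
  L1 (mu n) (fun x : 'rV[R]_n => cos (dotp a x + c) * expR (- t * dotp (x - b) (x - b))).
Proof.
move=> t0; apply: (@L1_bndM _ _ _ (mu n) 1); last exact: L1_rV_gauss.
  by apply: measurable_cosR; apply: measurable_funD => //; exact: measurable_dotp.
by move=> x; rewrite ler_norml cos_geN1 cos_le1.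
Qed.

(** By Fubini the first coordinate is integrated last; its contribution to
    the scalar product enters the remaining integral as an additional phase,
    so that the induction runs without complex exponentials. *)
Lemma Rint_rV_cos_gauss n (t : R) (a b : 'rV[R]_n) c : 0 < t ->
  \int[mu n]_x (cos (dotp a x + c) * expR (- t * dotp (x - b) (x - b))) =
  cos (dotp a b + c) * (Num.sqrt (pi / t) ^+ n * expR (- dotp a a / (4 * t))).
Proof.
move=> t0; elim: n a b c => [|n IHn] a b c.
  rewrite /Rintegral integral_rV0; last first.
    exact: (measurable_int _ (@L1_rV_cos_gauss 0 t a b c t0)).
  by rewrite /= /dotp !big_ord0 mulr0 expr0 oppr0 mul0r expR0 !mulr1.
rewrite Rint_rVS; last exact: (L1_meas (@L1_rV_cos_gauss n.+1 t a b c t0)).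
set F := fun p => _.
have lF : L1 (leb \x mu n)%E F.
  rewrite /F; under eq_fun do rewrite rV_gauss_cons.
  apply: (@L1_bndM _ _ _ _ 1).
  - apply: measurable_cosR; apply: measurable_funD => //.
    by apply: measurable_dotp => //; exact: measurable_rV_cons.
  - by move=> x; rewrite ler_norml cos_geN1 cos_le1.
  - exact: (@L1_prodM _ _ (measurableTypeR R) _ R leb (mu n)
      (fun x => expR (- t * (x - (rV_uncons b).1) ^+ 2)) _ (L1_gauss1 _ t0) (L1_rV_gauss _ t0)).
rewrite -(Rint_prod1 lF).
have [[a1 a2] aE] : {p | a = rV_cons p} by exists (rV_uncons a); rewrite rV_unconsK.
have [[b1 b2] bE] : {p | b = rV_cons p} by exists (rV_uncons b); rewrite rV_unconsK.
pose K := Num.sqrt (pi / t) ^+ n * expR (- dotp a2 a2 / (4 * t)).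
transitivity (\int[leb]_x
  (cos (a1 * x + (dotp a2 b2 + c)) * expR (- t * (x - (b1 : R)) ^+ 2) * K)).
  apply: eq_Rintegral => x _; rewrite /F.
  have e y : cos (dotp a (rV_cons (x, y)) + c) *
      expR (- t * dotp (rV_cons (x, y) - b) (rV_cons (x, y) - b)) =
      expR (- t * ((x : R) - b1) ^+ 2) *
      (cos (dotp a2 y + ((a1 : R) * x + c)) * expR (- t * dotp (y - b2) (y - b2))).
    rewrite rV_gauss_cons bE rV_consK/= aE dotp_cons/=.
    by rewrite (_ : _ + c = dotp a2 y + ((a1 : R) * x + c)); ring.
  under eq_Rintegral do rewrite e.
  rewrite RintegralZl//; last exact: L1_rV_cos_gauss.
  rewrite IHn -/K.
  have -> : dotp a2 b2 + ((a1 : R) * x + c) = a1 * x + (dotp a2 b2 + c) by ring.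
  by rewrite mulrCA mulrA.
rewrite RintegralZr//; last first.
  have := L1_shift1 (- (b1 : R)) (L1_cos_gauss1 a1 (a1 * b1 + (dotp a2 b2 + c)) t0).
  by congr (L1 _ _); apply/funext => x; congr (cos _ * _); ring.
rewrite Rint_cos_gauss1// aE bE !dotp_cons/= -mulrA -addrA; congr (cos _ * _).
have -> : - ((a1 : R) * a1 + dotp a2 a2) / (4 * t) =
    - (a1 : R) ^+ 2 / (4 * t) + - dotp a2 a2 / (4 * t) by field; rewrite gt_eqF.
rewrite expRD /K (exprS _ n); ring.
Qed.

Corollary Rint_rV_gauss n (t : R) (b : 'rV[R]_n) : 0 < t ->
  \int[mu n]_x expR (- t * dotp (x - b) (x - b)) = Num.sqrt (pi / t) ^+ n.
Proof.
move=> t0; have := Rint_rV_cos_gauss 0 b 0 t0.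
have d0 (y : 'rV[R]_n) : dotp 0 y = 0.
  by rewrite /dotp big1// => i _; rewrite mxE mul0r.
rewrite !d0 addr0 cos0 mul1r oppr0 mul0r expR0 mulr1 => <-.
by apply: eq_Rintegral => x _; rewrite d0 addr0 cos0 mul1r.
Qed.

End rV_integration.

(** * Reflection in the first coordinate *)

Section reflection.
Context {R : realType} (n : nat).
Local Notation leb := (@lebesgue_measure R).
Local Notation mu := (@lebesgue_rV R).
Implicit Types (c : R) (x y : 'rV[R]_n.+1).

Definition refl c x : 'rV[R]_n.+1 :=
  rV_cons (2 * c - x ord0 ord0 : measurableTypeR R, (rV_uncons x).2).

Lemma refl_cons c (p : measurableTypeR R * 'rV[R]_n) :
  refl c (rV_cons p) = rV_cons (2 * c - p.1 : measurableTypeR R, p.2).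
Proof. by rewrite /refl -[_ ord0 ord0]/((rV_uncons (rV_cons p)).1) rV_consK. Qed.

Lemma reflK c : involutive (refl c).
Proof.
move=> x; rewrite -(rV_unconsK x); move: (rV_uncons x) => [a b]; rewrite !refl_cons/=.
by congr (rV_cons (_, _)); exact: (@subKr R (2 * c) a).
Qed.

Lemma refl0E c x : refl c x ord0 ord0 = 2 * c - x ord0 ord0.
Proof. by rewrite mxE unlift_none. Qed.

Lemma rV_coord0 (p : measurableTypeR R * 'rV[R]_n) : rV_cons p ord0 ord0 = p.1.
Proof. by rewrite mxE unlift_none. Qed.

Lemma measurable_refl c : measurable_fun setT (refl c).
Proof.
apply: (measurableT_comp (@measurable_rV_cons R n)).
apply: measurable_fun_pair.
  by apply: measurable_funB => //; exact: measurable_rV_coord.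
exact: (measurableT_comp measurable_snd (@measurable_rV_uncons R n)).
Qed.

Lemma sqdist_refl c x y :
  dotp (refl c x - refl c y) (refl c x - refl c y) = dotp (x - y) (x - y).
Proof.
rewrite -(rV_unconsK x) -(rV_unconsK y) !refl_cons !rV_consB !dotp_cons/=.
by congr (_ + _); ring.
Qed.

Lemma sqdist_reflC c x y :
  dotp (refl c x - y) (refl c x - y) = dotp (x - refl c y) (x - refl c y).
Proof. by rewrite -(sqdist_refl c) reflK. Qed.

(** In particular two points on the same side of the mirror are closer to each
    other than to each other's image: the heat kernel favours pairs on the
    same side. *)
Lemma sqdist_reflr c x y : dotp (x - refl c y) (x - refl c y) =
  dotp (x - y) (x - y) + 4 * ((c - x ord0 ord0) * (c - y ord0 ord0)).
Proof.
rewrite -(rV_unconsK x) -(rV_unconsK y) !refl_cons !rV_consB !dotp_cons !rV_coord0/=.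
by ring.
Qed.

(** For c >= 0 a point before the mirror is closer to the origin than its
    image, hence belongs to a centred ball whenever its image does. *)
Lemma sqnorm_refl c x :
  dotp (refl c x) (refl c x) = dotp x x + 4 * (c * (c - x ord0 ord0)).
Proof. by rewrite -(rV_unconsK x) !refl_cons !dotp_cons !rV_coord0/=; ring. Qed.

(** Measure by sections along the first axis, the only direction that a
    reflection moves. *)
Lemma lebesgue_rV_sections (A : set 'rV[R]_n.+1) : measurable A -> mu n.+1 A =
  (\int[mu n]_y \int[leb]_x (\1_A (rV_cons (x, y)) : R)%:E)%E.
Proof.
move=> mA; pose f p : \bar R := (\1_A (rV_cons p : 'rV[R]_n.+1) : R)%:E.
have mf : measurable_fun setT f.
  apply/measurable_EFinP.
  exact: (measurableT_comp (measurable_indic mA) (@measurable_rV_cons R n)).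
have f0 p : (0 <= f p)%E by rewrite lee_fin.
transitivity (\int[mu n.+1]_x (\1_A x : R)%:E)%E.
  by rewrite integral_indic// setIT.
rewrite ge0_integral_rVS//; last exact/measurable_EFinP.
exact: (@fubini_tonelli2 _ _ _ _ _ leb (mu n) f mf f0).
Qed.

Lemma lebesgue_refl c (A : set 'rV[R]_n.+1) : measurable A ->
  mu n.+1 (refl c @^-1` A)%classic = mu n.+1 A.
Proof.
move=> mA.
have mrA : measurable (refl c @^-1` A)%classic.
  by rewrite -[X in measurable X]setTI; exact: measurable_refl.
rewrite (lebesgue_rV_sections mrA) (lebesgue_rV_sections mA); apply: eq_integral => y _.
have mf : measurable_fun setT (fun x : R => (\1_A (rV_cons (x, y)) : R)%:E).
  apply/measurable_EFinP; apply: (measurableT_comp (measurable_indic mA)).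
  exact: (measurableT_comp (@measurable_rV_cons R n) (measurable_pair2 y)).
rewrite -[RHS](@ge0_integral_preserving _ (measurableTypeR R) R leb _
  (measurable_refl1 (2 * c)) (@lebesgue_refl1 R (2 * c)))//.
by apply: eq_integral => x _; rewrite !indicE -(refl_cons c (x, y)).
Qed.

Lemma Rint_refl c (f : 'rV[R]_n.+1 -> R) : measurable_fun setT f ->
  \int[mu n.+1]_x f (refl c x) = \int[mu n.+1]_x f x.
Proof. exact: (Rint_preserving (measurable_refl c) (@lebesgue_refl c)). Qed.

Lemma L1_refl c (f : 'rV[R]_n.+1 -> R) :
  L1 (mu n.+1) f -> L1 (mu n.+1) (fun x => f (refl c x)).
Proof. exact: (L1_preserving (measurable_refl c) (@lebesgue_refl c)). Qed.

Lemma L2_refl c (f : 'rV[R]_n.+1 -> R) :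
  L2 (mu n.+1) f -> L2 (mu n.+1) (fun x => f (refl c x)).
Proof.
move=> [mf lf]; split; first exact: (measurableT_comp mf (measurable_refl c)).
exact: (@L1_refl c (fun x => f x ^+ 2)).
Qed.

(** Almost every line parallel to the first axis meets a sphere in at most two
    points. *)
Lemma sphere_null (r : R) : mu n.+1 [set x | dotp x x = r]%classic = 0%E.
Proof.
have mS : measurable [set x : 'rV[R]_n.+1 | dotp x x = r]%classic.
  have mf : measurable_fun setT (fun x : 'rV[R]_n.+1 => dotp x x).
    exact: measurable_dotp.
  by have := mf measurableT [set r]%classic (measurable_set1 r); rewrite setTI.
rewrite (lebesgue_rV_sections mS) integral0_eq// => y _.
pose S := [set x : R | dotp (rV_cons (x, y)) (rV_cons (x, y)) = r]%classic.
have cS : countable S.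
  apply: (@sub_countable _ _ _ [set Num.sqrt (r - dotp y y); - Num.sqrt (r - dotp y y)]%classic).
    apply: subset_card_le => x; rewrite /S/= dotp_cons/= => xr.
    have -> : r - dotp y y = x ^+ 2 by rewrite -xr addrK.
    by rewrite sqrtr_sqr; case: (lerP 0 x) => x0; [left; rewrite ger0_norm|right; rewrite ltr0_norm ?opprK].
  by apply: finite_set_countable; exact: finite_set2.
have mSy : measurable (S : set (measurableTypeR R)).
  have mf : measurable_fun setT (fun x : R => dotp (rV_cons (x, y)) (rV_cons (x, y))).
    apply: measurable_dotp;
      exact: (measurableT_comp (@measurable_rV_cons R n) (measurable_pair2 y)).
  by have := mf measurableT [set r]%classic (measurable_set1 r); rewrite setTI.
transitivity (\int[leb]_x (\1_S x : R)%:E)%E; last first.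
  by rewrite integral_indic// setIT; exact: countable_lebesgue_measure0.
by apply: eq_integral => x _; rewrite !indicE.
Qed.

End reflection.

Section boxes.
Context {R : realType}.
Local Notation leb := (@lebesgue_measure R).
Local Notation mu := (@lebesgue_rV R).

(** Open sets have positive measure, in the form needed to pass from a strict
    inequality between continuous functions to a set of positive measure. *)
Lemma box_gt0 n (x : 'rV[R]_n) (e : R) : 0 < e ->
  exists2 B : set 'rV[R]_n, measurable B /\ (B `<=` [set y : 'rV[R]_n | forall i, `|x ord0 i - y ord0 i| < e])%classic &
    (0 < mu n B)%E.
Proof.
move=> e0; elim: n x => [|n IHn] x.
  exists setT; first by split => // y _ [].
  by rewrite /= diracT.
have [B [mB Bx] B0] := IHn (rV_uncons x).2.
pose I : set (measurableTypeR R) := `]x ord0 ord0 - e, x ord0 ord0 + e[%classic.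
have mI : measurable I by exact: measurable_itv.
exists (@rV_uncons R n @^-1` (I `*` B))%classic.
  split.
    rewrite -[X in measurable X]setTI; apply: measurable_rV_uncons => //.
    exact: measurableX.
  move=> y [/= Iy By] i; have [j ->|->] := unliftP ord0 i.
    by have := Bx _ By j; rewrite !mxE.
  by move: Iy; rewrite /I/= in_itv/= ltr_distl => /andP[h1 h2]; lra.
rewrite lebesgue_rVS -comp_preimage (_ : _ \o _ = id); last first.
  by apply/funext => p; exact: rV_consK.
rewrite preimage_id product_measure1E// mule_gt0//.
rewrite -[X in (0 < X)%E]/(leb `]x ord0 ord0 - e, x ord0 ord0 + e[%classic).
rewrite lebesgue_measure_itv/= lte_fin ifT; last by lra.
by rewrite -EFinB lte_fin; lra.
Qed.

End boxes.

(** * The heat semigroup *)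

Section heat.
Context {R : realType} (d : nat).
Local Notation V := 'rV[R]_d.
Local Notation mu := (@lebesgue_rV R d).
Implicit Types (t : R) (x y : V) (f g psi : V -> R).

Definition heat_peak t : R := (Num.sqrt (4 * pi * t) ^+ d)^-1.
Definition heat_kernel t (z : V) : R := heat_peak t * expR (- (4 * t)^-1 * dotp z z).
Definition heat t f x : R := \int[mu]_y (heat_kernel t (x - y) * f y).

Lemma heat_peak_gt0 t : 0 < t -> 0 < heat_peak t.
Proof. by move=> t0; rewrite invr_gt0 exprn_gt0// sqrtr_gt0 !mulr_gt0 ?pi_gt0. Qed.

Lemma heat_kernel_gt0 t (z : V) : 0 < t -> 0 < heat_kernel t z.
Proof. by move=> t0; rewrite mulr_gt0 ?heat_peak_gt0 ?expR_gt0. Qed.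

Lemma heat_kernel_ge0 t (z : V) : 0 < t -> 0 <= heat_kernel t z.
Proof. by move=> t0; exact/ltW/heat_kernel_gt0. Qed.

Lemma heat_kernel_le t (z : V) : 0 < t -> heat_kernel t z <= heat_peak t.
Proof.
move=> t0; rewrite ler_piMr// ?(ltW (heat_peak_gt0 _))// expR_le1 mulNr oppr_le0.
by rewrite mulr_ge0 ?dotp_ge0// invr_ge0 mulr_ge0// ltW.
Qed.

Lemma heat_kernel_sym t x y : heat_kernel t (x - y) = heat_kernel t (y - x).
Proof. by rewrite /heat_kernel dotp_sym. Qed.

Lemma measurable_heat_kernel dT (T : measurableType dT) t (f g : T -> V) :
  measurable_fun setT f -> measurable_fun setT g ->
  measurable_fun setT (fun u => heat_kernel t (f u - g u)).
Proof.
by move=> mf mg; apply: measurable_funM => //; apply: measurable_expRM; exact: measurable_sqdist.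
Qed.

Lemma measurable_heat_kernel2 t :
  measurable_fun setT (fun z : V * V => heat_kernel t (z.1 - z.2)).
Proof. exact: measurable_heat_kernel. Qed.

Lemma L1_heat_kernel t x : 0 < t -> L1 mu (fun y => heat_kernel t (x - y)).
Proof.
move=> t0; under eq_fun do rewrite heat_kernel_sym.
by apply: L1Z; apply: L1_rV_gauss; rewrite invr_gt0 mulr_gt0.
Qed.

Lemma Rint_heat_kernel t x : 0 < t -> \int[mu]_y heat_kernel t (x - y) = 1.
Proof.
move=> t0; have t40 : 0 < (4 * t)^-1 by rewrite invr_gt0 mulr_gt0.
under eq_Rintegral do rewrite heat_kernel_sym.
rewrite RintegralZl//; last exact: L1_rV_gauss.
rewrite Rint_rV_gauss// invrK (_ : pi * (4 * t) = 4 * pi * t); last by ring.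
by rewrite mulVf// gt_eqF// exprn_gt0// sqrtr_gt0 !mulr_gt0 ?pi_gt0.
Qed.

Lemma heat_kernel_norm t (z : V) : 0 < t -> `|heat_kernel t z| <= heat_peak t.
Proof. by move=> t0; rewrite ger0_norm ?heat_kernel_le ?heat_kernel_ge0. Qed.

Lemma L2_heat_kernel t x : 0 < t -> L2 mu (fun y => heat_kernel t (x - y)).
Proof.
move=> t0; have lk := L1_heat_kernel x t0; split; first exact: L1_meas lk.
by apply: (@L1_bndM _ _ _ mu (heat_peak t)) => //; [exact: L1_meas lk|move=> y; exact: heat_kernel_norm].
Qed.

Lemma L1_heatM t g x : 0 < t -> L1 mu g -> L1 mu (fun y => heat_kernel t (x - y) * g y).
Proof.
move=> t0; apply: (@L1_bndM _ _ _ mu (heat_peak t)); first exact: (L1_meas (L1_heat_kernel x t0)).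
by move=> y; exact: heat_kernel_norm.
Qed.

Lemma L1_heat2 t g : 0 < t -> L1 mu g ->
  L1 (mu \x mu)%E (fun z => heat_kernel t (z.1 - z.2) * g z.2).
Proof.
move=> t0 lg.
have : L1 (mu \x mu)%E (fun z : V * V => heat_kernel t (z.2 - z.1) * g z.1).
  apply: L1_prodP => /=.
  - apply: measurable_funM; first exact: measurable_heat_kernel.
    exact: (measurableT_comp (L1_meas lg) measurable_fst).
  - move=> x; under eq_fun do rewrite mulrC heat_kernel_sym.
    exact/L1Z/L1_heat_kernel.
  - have : L1 mu (fun x => `|g x|) by exact: L1_norm.
    congr (L1 _ _); apply/funext => x.
    under eq_Rintegral do rewrite normrM mulrC (ger0_norm (heat_kernel_ge0 _ t0)) heat_kernel_sym.
    by rewrite RintegralZl ?Rint_heat_kernel ?mulr1//; exact: L1_heat_kernel.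
by move=> /L1_swap.
Qed.

Lemma L1_heat t g : 0 < t -> L1 mu g -> L1 mu (heat t g).
Proof. by move=> t0 lg; exact: (L1_prod1 (L1_heat2 t0 lg)). Qed.

Lemma Rint_heat t g : 0 < t -> L1 mu g -> \int[mu]_x heat t g x = \int[mu]_x g x.
Proof.
move=> t0 lg; rewrite (Rint_swap (L1_heat2 t0 lg)); apply: eq_Rintegral => y _ /=.
under eq_Rintegral do rewrite mulrC heat_kernel_sym.
by rewrite RintegralZl ?Rint_heat_kernel ?mulr1//; exact: L1_heat_kernel.
Qed.

Lemma measurable_heat t g : measurable_fun setT g -> measurable_fun setT (heat t g).
Proof.
move=> mg.
have mF : measurable_fun setT (fun z : V * V => heat_kernel t (z.1 - z.2) * g z.2).
  apply: measurable_funM; first exact: measurable_heat_kernel2.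
  exact: (measurableT_comp mg measurable_snd).
exact: (measurable_Rint2 mu mF).
Qed.

(** Jensen's inequality: the kernel is a probability density, and the difference
    of the two sides is a variance. *)
Lemma heat_jensen t f x : 0 < t -> L2 mu f ->
  (heat t f x) ^+ 2 <= heat t (fun y => f y ^+ 2) x.
Proof.
move=> t0 [mf lf].
have l1 : L1 mu (fun y => heat_kernel t (x - y) * f y).
  by apply: L1_L2M => //; exact: L2_heat_kernel.
have l2 := L1_heatM x t0 lf.
have lk := L1_heat_kernel x t0.
set A := heat t f x.
have l12 : L1 mu (fun y => heat_kernel t (x - y) * f y ^+ 2 - 2 * A * (heat_kernel t (x - y) * f y)).
  by apply: L1B => //; exact: L1Z.
suff : 0 <= heat t (fun y => f y ^+ 2) x - 2 * A * A + A ^+ 2 * 1 by lra.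
have <- : \int[mu]_y (heat_kernel t (x - y) * f y ^+ 2 -
    2 * A * (heat_kernel t (x - y) * f y) + A ^+ 2 * heat_kernel t (x - y)) =
    heat t (fun y => f y ^+ 2) x - 2 * A * A + A ^+ 2 * 1.
  rewrite RintegralD//; last exact: L1Z.
  rewrite RintegralB//; last exact: L1Z.
  by rewrite RintegralZl// (@RintegralZl _ _ _ mu setT (fun y => heat_kernel t (x - y)))// Rint_heat_kernel.
apply: Rintegral_ge0 => y _.
rewrite (_ : _ + _ = heat_kernel t (x - y) * (f y - A) ^+ 2); last by ring.
by rewrite mulr_ge0 ?heat_kernel_ge0 ?sqr_ge0.
Qed.

Lemma L2_heat t f : 0 < t -> L2 mu f -> L2 mu (heat t f).
Proof.
move=> t0 lf; have mh := measurable_heat t lf.1; split => //.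
apply: (L1_le _ _ (L1_heat t0 lf.2)); first exact: measurable_funX.
by move=> x; rewrite ger0_norm ?sqr_ge0 ?heat_jensen.
Qed.

(** Jensen's inequality and conservation of the integral. *)
Lemma nrm2_heat t f : 0 < t -> L2 mu f -> nrm2 mu (heat t f) <= nrm2 mu f.
Proof.
move=> t0 lf; apply: ler_wsqrtr; rewrite -(Rint_heat t0 lf.2).
apply: le_Rint; [exact: (L2_heat t0 lf).2|exact: L1_heat t0 lf.2|].
by move=> x; exact: heat_jensen.
Qed.

(** |f(x) g(y)| <= f(x)^2 + g(y)^2, and the kernel integrates to one in each
    variable. *)
Lemma L1_heat_pair t f g : 0 < t -> L2 mu f -> L2 mu g ->
  L1 (mu \x mu)%E (fun z => f z.1 * (heat_kernel t (z.1 - z.2) * g z.2)).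
Proof.
move=> t0 lf lg.
have mk := measurable_heat_kernel2 t.
have mf : measurable_fun setT (fun z : V * V => f z.1).
  exact: (measurableT_comp lf.1 measurable_fst).
have mg : measurable_fun setT (fun z : V * V => g z.2).
  exact: (measurableT_comp lg.1 measurable_snd).
have l1 := L1_heat2 t0 lg.2.
have l2 : L1 (mu \x mu)%E (fun z => heat_kernel t (z.1 - z.2) * f z.1 ^+ 2).
  have /L1_swap := L1_heat2 t0 lf.2; congr (L1 _ _); apply/funext => z /=.
  by rewrite heat_kernel_sym.
apply: (L1_le _ _ (L1D l1 l2)); first by apply: measurable_funM => //; exact: measurable_funM.
move=> z; have k0 := heat_kernel_ge0 (z.1 - z.2) t0.
rewrite mulrCA normrM ger0_norm// -mulrDr ler_wpM2l// ler_norml; apply/andP; split; nra.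
Qed.

End heat.

(** * Convergence of heat averages at points of continuity *)

Section heat_continuity.
Context {R : realType} (d : nat).
Local Notation V := 'rV[R]_d.
Local Notation mu := (@lebesgue_rV R d).
Implicit Types (t r : R) (x y : V) (psi : V -> R).

(** Continuity at x expressed with the Euclidean distance, which is the one
    that the heat kernel sees; r is a squared radius. *)
Definition econtinuous psi x := forall e : R, 0 < e ->
  exists2 r, 0 < r & forall y, dotp (x - y) (x - y) < r -> `|psi y - psi x| <= e.

Lemma heat_peak2 t : 0 < t -> heat_peak d t = Num.sqrt 2 ^+ d * heat_peak d (2 * t).
Proof.
move=> t0; rewrite /heat_peak (_ : 4 * pi * (2 * t) = 2 * (4 * pi * t)); last by ring.
by rewrite (@sqrtrM _ 2)// exprMn invfM mulrA divff ?mul1r//.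
Qed.

Lemma heat_peak_le t : 0 < t -> t <= 1 -> heat_peak d t <= t^-1 ^+ d.
Proof.
move=> t0 t1; rewrite /heat_peak exprVn lef_pV2 ?posrE ?exprn_gt0 ?sqrtr_gt0 ?mulr_gt0 ?pi_gt0//.
apply: lerXn2r; rewrite ?nnegrE ?sqrtr_ge0 ?(ltW t0)//.
rewrite -(ler_pXn2r (ltn0Sn 1)) ?nnegrE ?sqrtr_ge0 ?(ltW t0)//.
rewrite sqr_sqrtr; last by rewrite !mulr_ge0 ?pi_ge0// ltW.
apply: (@le_trans _ _ t); first by rewrite expr2 ler_piMl// ltW.
rewrite ler_peMl ?(ltW t0)//; have := @pi_ge2 R; lra.
Qed.

(** Away from the origin half of the Gaussian exponent is given up in exchange
    for an exponentially small factor; what remains is a kernel with total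
    mass independent of t. *)
Lemma heat_kernel_far1 t r (z : V) : 0 < t -> r <= dotp z z ->
  heat_kernel t z <= expR (- (r / 8) / t) * (Num.sqrt 2 ^+ d * heat_kernel (2 * t) z).
Proof.
move=> t0 rz; rewrite /heat_kernel heat_peak2//.
have -> : expR (- (4 * t)^-1 * dotp z z) =
    expR (- (dotp z z / 8) / t) * expR (- (4 * (2 * t))^-1 * dotp z z).
  by rewrite -expRD; congr expR; field; rewrite gt_eqF.
set E := expR (- (4 * (2 * t))^-1 * dotp z z); set P := heat_peak d (2 * t).
have C0 : 0 <= Num.sqrt 2 ^+ d * (P * E).
  rewrite mulr_ge0 ?exprn_ge0 ?sqrtr_ge0// mulr_ge0 ?expR_ge0//.
  by apply/ltW/heat_peak_gt0; rewrite mulr_gt0.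
rewrite (_ : _ * P * _ = expR (- (dotp z z / 8) / t) * (Num.sqrt 2 ^+ d * (P * E))).
  by apply: ler_wpM2r => //; rewrite ler_expR ler_pM2r ?invr_gt0//; lra.
ring.
Qed.

(** The exponential decay absorbs the singularity t^(-d/2) of the peak. *)
Lemma heat_kernel_far2 t r (z : V) : 0 < t -> t <= 1 -> 0 < r -> r <= dotp z z ->
  heat_kernel t z <= expR (- (r / 8) / t) * (8 * d.+1%:R / r) ^+ d.
Proof.
move=> t0 t1 r0 rz.
(* t^-1 is a multiple of u, and u^d <= exp(u d) <= exp(r / (8 t)). *)
pose u := r / (8 * t * d.+1%:R).
have u0 : 0 < u by rewrite divr_gt0// !mulr_gt0.
have tu : t^-1 = 8 * d.+1%:R / r * u.
  by rewrite /u; field; rewrite !gt_eqF//=.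
have ud : u * d%:R <= r / 8 / t.
  have -> : r / 8 / t = u * d.+1%:R by rewrite /u; field; rewrite !gt_eqF//=.
  by rewrite ler_pM2l// ler_nat.
apply: (@le_trans _ _ ((8 * d.+1%:R / r) ^+ d * expR (u * d%:R) * expR (- (r / 4) / t))).
  apply: ler_pM; rewrite ?expR_ge0 ?(ltW (heat_peak_gt0 _ _))//.
    apply: (le_trans (heat_peak_le t0 t1)).
    rewrite tu exprMn ler_wpM2l//.
      by rewrite exprn_ge0// divr_ge0 ?mulr_ge0 ?(ltW r0).
    rewrite expRM_natr; apply: lerXn2r; rewrite ?nnegrE ?expR_ge0 ?(ltW u0)//.
    by have := expR_ge1Dx u; lra.
  rewrite ler_expR; have -> : - (r / 4) / t = - (4 * t)^-1 * r by field; rewrite gt_eqF.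
  by rewrite !mulNr lerN2 ler_pM2l// invr_gt0 mulr_gt0.
rewrite -mulrA mulrC -expRD ler_wpM2r ?exprn_ge0 ?divr_ge0 ?mulr_ge0 ?(ltW r0)//.
rewrite ler_expR; have -> : - (r / 4) / t = - (r / 8 / t) - (r / 8 / t) by field; rewrite gt_eqF.
have -> : - (r / 8) / t = - (r / 8 / t) by rewrite mulNr.
lra.
Qed.

Lemma cvg_expR_nat (k : R) : 0 < k ->
  (expR (- k / n.+1%:R^-1) @[n --> \oo] --> (0 : R))%classic.
Proof.
move=> k0; have e1 : `|expR (- k)| < 1 by rewrite ger0_norm ?expR_ge0// expR_lt1 oppr_lt0.
have := cvg_expr e1; rewrite -(cvg_shiftn 1) => h.
by under eq_fun do rewrite invrK expRM_natr -addn1.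
Qed.

(** Away from x both the mass and the height of the kernel are at most
    exp(-const / t), which controls the constant psi x and the
    square-integrable psi respectively; near x the average sees only values
    close to psi x. *)
Lemma heat_cvg psi x : L2 mu psi -> econtinuous psi x ->
  (heat n.+1%:R^-1 psi x @[n --> \oo] --> psi x)%classic.
Proof.
move=> lp cp; apply/cvgrPdist_le => e e0.
have e20 : 0 < e / 2 by rewrite divr_gt0.
have [r r0 hr] := cp _ e20.
pose B := Num.sqrt 2 ^+ d * (1 + `|psi x|) : R.
pose A := (8 * d.+1%:R / r) ^+ d.
pose K := B + A * nrm2 mu psi ^+ 2 + 1.
have B0 : 0 <= B by rewrite mulr_ge0 ?exprn_ge0 ?sqrtr_ge0// addr_ge0.
have A0 : 0 <= A by rewrite exprn_ge0// divr_ge0 ?mulr_ge0// ltW.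
have K0 : 0 < K by rewrite ltr_wpDl// addr_ge0// mulr_ge0// sqr_ge0.
have r80 : 0 < r / 8 by rewrite divr_gt0.
have qe : (\forall n \near \oo, expR (- (r / 8) / n.+1%:R^-1) <= e / 2 / K)%classic.
  have /cvgrPdist_le/(_ (e / 2 / K) (divr_gt0 e20 K0)) := cvg_expR_nat r80.
  by apply: filterS => n; rewrite sub0r normrN ger0_norm ?expR_ge0.
near=> n.
have : expR (- (r / 8) / n.+1%:R^-1) <= e / 2 / K by near: n; exact: qe.
set t := n.+1%:R^-1; set q := expR _ => qe'.
have t0 : 0 < t by rewrite invr_gt0.
have t1 : t <= 1 by rewrite invf_le1// ler1n.
have t20 : 0 < 2 * t by rewrite mulr_gt0.
have q0 : 0 <= q by exact: expR_ge0.
have lk := L1_heat_kernel x t0; have lk2 := L1_heat_kernel x t20.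
have lkp : L1 mu (fun y => heat_kernel t (x - y) * psi y).
  by apply: L1_L2M => //; exact: L2_heat_kernel.
have lm : L1 mu (fun y => e / 2 * heat_kernel t (x - y) +
    (q * B * heat_kernel (2 * t) (x - y) + q * A * psi y ^+ 2)).
  by apply: L1D; [exact: L1Z|apply: L1D; apply: L1Z => //; exact: lp.2].
have lxk : L1 mu (fun y => psi x * heat_kernel t (x - y) - heat_kernel t (x - y) * psi y).
  by apply: L1B => //; exact: L1Z.
have -> : psi x - heat t psi x =
    \int[mu]_y (psi x * heat_kernel t (x - y) - heat_kernel t (x - y) * psi y).
  rewrite RintegralB//; last exact: L1Z.
  by rewrite RintegralZl// Rint_heat_kernel// mulr1.
apply: (le_trans (le_normr_Rintegral measurableT lxk)).
apply: (@le_trans _ _ (\int[mu]_y (e / 2 * heat_kernel t (x - y) +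
    (q * B * heat_kernel (2 * t) (x - y) + q * A * psi y ^+ 2)))).
  apply: le_Rint; [exact: L1_norm|exact: lm|move=> y].
  have k0 := heat_kernel_ge0 (x - y) t0; have k20 := heat_kernel_ge0 (x - y) t20.
  rewrite (mulrC (psi x)) -mulrBr normrM ger0_norm// distrC.
  have p1 : 0 <= q * B * heat_kernel (2 * t) (x - y).
    exact: (mulr_ge0 (mulr_ge0 q0 B0) k20).
  have p2 : 0 <= q * A * psi y ^+ 2.
    exact: (mulr_ge0 (mulr_ge0 q0 A0) (sqr_ge0 _)).
  have [near|far] := ltP (dotp (x - y) (x - y)) r.
    rewrite mulrC; apply: (@le_trans _ _ (e / 2 * heat_kernel t (x - y))); last by lra.
    by rewrite ler_wpM2r// hr.
  have h1 := heat_kernel_far1 t0 far.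
  have h2 := heat_kernel_far2 t0 t1 r0 far.
  apply: (@le_trans _ _ (q * B * heat_kernel (2 * t) (x - y) + q * A * psi y ^+ 2)); last first.
    by rewrite lerDr mulr_ge0// ltW.
  apply: (@le_trans _ _ (heat_kernel t (x - y) * (1 + `|psi x|) + heat_kernel t (x - y) * psi y ^+ 2)).
    rewrite -mulrDr ler_wpM2l//; apply: (le_trans (ler_normB _ _)).
    have := sqr_ge0 (`|psi y| - 1); have := real_normK (num_real (psi y)).
    by have := normr_ge0 (psi y); nra.
  apply: lerD; last by rewrite ler_wpM2r ?sqr_ge0// h2.
  have -> : q * B * heat_kernel (2 * t) (x - y) =
    q * (Num.sqrt 2 ^+ d * heat_kernel (2 * t) (x - y)) * (1 + `|psi x|) by rewrite /B; ring.
  by rewrite ler_wpM2r// addr_ge0.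
rewrite RintegralD//; [|exact: L1Z|by apply: L1D; apply: L1Z => //; exact: lp.2].
rewrite (@RintegralD _ _ _ mu setT (fun y => q * B * _))//; [|exact: L1Z|by apply: L1Z; exact: lp.2].
have ek k s : 0 < s -> \int[mu]_y (k * heat_kernel s (x - y)) = k.
  by move=> s0; rewrite RintegralZl ?Rint_heat_kernel ?mulr1//; exact: L1_heat_kernel.
rewrite !ek// RintegralZl//; last exact: lp.2.
rewrite -nrm2_sqr.
have : q * K <= e / 2 by rewrite -ler_pdivlMr.
rewrite /K; have := mulr_ge0 q0 B0; nra.
Unshelve. all: end_near. Qed.

End heat_continuity.

(** * Cosine and sine transforms *)

Section transforms.
Context {R : realType} (d : nat).
Local Notation V := 'rV[R]_d.
Local Notation mu := (@lebesgue_rV R d).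
Implicit Types (t : R) (x y xi : V) (g u v : V -> R).

Definition fnorm : R := (Num.sqrt (2 * pi) ^+ d)^-1.
Definition gaussian t xi : R := expR (- t * dotp xi xi).
(** The transform of a real function g in the unitary normalisation is
    costr g - i sintr g; keeping the two parts separate keeps all integrals
    real. *)
Definition costr g xi : R := fnorm * \int[mu]_x (cos (dotp x xi) * g x).
Definition sintr g xi : R := fnorm * \int[mu]_x (sin (dotp x xi) * g x).

Lemma fnorm_ge0 : 0 <= fnorm.
Proof. by rewrite invr_ge0 exprn_ge0// sqrtr_ge0. Qed.

(** The two normalisations agree: transforming a Gaussian forth and back gives
    the heat kernel. *)
Lemma sqrt_pi_fnorm t : 0 < t ->
  fnorm ^+ 2 * Num.sqrt (pi / t) ^+ d = heat_peak d t.
Proof.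
move=> t0; have p0 := @pi_gt0 R.
have a0 : 0 < Num.sqrt (pi / t) by rewrite sqrtr_gt0 divr_gt0.
have b0 : 0 < Num.sqrt (4 * pi * t) by rewrite sqrtr_gt0 !mulr_gt0.
have ab : Num.sqrt (pi / t) * Num.sqrt (4 * pi * t) = 2 * pi.
  rewrite -sqrtrM ?divr_ge0 ?ltW//.
  rewrite (_ : pi / t * (4 * pi * t) = (2 * pi) ^+ 2); last by field; rewrite gt_eqF.
  by rewrite sqrtr_sqr ger0_norm// mulr_ge0// ltW.
rewrite /fnorm /heat_peak exprVn -exprM mulnC exprM sqr_sqrtr ?mulr_ge0 ?ltW//.
rewrite -ab exprMn invfM mulrC mulrA divff ?mul1r//.
by rewrite expf_neq0// gt_eqF.
Qed.

Lemma measurable_sinR dT (T : measurableType dT) (f : T -> R) :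
  measurable_fun setT f -> measurable_fun setT (fun w => sin (f w)).
Proof.
move=> mf; apply: (measurableT_comp _ mf).
exact: (continuous_measurable_fun (@continuous_sin R)).
Qed.

Lemma cos_norm (z : R) : `|cos z| <= 1.
Proof. by rewrite ler_norml cos_geN1 cos_le1. Qed.

Lemma sin_norm (z : R) : `|sin z| <= 1.
Proof. by rewrite ler_norml sin_geN1 sin_le1. Qed.

Lemma measurable_cosdot x : measurable_fun setT (fun xi : V => cos (dotp x xi)).
Proof. by apply: measurable_cosR; exact: measurable_dotp. Qed.

Lemma measurable_sindot x : measurable_fun setT (fun xi : V => sin (dotp x xi)).
Proof. by apply: measurable_sinR; exact: measurable_dotp. Qed.

Lemma L1_cosM g x : L1 mu g -> L1 mu (fun xi => cos (dotp x xi) * g xi).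
Proof. by apply: (@L1_bndM _ _ _ mu 1); [exact: measurable_cosdot|move=> xi; exact: cos_norm]. Qed.

Lemma L1_sinM g x : L1 mu g -> L1 mu (fun xi => sin (dotp x xi) * g xi).
Proof. by apply: (@L1_bndM _ _ _ mu 1); [exact: measurable_sindot|move=> xi; exact: sin_norm]. Qed.

Lemma L1_cosM2 g xi : L1 mu g -> L1 mu (fun x => cos (dotp x xi) * g x).
Proof. by under eq_fun do rewrite dotpC; exact: L1_cosM. Qed.

Lemma L1_sinM2 g xi : L1 mu g -> L1 mu (fun x => sin (dotp x xi) * g x).
Proof. by under eq_fun do rewrite dotpC; exact: L1_sinM. Qed.

Lemma measurable_costr g : measurable_fun setT g -> measurable_fun setT (costr g).
Proof.
move=> mg; apply: measurable_funM => //.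
have mF : measurable_fun setT (fun z : V * V => cos (dotp z.2 z.1) * g z.2).
  apply: measurable_funM; first by apply: measurable_cosR; exact: measurable_dotp.
  exact: (measurableT_comp mg measurable_snd).
exact: (measurable_Rint2 mu mF).
Qed.

Lemma measurable_sintr g : measurable_fun setT g -> measurable_fun setT (sintr g).
Proof.
move=> mg; apply: measurable_funM => //.
have mF : measurable_fun setT (fun z : V * V => sin (dotp z.2 z.1) * g z.2).
  apply: measurable_funM; first by apply: measurable_sinR; exact: measurable_dotp.
  exact: (measurableT_comp mg measurable_snd).
exact: (measurable_Rint2 mu mF).
Qed.

Lemma costr_bnd g xi : L1 mu g -> `|costr g xi| <= fnorm * \int[mu]_x `|g x|.
Proof.
move=> lg; rewrite normrM ger0_norm ?fnorm_ge0// ler_wpM2l ?fnorm_ge0//.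
have lc := L1_cosM2 xi lg.
apply: (le_trans (le_normr_Rintegral measurableT lc)).
apply: le_Rint; [exact: L1_norm|exact: L1_norm|move=> x].
by rewrite normrM ler_piMl ?cos_norm.
Qed.

Lemma sintr_bnd g xi : L1 mu g -> `|sintr g xi| <= fnorm * \int[mu]_x `|g x|.
Proof.
move=> lg; rewrite normrM ger0_norm ?fnorm_ge0// ler_wpM2l ?fnorm_ge0//.
have lc := L1_sinM2 xi lg.
apply: (le_trans (le_normr_Rintegral measurableT lc)).
apply: le_Rint; [exact: L1_norm|exact: L1_norm|move=> x].
by rewrite normrM ler_piMl ?sin_norm.
Qed.

Lemma gaussianE t xi : gaussian t xi = expR (- t * dotp (xi - 0) (xi - 0)).
Proof. by rewrite subr0. Qed.

Lemma L1_gaussian t : 0 < t -> L1 mu (gaussian t).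
Proof.
move=> t0; have := L1_rV_gauss (0 : V) t0; congr (L1 _ _).
by apply/funext => xi; rewrite gaussianE.
Qed.

Lemma gaussian_le1 t xi : 0 < t -> `|gaussian t xi| <= 1.
Proof.
move=> t0; rewrite ger0_norm ?expR_ge0// expR_le1 mulNr oppr_le0.
by rewrite mulr_ge0 ?dotp_ge0// ltW.
Qed.

Lemma L2_gaussian t : 0 < t -> L2 mu (gaussian t).
Proof.
move=> t0; have lg := L1_gaussian t0; split; first exact: L1_meas lg.
by apply: (@L1_bndM _ _ _ mu 1) => //; [exact: L1_meas lg|move=> x; exact: gaussian_le1].
Qed.

Lemma Rint_cos_gaussian t x : 0 < t ->
  fnorm ^+ 2 * \int[mu]_xi (cos (dotp x xi) * gaussian t xi) = heat_kernel t x.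
Proof.
move=> t0; have := Rint_rV_cos_gauss x 0 0 t0.
have d0 : dotp x 0 = 0 by rewrite /dotp big1// => i _; rewrite mxE mulr0.
rewrite d0 addr0 cos0 mul1r.
under eq_Rintegral do rewrite addr0 -gaussianE.
move=> ->; rewrite mulrA sqrt_pi_fnorm// /heat_kernel; congr (_ * expR _).
by rewrite !mulNr mulrC.
Qed.

Lemma Rint_sin_gaussian t x : 0 < t ->
  \int[mu]_xi (sin (dotp x xi) * gaussian t xi) = 0.
Proof.
move=> t0; have := Rint_rV_cos_gauss x 0 (- (pi / 2)) t0.
have d0 : dotp x 0 = 0 by rewrite /dotp big1// => i _; rewrite mxE mulr0.
rewrite d0 add0r cosN cos_pihalf mul0r => <-.
by apply: eq_Rintegral => xi _; rewrite cosBpihalf gaussianE.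
Qed.

(** Fourier inversion for the integrable complex function u + iv, regularised by
    a Gaussian factor in frequency; the formula is the real part. Exchanging
    the integrals leaves the Fourier integral of the Gaussian, which is the
    heat kernel. *)
Lemma heat_inversion t u v y : 0 < t -> L1 mu u -> L1 mu v ->
  heat t u y = fnorm * \int[mu]_xi (gaussian t xi *
    ((costr u xi + sintr v xi) * cos (dotp y xi) -
     (costr v xi - sintr u xi) * sin (dotp y xi))).
Proof.
move=> t0 lu lv.
pose F (z : V * V) := gaussian t z.1 *
  (cos (dotp (z.2 - y) z.1) * u z.2 + sin (dotp (z.2 - y) z.1) * v z.2).
have lF : L1 (mu \x mu)%E F.
  have mF : measurable_fun setT F.
    apply: measurable_funM.
      exact: (measurableT_comp (L1_meas (L1_gaussian t0)) measurable_fst).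
    apply: measurable_funD; apply: measurable_funM.
    - by apply: measurable_cosR; apply: measurable_dotp => //; exact: measurable_rVB.
    - exact: (measurableT_comp (L1_meas lu) measurable_snd).
    - by apply: measurable_sinR; apply: measurable_dotp => //; exact: measurable_rVB.
    - exact: (measurableT_comp (L1_meas lv) measurable_snd).
  have l := L1_prodM (L1_gaussian t0) (L1D (L1_norm lu) (L1_norm lv)).
  apply: (L1_le mF _ l) => z; rewrite /F normrM (ger0_norm (expR_ge0 _)).
  rewrite ler_wpM2l ?expR_ge0//; apply: (le_trans (ler_normD _ _)); apply: lerD.
    by rewrite normrM ler_piMl ?cos_norm.
  by rewrite normrM ler_piMl ?sin_norm.
transitivity (fnorm ^+ 2 * \int[mu]_xi \int[mu]_x F (xi, x)); last first.
  rewrite expr2 -mulrA; congr (_ * _).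
  rewrite -RintegralZl//; last exact: (L1_prod1 lF).
  apply: eq_Rintegral => xi _ /=.
  have lc g : L1 mu g -> L1 mu (fun x => cos (dotp x xi) * g x) by exact: L1_cosM2.
  have ls g : L1 mu g -> L1 mu (fun x => sin (dotp x xi) * g x) by exact: L1_sinM2.
  have -> : \int[mu]_x F (xi, x) = \int[mu]_x (gaussian t xi * (
      cos (dotp y xi) * (cos (dotp x xi) * u x + sin (dotp x xi) * v x) -
      sin (dotp y xi) * (cos (dotp x xi) * v x - sin (dotp x xi) * u x))).
    by apply: eq_Rintegral => x _; rewrite /F/= dotpBl cosB sinB; ring.
  have l1 : L1 mu (fun x => cos (dotp x xi) * u x + sin (dotp x xi) * v x).
    by apply: L1D; [exact: lc|exact: ls].
  have l2 : L1 mu (fun x => cos (dotp x xi) * v x - sin (dotp x xi) * u x).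
    by apply: L1B; [exact: lc|exact: ls].
  rewrite RintegralZl//; last by apply: L1B; exact: L1Z.
  rewrite RintegralB//; [|exact: L1Z|exact: L1Z].
  rewrite RintegralZl// (@RintegralZl _ _ _ mu setT (fun x => cos (dotp x xi) * v x - _))//.
  rewrite RintegralD//; [|exact: lc|exact: ls].
  rewrite RintegralB//; [|exact: lc|exact: ls].
  by rewrite /costr /sintr; ring.
rewrite (Rint_swap lF) -RintegralZl//; last exact: (L1_prod2 lF).
apply: eq_Rintegral => x _.
have lc := L1_cosM (x - y) (L1_gaussian t0).
have ls := L1_sinM (x - y) (L1_gaussian t0).
have -> : \int[mu]_xi F (xi, x) = \int[mu]_xi (
    u x * (cos (dotp (x - y) xi) * gaussian t xi) +
    v x * (sin (dotp (x - y) xi) * gaussian t xi)).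
  by apply: eq_Rintegral => xi _; rewrite /F/=; ring.
rewrite RintegralD//; [|exact: L1Z|exact: L1Z].
rewrite !RintegralZl// Rint_sin_gaussian// mulr0 addr0 mulrCA Rint_cos_gaussian//.
by rewrite heat_kernel_sym mulrC.
Qed.

End transforms.

(** * Plancherel theory *)

Section plancherel.
Context {R : realType} (d : nat).
Local Notation V := 'rV[R]_d.
Local Notation mu := (@lebesgue_rV R d).
Implicit Types (t : R) (x y xi : V) (g u v : V -> R).

(** Exchange of integrals: testing a regularised inverse transform against g
    moves the transform onto g. *)
Lemma gaussian_pairing t g G1 G2 : L1 mu g ->
  L1 mu (fun xi => gaussian t xi * G1 xi) -> L1 mu (fun xi => gaussian t xi * G2 xi) ->
  \int[mu]_y (g y * (fnorm d * \int[mu]_xi (gaussian t xi *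
     (G1 xi * cos (dotp y xi) - G2 xi * sin (dotp y xi))))) =
  \int[mu]_xi (gaussian t xi * (G1 xi * costr g xi - G2 xi * sintr g xi)).
Proof.
move=> lg l1 l2.
pose F (z : V * V) := g z.1 * (gaussian t z.2 * G1 z.2 * cos (dotp z.1 z.2) -
  gaussian t z.2 * G2 z.2 * sin (dotp z.1 z.2)).
have lF : L1 (mu \x mu)%E F.
  have mF : measurable_fun setT F.
    apply: measurable_funM; first exact: (measurableT_comp (L1_meas lg) measurable_fst).
    apply: measurable_funB; apply: measurable_funM.
    - exact: (measurableT_comp (L1_meas l1) measurable_snd).
    - by apply: measurable_cosR; exact: measurable_dotp.
    - exact: (measurableT_comp (L1_meas l2) measurable_snd).
    - by apply: measurable_sinR; exact: measurable_dotp.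
  have l := L1_prodM (L1_norm lg) (L1D (L1_norm l1) (L1_norm l2)).
  apply: (L1_le mF _ l) => z; rewrite /F normrM ler_wpM2l//.
  apply: (le_trans (ler_normB _ _)); apply: lerD; rewrite normrM ler_piMr//.
    exact: cos_norm.
  exact: sin_norm.
have lc y : L1 mu (fun xi => gaussian t xi * G1 xi * cos (dotp y xi)).
  by under eq_fun do rewrite mulrC; exact: L1_cosM.
have ls y : L1 mu (fun xi => gaussian t xi * G2 xi * sin (dotp y xi)).
  by under eq_fun do rewrite mulrC; exact: L1_sinM.
transitivity (fnorm d * \int[mu]_y \int[mu]_xi F (y, xi)).
  rewrite -RintegralZl//; last exact: (L1_prod1 lF).
  apply: eq_Rintegral => y _; rewrite /F/= RintegralZl//; last exact: L1B.
  rewrite mulrCA; congr (_ * (_ * _)); apply: eq_Rintegral => xi _; ring.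
rewrite (Rint_swap lF) -RintegralZl//; last exact: (L1_prod2 lF).
apply: eq_Rintegral => xi _.
have -> : \int[mu]_y F (y, xi) = \int[mu]_y (
    gaussian t xi * G1 xi * (cos (dotp y xi) * g y) -
    gaussian t xi * G2 xi * (sin (dotp y xi) * g y)).
  by apply: eq_Rintegral => y _; rewrite /F/=; ring.
have lgc := L1_cosM2 xi lg; have lgs := L1_sinM2 xi lg.
rewrite RintegralB//; [|exact: L1Z|exact: L1Z].
by rewrite !RintegralZl// /costr /sintr; ring.
Qed.

Lemma L1_gaussianM t g : 0 < t -> L2 mu g -> L1 mu (fun xi => gaussian t xi * g xi).
Proof. by move=> t0 lg; apply: L1_L2M => //; exact: L2_gaussian. Qed.

Lemma L1_gaussian_bnd t k g : 0 < t -> measurable_fun setT g ->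
  (forall x, `|g x| <= k) -> L1 mu (fun xi => gaussian t xi * g xi).
Proof.
move=> t0 mg gk; under eq_fun do rewrite mulrC.
by apply: (@L1_bndM _ _ _ mu k) => //; exact: L1_gaussian.
Qed.

Lemma gaussian_cvg xi :
  (gaussian n.+1%:R^-1 xi @[n --> \oo] --> (1 : R))%classic.
Proof.
have h : (- n.+1%:R^-1 * dotp xi xi @[n --> \oo] --> (0 : R))%classic.
  rewrite [X in (_ --> X)%classic](_ : 0 = - 0 * dotp xi xi); last by rewrite oppr0 mul0r.
  apply: cvgM; last exact: cvg_cst.
  by apply: cvgN; exact: (@cvg_harmonic R).
rewrite /gaussian -[X in (_ --> X)%classic]expR0.
by apply: continuous_cvg h; exact: continuous_expR.
Qed.

Lemma gaussian_nd xi : {homo (fun n => gaussian (n.+1%:R^-1 : R) xi) : m n / (m <= n)%N >-> m <= n}.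
Proof.
move=> m n mn; rewrite ler_expR !mulNr lerN2 ler_wpM2r ?dotp_ge0//.
by rewrite lef_pV2 ?posrE// ler_nat ltnS.
Qed.

(** Monotone convergence as the Gaussian factor increases to one. *)
Lemma gaussian_unregularise (h : V -> R) (B : R) : measurable_fun setT h ->
  (forall x, 0 <= h x) ->
  (forall t, 0 < t -> L1 mu (fun x => gaussian t x * h x)) ->
  (forall t, 0 < t -> \int[mu]_x (gaussian t x * h x) <= B) ->
  L1 mu h /\ \int[mu]_x h x <= B.
Proof.
move=> mh h0 lh hB.
pose f n x : \bar R := (gaussian n.+1%:R^-1 x * h x)%:E.
have tn n : 0 < n.+1%:R^-1 :> R by rewrite invr_gt0.
have mf n : measurable_fun setT (f n) by exact: (measurable_int _ (lh _ (tn n))).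
have f0 n x : setT x -> (0 <= f n x)%E by move=> _; rewrite lee_fin mulr_ge0 ?expR_ge0.
have ndf x : setT x -> {homo f^~ x : n m / (n <= m)%N >-> (n <= m)%E}.
  by move=> _ n m nm; rewrite lee_fin ler_wpM2r//; exact: gaussian_nd.
have cf x : (f n x @[n --> \oo] --> (h x)%:E)%classic.
  apply: cvg_EFin; first by near=> n.
  rewrite -[X in (_ --> X)%classic]mul1r; apply: cvgM; last exact: cvg_cst.
  exact: gaussian_cvg.
have key : (\int[mu]_x (h x)%:E <= B%:E)%E.
  have := @cvg_monotone_convergence _ _ _ mu setT measurableT f mf f0 ndf.
  have -> : (\int[mu]_x limn (f^~ x) = \int[mu]_x (h x)%:E)%E.
    by apply: eq_integral => x _; apply/cvg_lim => //; exact: cf.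
  move=> c; rewrite -(cvg_lim _ c)//; apply: lime_le; first exact: (cvgP _ c).
  apply: nearW => n; have := hB _ (tn n).
  by rewrite -lee_fin /Rintegral fineK//; exact: integrable_fin_num (lh _ (tn n)).
have lh1 : L1 mu h.
  apply/integrableP; split; first exact/measurable_EFinP.
  under eq_integral do rewrite gee0_abs ?lee_fin//.
  by rewrite (le_lt_trans key)// ltry.
split => //; rewrite -lee_fin /Rintegral fineK//; exact: integrable_fin_num lh1.
Unshelve. all: end_near. Qed.

(** By regularised inversion the Gaussian-weighted energy of the transform equals
    the pairing of g with its heat average, at most the energy of g; then
    the weight is removed. *)
Lemma bessel g : L1 mu g -> L2 mu g ->
  [/\ L2 mu (costr g), L2 mu (sintr g), nrm2 mu (costr g) <= nrm2 mu g &
      nrm2 mu (sintr g) <= nrm2 mu g].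
Proof.
move=> l1 l2.
have mc := measurable_costr (L1_meas l1); have ms := measurable_sintr (L1_meas l1).
have l0 : L1 mu (fun=> 0) by exact: integrable0.
have z0 xi : costr (fun=> 0) xi = 0 /\ sintr (fun=> 0) xi = 0 :> R.
  rewrite /costr /sintr; under eq_Rintegral do rewrite mulr0.
  under [X in _ /\ _ * X = 0]eq_Rintegral do rewrite mulr0.
  by rewrite /Rintegral integral0 /= mulr0.
pose k := fnorm d * \int[mu]_x `|g x|.
have [||||ls sB] := @gaussian_unregularise (fun xi => costr g xi ^+ 2 + sintr g xi ^+ 2) (nrm2 mu g ^+ 2).
- by apply: measurable_funD; exact: measurable_funX.
- by move=> xi; rewrite addr_ge0 ?sqr_ge0.
- move=> t t0; apply: (@L1_gaussian_bnd _ (k ^+ 2 + k ^+ 2)) => //.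
    by apply: measurable_funD; exact: measurable_funX.
  move=> xi; rewrite ger0_norm ?addr_ge0 ?sqr_ge0// lerD//.
    rewrite -(real_normK (num_real (costr g xi))) lerXn2r ?nnegrE//; last exact: costr_bnd.
    by rewrite (le_trans _ (costr_bnd xi l1)).
  rewrite -(real_normK (num_real (sintr g xi))) lerXn2r ?nnegrE//; last exact: sintr_bnd.
  by rewrite (le_trans _ (sintr_bnd xi l1)).
- move=> t t0.
  have := @gaussian_pairing t g (costr g) (fun xi => - sintr g xi) l1.
  have -> : \int[mu]_x (gaussian t x * (costr g x ^+ 2 + sintr g x ^+ 2)) =
     \int[mu]_xi (gaussian t xi * (costr g xi * costr g xi - - sintr g xi * sintr g xi)).
    by apply: eq_Rintegral => xi _; ring.
  move=> <-.
  + have -> : \int[mu]_y (g y * (fnorm d * \int[mu]_xi (gaussian t xi *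
      (costr g xi * cos (dotp y xi) - - sintr g xi * sin (dotp y xi))))) =
      \int[mu]_y (g y * heat t g y).
      apply: eq_Rintegral => y _; rewrite (heat_inversion y t0 l1 l0).
      congr (_ * (_ * _)); apply: eq_Rintegral => xi _.
      by have [-> ->] := z0 xi; rewrite addr0 sub0r.
    apply: (le_trans (ler_norm _)); apply: (le_trans (cauchy_schwarz l2 (L2_heat t0 l2))).
    by rewrite expr2 ler_wpM2l ?nrm2_ge0// nrm2_heat.
  + by apply: (@L1_gaussian_bnd _ k) => // xi; exact: costr_bnd.
  + apply: (@L1_gaussian_bnd _ k) => //; first exact: measurableT_comp.
    by move=> xi; rewrite normrN; exact: sintr_bnd.
have lc2 : L2 mu (costr g).
  split => //; apply: (L1_le _ _ ls); first exact: measurable_funX.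
  by move=> xi; rewrite ger0_norm ?sqr_ge0// lerDl sqr_ge0.
have ls2 : L2 mu (sintr g).
  split => //; apply: (L1_le _ _ ls); first exact: measurable_funX.
  by move=> xi; rewrite ger0_norm ?sqr_ge0// lerDr sqr_ge0.
split => //; rewrite -(ler_pXn2r (ltn0Sn 1)) ?nnegrE ?nrm2_ge0// [leLHS]nrm2_sqr.
  apply: (le_trans _ sB); apply: le_Rint => //; first exact: lc2.2.
  by move=> xi; rewrite lerDl sqr_ge0.
apply: (le_trans _ sB); apply: le_Rint => //; first exact: ls2.2.
by move=> xi; rewrite lerDr sqr_ge0.
Qed.

End plancherel.

(** * The Plancherel transform of complex functions *)

Section fourier_closure.
Local Open Scope complex_scope.
Context {R : realType} (d : nat).
Local Notation V := 'rV[R]_d.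
Local Notation mu := (@lebesgue_rV R d).
Local Notation cRe := (@complex.Re R).
Local Notation cIm := (@complex.Im R).
Implicit Types (t : R) (x y xi : V) (g : V -> R) (f psi Psi : V -> R[i]).

Lemma cRe_norm (z : R[i]) : `|cRe z| <= Normc.normc z.
Proof.
by case: z => a b /=; rewrite -sqrtr_sqr ler_wsqrtr// lerDl sqr_ge0.
Qed.

Lemma cIm_norm (z : R[i]) : `|cIm z| <= Normc.normc z.
Proof.
by case: z => a b /=; rewrite -sqrtr_sqr ler_wsqrtr// lerDr sqr_ge0.
Qed.

Lemma cReB (z w : R[i]) : cRe (z - w) = cRe z - cRe w.
Proof. by case: z w => a b []. Qed.

Lemma cImB (z w : R[i]) : cIm (z - w) = cIm z - cIm w.
Proof. by case: z w => a b []. Qed.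

Lemma measurable_normc f : cmeasurable f ->
  measurable_fun setT (fun x => Normc.normc (f x)).
Proof.
move=> [mr mi].
rewrite (_ : (fun x => _) = (fun x => Num.sqrt (cRe (f x) ^+ 2 + cIm (f x) ^+ 2))); last first.
  by apply/funext => x; case: (f x).
apply: (measurableT_comp (continuous_measurable_fun (@sqrt_continuous R))).
by apply: measurable_funD; exact: measurable_funX.
Qed.

Lemma L2_normc f : cmeasurable f -> (cLnorm 2%:E f < +oo)%E ->
  L2 mu (fun x => Normc.normc (f x)) /\
  nrm2 mu (fun x => Normc.normc (f x)) = fine (cLnorm 2%:E f).
Proof.
move=> mf fin; have mn := measurable_normc mf.
have e : (\int[mu]_x (Normc.normc (f x) ^+ 2)%:E = cLnorm 2%:E f `^ 2)%E.
  rewrite poweR_Lnorm//; apply: eq_integral => x _ /=.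
  by rewrite powR_mulrn ?normr_ge0// real_normK ?num_real.
have c0 : (0 <= cLnorm 2%:E f)%E by exact: Lnorm_ge0.
have cE : cLnorm 2%:E f = (fine (cLnorm 2%:E f))%:E by rewrite fineK// ge0_fin_numE.
have f0 : 0 <= fine (cLnorm 2%:E f) by exact: fine_ge0.
rewrite cE poweR_EFin powR_mulrn// in e.
have l2 : L2 mu (fun x => Normc.normc (f x)).
  split => //; apply/integrableP; split; first by apply/measurable_EFinP; exact: measurable_funX.
  under eq_integral do rewrite /= ger0_norm ?sqr_ge0//.
  by rewrite e ltry.
split => //; apply/eqP; rewrite -(eqrXn2 (ltn0Sn 1))// ?nrm2_ge0//.
by rewrite nrm2_sqr /Rintegral e.
Qed.

Lemma L2_Re f : cmeasurable f -> (cLnorm 2%:E f < +oo)%E ->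
  L2 mu (cRe \o f) /\ nrm2 mu (cRe \o f) <= fine (cLnorm 2%:E f).
Proof.
move=> mf fin; have [l <-] := L2_normc mf fin.
split; first by apply: (L2_le mf.1 _ l) => x; exact: cRe_norm.
by apply: (nrm2_le mf.1 _ l) => x; exact: cRe_norm.
Qed.

Lemma L2_Im f : cmeasurable f -> (cLnorm 2%:E f < +oo)%E ->
  L2 mu (cIm \o f) /\ nrm2 mu (cIm \o f) <= fine (cLnorm 2%:E f).
Proof.
move=> mf fin; have [l <-] := L2_normc mf fin.
split; first by apply: (L2_le mf.2 _ l) => x; exact: cIm_norm.
by apply: (nrm2_le mf.2 _ l) => x; exact: cIm_norm.
Qed.

Lemma L1_ReIm f : inLp 1%:E f -> L1 mu (cRe \o f) /\ L1 mu (cIm \o f).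
Proof.
move=> [mf]; rewrite /cLnorm Lnorm1 => fin; have mn := measurable_normc mf.
have l : L1 mu (fun x => Normc.normc (f x)).
  apply/integrableP; split; first by apply/measurable_EFinP; exact: mn.
  exact: fin.
split; first by apply: (L1_le mf.1 _ l) => x; exact: cRe_norm.
by apply: (L1_le mf.2 _ l) => x; exact: cIm_norm.
Qed.

Lemma cmeasurableB f psi : cmeasurable f -> cmeasurable psi ->
  cmeasurable (fun x => f x - psi x).
Proof.
move=> [m1 m2] [n1 n2]; split.
  under eq_fun do rewrite cReB; exact: measurable_funB.
under eq_fun do rewrite cImB; exact: measurable_funB.
Qed.

Lemma fourier1E f xi : inLp 1%:E f -> fourier1 f xi =
  (costr (cRe \o f) xi + sintr (cIm \o f) xi) +i*
  (costr (cIm \o f) xi - sintr (cRe \o f) xi).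
Proof.
move=> /L1_ReIm[l1 l2].
have a1 := L1_cosM2 xi l1; have a2 := L1_sinM2 xi l2.
have a3 := L1_cosM2 xi l2; have a4 := L1_sinM2 xi l1.
rewrite /fourier1 /cintegral.
have -> : \int[mu]_x cRe ((cos (dotp x xi) -i* sin (dotp x xi)) * f x) =
  \int[mu]_x (cos (dotp x xi) * (cRe \o f) x + sin (dotp x xi) * (cIm \o f) x).
  by apply: eq_Rintegral => x _ /=; case: (f x) => a b /=; ring.
have -> : \int[mu]_x cIm ((cos (dotp x xi) -i* sin (dotp x xi)) * f x) =
  \int[mu]_x (cos (dotp x xi) * (cIm \o f) x - sin (dotp x xi) * (cRe \o f) x).
  by apply: eq_Rintegral => x _ /=; case: (f x) => a b /=; ring.
rewrite RintegralD// RintegralB//.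
by rewrite /costr /sintr /fnorm; simpc; congr (_ +i* _); ring.
Qed.

Lemma cmeasurable_fourier1 f : inLp 1%:E f -> cmeasurable (fourier1 f).
Proof.
move=> lf; have [l1 l2] := L1_ReIm lf; split.
  under eq_fun do rewrite (fourier1E _ lf) /=.
  exact: (measurable_funD (measurable_costr (L1_meas l1)) (measurable_sintr (L1_meas l2))).
under eq_fun do rewrite (fourier1E _ lf) /=.
exact: (measurable_funB (measurable_costr (L1_meas l2)) (measurable_sintr (L1_meas l1))).
Qed.

Lemma cvg_cLnorm_fine (f_ : nat -> V -> R[i]) :
  (cLnorm 2%:E (f_ n) @[n --> \oo] --> 0%E)%classic ->
  (\forall n \near \oo, (cLnorm 2%:E (f_ n) < +oo)%E)%classic /\
  (fine (cLnorm 2%:E (f_ n)) @[n --> \oo] --> (0 : R))%classic.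
Proof.
move=> c; split; last exact: (fine_cvg c).
have : (\forall x \near nbhs (0%E : \bar R), (x < +oo)%E)%classic.
  by exists 1 => //= r; rewrite /ball/= => _; exact: ltry.
by move=> h; exact: (c [set x | (x < +oo)%E]%classic h).
Qed.

Lemma cvg_pairing_L2 (k : V -> R) (f_ : nat -> V -> R[i]) psi : L2 mu k ->
  (forall n, cmeasurable (f_ n)) -> inLp 2%:E psi ->
  (cLnorm 2%:E (fun x => f_ n x - psi x)%R @[n --> \oo] --> 0%E)%classic ->
  (\int[mu]_x (k x * cRe (f_ n x)) @[n --> \oo] --> \int[mu]_x (k x * cRe (psi x)))%classic /\
  (\int[mu]_x (k x * cIm (f_ n x)) @[n --> \oo] --> \int[mu]_x (k x * cIm (psi x)))%classic.
Proof.
move=> lk mf [mp fp] /cvg_cLnorm_fine[nf cf].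
have [lr _] := L2_Re mp fp; have [li _] := L2_Im mp fp.
have c0 : (nrm2 mu k * fine (cLnorm 2%:E (fun x => f_ n x - psi x)%R) @[n --> \oo] --> (0 : R))%classic.
  by rewrite -[X in (_ --> X)%classic](mulr0 (nrm2 mu k)); apply: cvgM => //; exact: cvg_cst.
split; apply/subr_cvg0; apply: norm_cvg0;
  apply: (@squeeze_cvgr _ _ _ _ (cst 0) _ _ _ _ _ c0); try exact: cvg_cst.
- near=> n; rewrite normr_ge0/=.
  have fn : (cLnorm 2%:E (fun x => f_ n x - psi x)%R < +oo)%E by near: n.
  have md := cmeasurableB (mf n) mp.
  have [ld ln] := L2_Re md fn.
  have e : cRe \o (fun x => f_ n x - psi x) = (fun x => cRe (f_ n x) - cRe (psi x)).
    by apply/funext => x /=; rewrite cReB.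
  rewrite e in ld ln.
  have lfn : L2 mu (fun x => cRe (f_ n x)).
    by have := L2D ld lr; congr (L2 _ _); apply/funext => x /=; rewrite subrK.
  rewrite -RintegralB//; try exact: L1_L2M.
  under eq_Rintegral do rewrite -mulrBr.
  by apply: (le_trans (cauchy_schwarz lk ld)); rewrite ler_wpM2l ?nrm2_ge0.
- near=> n; rewrite normr_ge0/=.
  have fn : (cLnorm 2%:E (fun x => f_ n x - psi x)%R < +oo)%E by near: n.
  have md := cmeasurableB (mf n) mp.
  have [ld ln] := L2_Im md fn.
  have e : cIm \o (fun x => f_ n x - psi x) = (fun x => cIm (f_ n x) - cIm (psi x)).
    by apply/funext => x /=; rewrite cImB.
  rewrite e in ld ln.
  have lfn : L2 mu (fun x => cIm (f_ n x)).
    by have := L2D ld li; congr (L2 _ _); apply/funext => x /=; rewrite subrK.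
  rewrite -RintegralB//; try exact: L1_L2M.
  under eq_Rintegral do rewrite -mulrBr.
  by apply: (le_trans (cauchy_schwarz lk ld)); rewrite ler_wpM2l ?nrm2_ge0.
Unshelve. all: end_near. Qed.

(** Both sides are continuous in L^2, so the regularised inversion passes from
    the integrable approximants to the Plancherel transform. *)
Lemma fourier2_heat t psi Psi y : 0 < t -> is_fourier2 psi Psi ->
  heat t (cRe \o psi) y = fnorm d * \int[mu]_xi (gaussian t xi *
    (cRe (Psi xi) * cos (dotp y xi) - cIm (Psi xi) * sin (dotp y xi))).
Proof.
move=> t0 [lp lP [u [lu cu cU]]].
have lk := L2_heat_kernel y t0.
have mu_ n : cmeasurable (u n) by case: (lu n) => -[].
have [c1 _] := cvg_pairing_L2 lk mu_ lp cu.
have mU n : cmeasurable (fourier1 (u n)) by apply: cmeasurable_fourier1; case: (lu n).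
have lgc : L2 mu (fun xi => cos (dotp y xi) * gaussian t xi).
  apply: (@L2_bndM _ _ _ mu 1); [exact: measurable_cosdot|move=> xi; exact: cos_norm|].
  exact: L2_gaussian.
have lgs : L2 mu (fun xi => sin (dotp y xi) * gaussian t xi).
  apply: (@L2_bndM _ _ _ mu 1); [exact: measurable_sindot|move=> xi; exact: sin_norm|].
  exact: L2_gaussian.
have [C1 _] := cvg_pairing_L2 lgc mU lP cU.
have [_ C2] := cvg_pairing_L2 lgs mU lP cU.
have rhs (g1 g2 : V -> R) : L1 mu (fun xi => cos (dotp y xi) * gaussian t xi * g1 xi) ->
  L1 mu (fun xi => sin (dotp y xi) * gaussian t xi * g2 xi) ->
  \int[mu]_xi (gaussian t xi * (g1 xi * cos (dotp y xi) - g2 xi * sin (dotp y xi))) =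
  \int[mu]_xi (cos (dotp y xi) * gaussian t xi * g1 xi) -
  \int[mu]_xi (sin (dotp y xi) * gaussian t xi * g2 xi).
  move=> i1 i2; rewrite -RintegralB//; apply: eq_Rintegral => xi _; ring.
have [lr _] := L2_Re lP.1 lP.2; have [li _] := L2_Im lP.1 lP.2.
rewrite rhs; [|exact: L1_L2M|exact: L1_L2M].
have C : (fnorm d * (\int[mu]_x (cos (dotp y x) * gaussian t x * cRe (fourier1 (u n) x)) -
    \int[mu]_x (sin (dotp y x) * gaussian t x * cIm (fourier1 (u n) x))) @[n --> \oo] -->
    fnorm d * (\int[mu]_x (cos (dotp y x) * gaussian t x * cRe (Psi x)) -
    \int[mu]_x (sin (dotp y x) * gaussian t x * cIm (Psi x))))%classic.
  by apply: cvgM; [exact: cvg_cst|exact: cvgB].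
apply: (cvg_unique (@Rhausdorff R) c1); apply: cvg_trans C.
apply: near_eq_cvg; apply: nearW => n.
have [l1 l2] := L1_ReIm (lu n).1.
rewrite -[RHS]/(heat t (cRe \o u n) y) (heat_inversion y t0 l1 l2).
congr (_ * _); rewrite -rhs.
- by apply: eq_Rintegral => xi _; rewrite (fourier1E _ (lu n).1).
- have lb : L1 mu (fun xi => cRe (fourier1 (u n) xi) * (cos (dotp y xi) * gaussian t xi)).
    apply: (@L1_bndM _ _ _ mu (fnorm d * \int[mu]_x `|(cRe \o u n) x| +
        fnorm d * \int[mu]_x `|(cIm \o u n) x|)); first exact: (mU n).1.
      move=> xi; rewrite (fourier1E _ (lu n).1) /=.
      by apply: (le_trans (ler_normD _ _)); apply: lerD; [exact: costr_bnd|exact: sintr_bnd].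
    by apply: L1_cosM; exact: L1_gaussian.
  by move: lb; congr (L1 _ _); apply/funext => xi; rewrite mulrC.
- have lb : L1 mu (fun xi => cIm (fourier1 (u n) xi) * (sin (dotp y xi) * gaussian t xi)).
    apply: (@L1_bndM _ _ _ mu (fnorm d * \int[mu]_x `|(cIm \o u n) x| +
        fnorm d * \int[mu]_x `|(cRe \o u n) x|)); first exact: (mU n).2.
      move=> xi; rewrite (fourier1E _ (lu n).1) /=.
      by apply: (le_trans (ler_normB _ _)); apply: lerD; [exact: costr_bnd|exact: sintr_bnd].
    by apply: L1_sinM; exact: L1_gaussian.
  by move: lb; congr (L1 _ _); apply/funext => xi; rewrite mulrC.
Qed.

Lemma fourier2_heat_pairing t psi Psi g : 0 < t -> is_fourier2 psi Psi -> L1 mu g ->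
  \int[mu]_y (g y * heat t (cRe \o psi) y) =
  \int[mu]_xi (gaussian t xi * (cRe (Psi xi) * costr g xi - cIm (Psi xi) * sintr g xi)).
Proof.
move=> t0 fp lg; have [_ lP _] := fp.
have [lr _] := L2_Re lP.1 lP.2; have [li _] := L2_Im lP.1 lP.2.
rewrite -(gaussian_pairing lg (L1_gaussianM t0 lr) (L1_gaussianM t0 li)).
by apply: eq_Rintegral => y _; rewrite (fourier2_heat y t0 fp).
Qed.

(** Parseval's identity, obtained by letting the regularisation tend to zero
    against a fixed integrable g. The convergence of the averages of psi is
    an assumption: it holds for the functions of interest by pointwise
    convergence, once g has been chosen accordingly. *)
Lemma parseval psi Psi g : is_fourier2 psi Psi -> L1 mu g -> L2 mu g ->
  (\int[mu]_y (g y * heat n.+1%:R^-1 (cRe \o psi) y) @[n --> \oo] -->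
   \int[mu]_y (g y * cRe (psi y)))%classic ->
  \int[mu]_y (g y * cRe (psi y)) =
  \int[mu]_xi (cRe (Psi xi) * costr g xi - cIm (Psi xi) * sintr g xi).
Proof.
move=> fp l1 l2 c; have [_ lP _] := fp.
have [lr _] := L2_Re lP.1 lP.2; have [li _] := L2_Im lP.1 lP.2.
have [lc ls _ _] := bessel l1 l2.
have lF : L1 mu (fun xi => cRe (Psi xi) * costr g xi - cIm (Psi xi) * sintr g xi).
  by apply: L1B; exact: L1_L2M.
have tn n : 0 < n.+1%:R^-1 :> R by rewrite invr_gt0.
pose f_ n xi := gaussian n.+1%:R^-1 xi * (cRe (Psi xi) * costr g xi - cIm (Psi xi) * sintr g xi).
have mf n : measurable_fun setT (f_ n).
  exact: (measurable_funM (L1_meas (L1_gaussian d (tn n))) (L1_meas lF)).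
have cf xi : (f_ n xi @[n --> \oo] --> (cRe (Psi xi) * costr g xi - cIm (Psi xi) * sintr g xi))%classic.
  rewrite -[X in (_ --> X)%classic]mul1r; apply: cvgM; last exact: cvg_cst.
  exact: gaussian_cvg.
have bf n xi : `|f_ n xi| <= `|cRe (Psi xi) * costr g xi - cIm (Psi xi) * sintr g xi|.
  by rewrite normrM ler_piMl// gaussian_le1.
have [_ C] := Rdominated mf (L1_meas lF) (aeW mu cf) (L1_norm lF) bf.
apply: (cvg_unique (@Rhausdorff R) c); apply: cvg_trans C.
apply: near_eq_cvg; apply: nearW => n.
by rewrite (fourier2_heat_pairing (tn n) fp l1).
Qed.

End fourier_closure.

(** * Fractional powers as superpositions of exponentials *)

Lemma Rint_unit_interval (R : realType) :
  \int[@lebesgue_measure R]_s (\1_`[0, 1]%classic s : R) = 1.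
Proof.
have m01 : measurable (`[0, 1]%classic : set (measurableTypeR R)) by exact: measurable_itv.
rewrite /Rintegral integral_indic// setIT.
rewrite -[X in fine X]/(@lebesgue_measure R `[0, 1]%classic).
by rewrite lebesgue_measure_itv/= lte_fin ltr01 oppr0 adde0.
Qed.

Section fractional_power.
Context {R : realType}.
Local Notation leb := (@lebesgue_measure R).
Variable b : R.
Hypothesis b01 : 0 < b < 1.
Implicit Types (z s : R).

(** The integrand of the formula z^b = C int (1 - exp(-tz)) t^(-1-b) dt after the
    substitution t = exp s, which turns scaling in z into translation in s. *)
Definition levy z s : R := (1 - expR (- expR s * z)) * expR (- b * s).

Lemma levy_ge0 z s : 0 <= z -> 0 <= levy z s.
Proof.
move=> z0; rewrite mulr_ge0 ?expR_ge0// subr_ge0 expR_le1 mulNr oppr_le0.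
by rewrite mulr_ge0 ?expR_ge0.
Qed.

Lemma measurable_levy2 dT (T : measurableType dT) (q : T -> R) : measurable_fun setT q ->
  measurable_fun setT (fun u : T * R => levy (q u.1) u.2).
Proof.
move=> mq; apply: measurable_funM.
  apply: measurable_funB => //; apply: (measurableT_comp (@measurable_expR R)).
  apply: measurable_funM; last exact: (measurableT_comp mq measurable_fst).
  by apply: measurableT_comp => //; apply: (measurableT_comp (@measurable_expR R)); exact: measurable_snd.
apply: measurable_expRM; exact: measurable_snd.
Qed.

Lemma measurable_levy z : measurable_fun setT (levy z).
Proof.
have := measurable_levy2 (@measurable_cst _ _ R R setT z).
by move=> /measurableT_comp/(_ (measurable_pair1 (0 : R))).
Qed.

Lemma L1_exp_half (k : R) : 0 < k ->
  L1 leb (fun s => \1_`[0, +oo[%classic s * expR (- k * s)).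
Proof.
move=> k0; have := L1Z k^-1 (integrable_exponential_pdf k0).
congr (L1 _ _); apply/funext => s.
rewrite /exponential_pdf patchE indicE; case: ifP => _; rewrite ?mul0r ?mulr0//.
by rewrite mulrA mulVf ?gt_eqF// !mul1r.
Qed.

(** The integrand decays like exp(-bs) at plus infinity and like exp((1-b)s) at
    minus infinity. *)
Lemma levy_le z s : 0 <= z -> levy z s <=
  \1_`[0, +oo[%classic s * expR (- b * s) +
  z * (\1_`[0, +oo[%classic (0 - s) * expR (- (1 - b) * (0 - s))).
Proof.
move=> z0; rewrite /levy.
have h1 : 1 - expR (- expR s * z) <= 1 by rewrite gerBl expR_ge0.
have h2 : 1 - expR (- expR s * z) <= expR s * z.
  by have := expR_ge1Dx (- expR s * z); lra.
have [s0|s0] := lerP 0 s.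
  rewrite indicE mem_set/= ?in_itv/= ?s0// mul1r.
  apply: (@le_trans _ _ (expR (- b * s))); first by rewrite ler_piMl ?expR_ge0.
  by rewrite lerDl !mulr_ge0 ?expR_ge0.
rewrite [X in _ <= _ + _ * (X * _)]indicE mem_set/= ?in_itv/= ?andbT; last by lra.
rewrite mul1r (_ : - (1 - b) * (0 - s) = s + - b * s); last by ring.
rewrite expRD mulrA (mulrC z); apply: (le_trans (ler_wpM2r (expR_ge0 _) h2)).
by rewrite lerDr mulr_ge0 ?expR_ge0.
Qed.

Lemma L1_levy z : 0 <= z -> L1 leb (levy z).
Proof.
move=> z0; have [b0 b1] := andP b01.
have l1 := L1_exp_half b0.
have b1' : 0 < 1 - b by lra.
have l2 := L1_refl1 0 (L1_exp_half b1').
apply: (@L1_le _ _ _ leb _ _ _ _ (L1D l1 (L1Z z l2))); first exact: measurable_levy.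
by move=> s; rewrite ger0_norm ?levy_ge0 ?levy_le.
Qed.

Definition levy_cst : R := \int[leb]_s levy 1 s.

Lemma levy_cst_gt0 : 0 < levy_cst.
Proof.
have [b0 b1] := andP b01.
pose c := (1 - expR (- 1)) * expR (- b) : R.
have c0 : 0 < c by rewrite mulr_gt0 ?expR_gt0// subr_gt0 expR_lt1 oppr_lt0.
have i1 := @Rint_unit_interval R.
have l1 : L1 leb (fun s => \1_`[0, 1]%classic s) by exact: integrable_indic_itv.
apply: (@lt_le_trans _ _ c) => //; rewrite -[X in X <= _]mulr1 -[X in _ * X]i1 -RintegralZl//.
apply: le_Rint; [exact: L1Z|exact: L1_levy|move=> s].
rewrite indicE; case: (boolP (s \in _)) => [|_]; last by rewrite mulr0 levy_ge0.
rewrite inE/= in_itv/= mulr1 => /andP[s0 s1]; rewrite /levy /c.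
apply: ler_pM; rewrite ?expR_ge0// ?subr_ge0 ?expR_le1 ?oppr_le0//.
  by rewrite lerD2l lerN2 ler_expR mulr1 lerN2 -[X in X <= _]expR0 ler_expR.
by rewrite ler_expR mulNr lerN2 ler_piMr// ltW.
Qed.

(** Translating s by ln z exhibits the homogeneity of degree b in z. *)
Lemma powR_levy z : 0 <= z -> z `^ b = levy_cst^-1 * \int[leb]_s levy z s.
Proof.
move=> z0; have [b0 b1] := andP b01.
move: z0; rewrite le_eqVlt => /predU1P[<-|z0].
  rewrite powR0 ?gt_eqF// (_ : \int[leb]_s levy 0 s = 0) ?mulr0//.
  transitivity (\int[leb]_s (cst 0 s : R)); last by rewrite /Rintegral integral0.
  by apply: eq_Rintegral => s _; rewrite /levy mulr0 expR0 subrr mul0r.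
have -> : \int[leb]_s levy z s = \int[leb]_s (z `^ b * levy 1 (s + ln z)).
  apply: eq_Rintegral => s _; rewrite /levy /powR gt_eqF// mulrCA -expRD mulr1.
  rewrite (_ : b * ln z + - b * (s + ln z) = - b * s); last by ring.
  by rewrite expRD lnK// mulNr.
have l1 := L1_levy ler01.
rewrite RintegralZl//; last exact: (L1_shift1 (ln z) l1).
by rewrite (Rint_shift1 (ln z) (measurable_levy 1)) -/levy_cst mulrCA mulVf ?mulr1// gt_eqF ?levy_cst_gt0.
Qed.

Definition window n s : R := \1_`[- n%:R, n%:R]%classic s.

Lemma window01 n s : 0 <= window n s <= 1.
Proof. by rewrite /window indicE; case: (_ \in _); rewrite ?lexx ?ler01. Qed.

Lemma measurable_window n : measurable_fun setT (window n).
Proof. by apply: measurable_indic; exact: measurable_itv. Qed.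

Lemma window_cvg s : (window n s @[n --> \oo] --> (1 : R))%classic.
Proof.
apply: cvg_near_cst; near=> n; rewrite /window indicE mem_set//= in_itv/= -ler_norml.
by near: n; exact: nbhs_infty_ger.
Unshelve. all: end_near. Qed.

(** The part of the power carried by bounded s; unlike the full power it is
    bounded in z, and its pairings are covered by Fubini. *)
Definition cut_power n z : R := levy_cst^-1 * \int[leb]_s (window n s * levy z s).

Lemma L1_window_levy n z : 0 <= z -> L1 leb (fun s => window n s * levy z s).
Proof.
move=> z0; apply: (@L1_bndM _ _ _ leb 1); [exact: measurable_window| |exact: L1_levy].
by move=> s; have /andP[w0 w1] := window01 n s; rewrite ger0_norm.
Qed.

Lemma cut_power_ge0 n z : 0 <= z -> 0 <= cut_power n z.
Proof.
move=> z0; rewrite mulr_ge0 ?invr_ge0 ?(ltW levy_cst_gt0)//.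
by apply: Rintegral_ge0 => s _; rewrite mulr_ge0 ?levy_ge0.
Qed.

Lemma cut_power_le n z : 0 <= z -> cut_power n z <= z `^ b.
Proof.
move=> z0; rewrite powR_levy// ler_wpM2l ?invr_ge0 ?(ltW levy_cst_gt0)//.
apply: le_Rint; [exact: L1_window_levy|exact: L1_levy|move=> s].
by rewrite ler_piMl ?levy_ge0//; have /andP[] := window01 n s.
Qed.

Lemma cut_power_cvg z : 0 <= z -> (cut_power n z @[n --> \oo] --> z `^ b)%classic.
Proof.
move=> z0; rewrite powR_levy//; apply: cvgM; first exact: cvg_cst.
have mf n : measurable_fun setT (fun s => window n s * levy z s).
  by apply: measurable_funM; [exact: measurable_window|exact: measurable_levy].
have cf s : (window n s * levy z s @[n --> \oo] --> levy z s)%classic.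
  by rewrite -[X in (_ --> X)%classic]mul1r; apply: cvgM; [exact: window_cvg|exact: cvg_cst].
have bf n s : `|window n s * levy z s| <= levy z s.
  have /andP[w0 w1] := window01 n s.
  have l0 := levy_ge0 s z0.
  by rewrite (ger0_norm (mulr_ge0 w0 l0)) ler_piMl.
by have [_] := @Rdominated _ _ _ leb _ _ _ mf (measurable_levy z) (aeW leb cf) (L1_levy z0) bf.
Qed.

End fractional_power.

(** * The quadratic form of a fractional power *)

Section levy_form.
Context dT (T : measurableType dT) (R : realType).
Variable mu : {sigma_finite_measure set T -> \bar R}.
Local Notation leb := (@lebesgue_measure R).
Variable b : R.
Hypothesis b01 : 0 < b < 1.
Variable q : T -> R.
Hypothesis mq : measurable_fun setT q.
Hypothesis q0 : forall x, 0 <= q x.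

Lemma measurable_cut_power n : measurable_fun setT (fun x => cut_power b n (q x)).
Proof.
apply: measurable_funM => //.
have mF : measurable_fun setT (fun u : T * measurableTypeR R => window n u.2 * levy b (q u.1) u.2).
  apply: measurable_funM; last exact: measurable_levy2.
  exact: (measurableT_comp (@measurable_window R n) measurable_snd).
exact: (measurable_Rint2 leb mF).
Qed.

Lemma measurable_powq : measurable_fun setT (fun x => q x `^ b).
Proof. exact: (measurableT_comp (measurable_powR b) mq). Qed.

Lemma window_levy_bnd n z s : 0 <= z ->
  0 <= window n s * levy b z s <= window n s * expR (- b * s).
Proof.
move=> z0; have /andP[w0 w1] := @window01 R n s.
by rewrite mulr_ge0 ?levy_ge0//= ler_wpM2l// ler_piMl ?expR_ge0// gerBl expR_ge0.
Qed.

Lemma L1_window_exp n : L1 leb (fun s => window n s * expR (- b * s)).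
Proof.
have [b0 b1] := andP b01.
have mw : measurable_fun setT (fun s : R => window n s * expR (- b * s)).
  by apply: measurable_funM; [exact: measurable_window|apply: measurable_expRM].
apply: (@L1_le _ _ _ leb _ (fun s => expR (b * n%:R) * window n s)) => //.
  move=> s; have /andP[w0 w1] := @window01 R n s.
  rewrite ger0_norm ?mulr_ge0 ?expR_ge0// mulrC /window indicE.
  case: (boolP (s \in _)) => [|_]; last by rewrite !mulr0.
  rewrite inE/= in_itv/= !mulr1 ler_expR => /andP[s1 s2].
  by rewrite mulNr -mulrN ler_wpM2l// ?(ltW b0)// lerNl.
apply: (@L1Z _ _ _ leb); exact: integrable_indic_itv.
Qed.

(** Fubini: on a bounded range of s the weight exp(-bs) is integrable. *)
Lemma cut_power_pairing n (P : T -> R) : L1 mu P ->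
  L1 leb (fun s => window n s * expR (- b * s) *
    \int[mu]_x ((1 - expR (- expR s * q x)) * P x)) /\
  \int[mu]_x (cut_power b n (q x) * P x) = (levy_cst b)^-1 *
    \int[leb]_s (window n s * expR (- b * s) *
      \int[mu]_x ((1 - expR (- expR s * q x)) * P x)).
Proof.
move=> lP; have lw := L1_window_exp n.
pose F (u : T * measurableTypeR R) := window n u.2 * levy b (q u.1) u.2 * P u.1.
have lF : L1 (mu \x leb)%E F.
  apply: (L1_le _ _ (L1_prodM (L1_norm lP) lw)).
    apply: measurable_funM; last exact: (measurableT_comp (L1_meas lP) measurable_fst).
    apply: measurable_funM; last exact: measurable_levy2.
    exact: (measurableT_comp (@measurable_window R n) measurable_snd).
  move=> u; have /andP[h1 h2] := window_levy_bnd n u.2 (q0 u.1).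
  by rewrite /F normrM (ger0_norm h1) mulrC ler_wpM2l.
have lq s : L1 mu (fun x => (1 - expR (- expR s * q x)) * P x).
  apply: (@L1_bndM _ _ _ mu 1) => //.
    apply: measurable_funB => //; apply: (measurableT_comp (@measurable_expR R)).
    exact: measurable_funM.
  move=> x; have : 0 <= 1 - expR (- expR s * q x).
    by rewrite subr_ge0 expR_le1 mulNr oppr_le0 mulr_ge0 ?expR_ge0.
  by move=> h; rewrite ger0_norm// gerBl expR_ge0.
have e s : \int[mu]_x F (x, s) = window n s * expR (- b * s) *
    \int[mu]_x ((1 - expR (- expR s * q x)) * P x).
  rewrite -RintegralZl//; last exact: lq.
  by apply: eq_Rintegral => x _; rewrite /F /levy/=; ring.
split.
  have := L1_prod2 lF; congr (L1 _ _); apply/funext => s; exact: e.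
under [X in _ = _ * X]eq_Rintegral do rewrite -e.
rewrite -(Rint_swap lF) -RintegralZl//; last exact: (L1_prod1 lF).
apply: eq_Rintegral => x _; rewrite /F/= RintegralZr//.
  by rewrite mulrA.
exact: L1_window_levy.
Qed.

Lemma cut_power_cvgL2 (F : T -> R) : L2 mu (fun x => q x `^ b * F x) ->
  measurable_fun setT F ->
  (nrm2 mu (fun x => cut_power b n (q x) * F x - q x `^ b * F x) @[n --> \oo] --> (0 : R))%classic.
Proof.
move=> lF mF.
apply: (@cvg_nrm2 _ _ _ mu (fun n x => cut_power b n (q x) * F x) _ _ _ (fun x => `|q x `^ b * F x|)).
- exact: lF.1.
- by move=> n; apply: measurable_funM => //; exact: measurable_cut_power.
- split; first by apply: measurableT_comp => //; exact: lF.1.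
  have := lF.2; congr (L1 _ _); apply/funext => x; by rewrite real_normK ?num_real.
- move=> n x; rewrite -mulrBl !normrM ler_wpM2r// (ger0_norm (powR_ge0 _ _)).
  have h1 := cut_power_ge0 b01 n (q0 x); have h2 := cut_power_le b01 n (q0 x).
  by rewrite distrC ger0_norm ?subr_ge0// gerBl.
- by apply: aeW => x; apply: cvgM; [exact: cut_power_cvg|exact: cvg_cst].
Qed.

End levy_form.

(** * The antisymmetric test function *)

Lemma measurable_natb (R : realType) d (T : measurableType d) (p : T -> bool) :
  measurable_fun setT p -> measurable_fun setT (fun x => (p x)%:R : R).
Proof.
move=> mp; rewrite (_ : (fun x => _) = (fun x => if p x then 1 else 0)).
  exact: measurable_fun_ifT.
by apply/funext => x; case: (p x).
Qed.

Section folding.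
Context {R : realType} (n : nat).
Local Notation V := 'rV[R]_n.+1.
Local Notation mu := (@lebesgue_rV R n.+1).
Variable c : R.
Local Notation sg := (refl c).
Implicit Types (x y : V) (F : V * V -> R).

Definition reflL (z : V * V) : V * V := (sg z.1, z.2).
Definition reflR (z : V * V) : V * V := (z.1, sg z.2).

Lemma measurable_reflL : measurable_fun setT reflL.
Proof.
apply: measurable_fun_pair; last exact: measurable_snd.
exact: (measurableT_comp (measurable_refl c) measurable_fst).
Qed.

Lemma L1_reflL F : L1 (mu \x mu)%E F -> L1 (mu \x mu)%E (F \o reflL).
Proof.
move=> lF; have mF := L1_meas lF.
have mE : measurable_fun setT (EFin \o F) by exact/measurable_EFinP.
have mA : measurable_fun setT (fun z => `|(F z)%:E|%E) by exact: measurableT_comp.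
have [+ _] := integrable12ltyP mu mu mE => /(_ lF) h.
have mE' : measurable_fun setT (EFin \o (F \o reflL)).
  by apply/measurable_EFinP; exact: (measurableT_comp mF measurable_reflL).
have [_] := integrable12ltyP mu mu mE'; apply.
have mf := measurable_fun_fubini_tonelli_F _ mA (fun z => abse_ge0 _).
move: h; rewrite -(@ge0_integral_preserving _ _ _ mu _ (measurable_refl c) (@lebesgue_refl R n c) _ (mf mu))//.
by move=> x; exact: integral_ge0.
Qed.

Lemma Rint_reflL F : L1 (mu \x mu)%E F ->
  \int[(mu \x mu)%E]_z F (reflL z) = \int[(mu \x mu)%E]_z F z.
Proof.
move=> lF; rewrite -(Rint_prod1 (L1_reflL lF)) -(Rint_prod1 lF) /=.
by rewrite -[RHS](Rint_refl c (L1_meas (L1_prod1 lF))).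
Qed.

Lemma Rint_swap_pair F : L1 (mu \x mu)%E F ->
  \int[(mu \x mu)%E]_z F (swap_pair z) = \int[(mu \x mu)%E]_z F z.
Proof.
by move=> lF; rewrite -(Rint_prod1 (L1_swap lF)) -(Rint_prod2 lF).
Qed.

Lemma reflRE F : F \o reflR = ((F \o swap_pair) \o reflL) \o swap_pair.
Proof. by apply/funext => -[]. Qed.

Lemma L1_reflR F : L1 (mu \x mu)%E F -> L1 (mu \x mu)%E (F \o reflR).
Proof. by move=> lF; rewrite reflRE; exact: (L1_swap (L1_reflL (L1_swap lF))). Qed.

Lemma Rint_reflR F : L1 (mu \x mu)%E F ->
  \int[(mu \x mu)%E]_z F (reflR z) = \int[(mu \x mu)%E]_z F z.
Proof.
move=> lF; have l1 := L1_swap lF; have l2 := L1_reflL l1.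
transitivity (\int[(mu \x mu)%E]_z (((F \o swap_pair) \o reflL) \o swap_pair) z).
  by rewrite -reflRE.
rewrite (@Rint_swap_pair ((F \o swap_pair) \o reflL))//.
by rewrite (@Rint_reflL (F \o swap_pair))// Rint_swap_pair.
Qed.

(** fold8 sums over the group of order eight generated by the reflections of the
    two variables and their exchange. *)
Definition foldL F z := F z + F (reflL z).
Definition foldR F z := F z + F (reflR z).
Definition fold_swap F z := F z + F (swap_pair z).
Definition fold8 F := fold_swap (foldR (foldL F)).

Lemma fold8P F : L1 (mu \x mu)%E F -> L1 (mu \x mu)%E (fold8 F) /\
  \int[(mu \x mu)%E]_z fold8 F z = 8 * \int[(mu \x mu)%E]_z F z.
Proof.
move=> lF.
have l1 : L1 (mu \x mu)%E (foldL F) by apply: L1D => //; exact: L1_reflL.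
have l2 : L1 (mu \x mu)%E (foldR (foldL F)) by apply: L1D => //; exact: L1_reflR.
have l3 : L1 (mu \x mu)%E (fold8 F) by apply: L1D => //; exact: L1_swap.
split => //.
rewrite RintegralD//; last exact: L1_swap.
rewrite Rint_swap_pair// RintegralD//; last exact: L1_reflR.
rewrite Rint_reflR// RintegralD//; last exact: L1_reflL.
by rewrite Rint_reflL//; ring.
Qed.

End folding.

Section antisymmetric_test.
Context {R : realType} (n : nat).
Local Notation V := 'rV[R]_n.+1.
Local Notation mu := (@lebesgue_rV R n.+1).
Context (c : R) (phi : V -> R).
Hypothesis phi_gt0 : forall x, 0 < phi x.
Hypothesis phi_L2 : L2 mu phi.
Local Notation sg := (refl c).
Implicit Types (x y : V).

Definition defect x : bool := (x ord0 ord0 <= c) && (phi x < phi (sg x)).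
Definition mirror_sign x : R := (defect x)%:R - (defect (sg x))%:R.
(** The odd sign makes the test function orthogonal to phi; the weight phi o sg,
    rather than a weight 1, is the one for which the folded heat pairing has a
    sign. *)
Definition mirror_test x : R := mirror_sign x * phi (sg x).

Lemma refl_fixed x : x ord0 ord0 = c -> sg x = x.
Proof.
move=> xc; rewrite -[RHS](rV_unconsK x) /refl xc; congr (rV_cons _).
by rewrite [RHS]surjective_pairing; congr pair; rewrite /= xc; ring.
Qed.

Lemma mirror_signN x : mirror_sign (sg x) = - mirror_sign x.
Proof. by rewrite /mirror_sign reflK opprB. Qed.

Lemma mirror_sign_lo x : x ord0 ord0 <= c -> mirror_sign x = (phi x < phi (sg x))%R%:R.
Proof.
move=> xc; rewrite /mirror_sign /defect xc/= reflK refl0E.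
have [x_eq|x_ne] := eqVneq (x ord0 ord0) c.
  by rewrite (refl_fixed x_eq) ltxx andbF subrr.
have x_lt : x ord0 ord0 < c by rewrite lt_neqAle x_ne.
suff -> : (2 * c - x ord0 ord0 <= c) = false by rewrite subr0.
by apply/negbTE; rewrite -ltNge; lra.
Qed.

Lemma mirror_sign_hi x : c <= x ord0 ord0 -> mirror_sign x = - (phi (sg x) < phi x)%R%:R.
Proof.
move=> cx; rewrite -(reflK c x) mirror_signN mirror_sign_lo ?reflK//.
by rewrite refl0E; lra.
Qed.

Lemma defect_sign x : defect x -> mirror_sign x = 1.
Proof. by move=> /andP[h1 h2]; rewrite mirror_sign_lo// h2. Qed.

Lemma measurable_defect : measurable_fun setT defect.
Proof.
have mp := phi_L2.1.
apply: measurable_and.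
  by apply: measurable_fun_ler => //; exact: measurable_rV_coord.
by apply: measurable_fun_ltr => //; exact: (measurableT_comp mp (measurable_refl c)).
Qed.

Lemma measurable_mirror_sign : measurable_fun setT mirror_sign.
Proof.
apply: measurable_funB; apply: measurable_natb; first exact: measurable_defect.
exact: (measurableT_comp measurable_defect (measurable_refl c)).
Qed.

Lemma mirror_sign_norm x : `|mirror_sign x| <= 1.
Proof. by rewrite /mirror_sign; do 2 case: (defect _); rewrite ?subrr ?subr0 ?sub0r ?normrN ?normr1 ?normr0. Qed.

Lemma L2_mirror_test : L2 mu mirror_test.
Proof.
apply: (@L2_bndM _ _ _ mu 1); [exact: measurable_mirror_sign|exact: mirror_sign_norm|].
exact: L2_refl.
Qed.

(** The sign is odd under the reflection, phi times its reflection is even. *)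
Lemma mirror_test_orth : \int[mu]_x (mirror_test x * phi x) = 0.
Proof.
have l : L1 mu (fun x => mirror_test x * phi x) by apply: L1_L2M => //; exact: L2_mirror_test.
have := Rint_refl c (L1_meas l).
have -> : \int[mu]_x (mirror_test (sg x) * phi (sg x)) = \int[mu]_x (- 1 * (mirror_test x * phi x)).
  by apply: eq_Rintegral => x _; rewrite /mirror_test mirror_signN reflK; ring.
rewrite RintegralZl//; lra.
Qed.

(** The sign of the folded integrand. Here a, A and b, B are the values of phi at
    two points before the mirror and at their images, and P, P' the kernels of
    the direct and of the reflected pair. When exactly one of the points is a
    defect, the inequality P' <= P is what lets the positive term win. *)
Lemma fold_ineq (a A b B P P' zx zy : R) : 0 < a -> 0 < A -> 0 < b -> 0 < B ->
  0 <= P' <= P -> zx = (a < A)%R%:R -> zy = (b < B)%R%:R ->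
  0 <= P * (A * b - a * B) * (zx - zy) + P' * (A * B - a * b) * (zx + zy).
Proof.
move=> a0 A0 b0 B0 /andP[P0 PP] -> ->.
have key (u U w W : R) : 0 < u -> 0 < U -> 0 < w -> 0 < W -> u < U -> W <= w ->
    0 <= P * (U * w - u * W) + P' * (U * W - u * w).
  move=> u0 U0 w0 W0 uU Ww.
  have h1 : 0 <= U * w - u * W by nra.
  rewrite (_ : _ + _ = (P - P') * (U * w - u * W) + P' * ((U - u) * (w + W))); last by ring.
  by rewrite addr_ge0// mulr_ge0// ?subr_ge0// mulr_ge0 ?subr_ge0 ?addr_ge0// ltW.
have [aA|Aa] := ltP a A; have [bB|Bb] := ltP b B => /=.
- rewrite subrr mulr0 add0r; apply: mulr_ge0 => //; apply: mulr_ge0 => //; nra.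
- by have := key _ _ _ _ a0 A0 b0 B0 aA Bb; rewrite subr0 addr0 !mulr1.
- have := key _ _ _ _ b0 B0 a0 A0 bB Aa.
  by rewrite sub0r add0r !mulr1 => h; apply: (le_trans h); rewrite le_eqVlt; apply/orP; left; apply/eqP; ring.
- by rewrite subrr addr0 !mulr0 addr0.
Qed.

Lemma heat_kernel_refl t x y : 0 < t ->
  0 <= (c - x ord0 ord0) * (c - y ord0 ord0) ->
  heat_kernel t (x - sg y) <= heat_kernel t (x - y).
Proof.
move=> t0 h; rewrite ler_pM2l ?heat_peak_gt0// ler_expR !mulNr lerN2.
rewrite ler_pM2l ?invr_gt0 ?mulr_gt0// sqdist_reflr lerDl mulr_ge0//.
Qed.

Lemma heat_kernel_reflC t x y : heat_kernel t (sg x - y) = heat_kernel t (x - sg y).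
Proof. by rewrite /heat_kernel sqdist_reflC. Qed.

Lemma heat_kernel_refl2 t x y : heat_kernel t (sg x - sg y) = heat_kernel t (x - y).
Proof. by rewrite /heat_kernel sqdist_refl. Qed.

Definition test_density t (z : V * V) : R :=
  mirror_test z.1 * (heat_kernel t (z.1 - z.2) * phi z.2).

Lemma fold8E t x y : fold8 c (test_density t) (x, y) =
  heat_kernel t (x - y) * (phi (sg x) * phi y - phi x * phi (sg y)) *
    (mirror_sign x - mirror_sign y) +
  heat_kernel t (x - sg y) * (phi (sg x) * phi (sg y) - phi x * phi y) *
    (mirror_sign x + mirror_sign y).
Proof.
rewrite /fold8 /fold_swap /foldR /foldL /reflL /reflR /test_density /mirror_test /=.
rewrite !mirror_signN !reflK !heat_kernel_refl2 !heat_kernel_reflC.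
rewrite (heat_kernel_sym t y x) (heat_kernel_sym t y (sg x)) heat_kernel_reflC.
ring.
Qed.

Lemma heat_kernel_refl_opposite t x y : 0 < t ->
  0 <= (x ord0 ord0 - c) * (c - y ord0 ord0) ->
  heat_kernel t (x - y) <= heat_kernel t (x - sg y).
Proof.
move=> t0 h; have := @heat_kernel_refl t (sg x) y t0; rewrite refl0E.
rewrite heat_kernel_refl2 heat_kernel_reflC; apply.
by rewrite (_ : c - _ = x ord0 ord0 - c) //; ring.
Qed.

(** The four cases are the positions of x and y relative to the mirror. Each is
    the inequality between numbers above, applied to the points before the
    mirror among x, y and their images. *)
Lemma fold8_ge0 t z : 0 < t -> 0 <= fold8 c (test_density t) z.
Proof.
move=> t0; case: z => x y; rewrite fold8E.
have k0 := heat_kernel_ge0 (x - y) t0; have k1 := heat_kernel_ge0 (x - sg y) t0.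
have p0 := phi_gt0.
have [xc|cx] := leP (x ord0 ord0) c; have [yc|cy] := leP (y ord0 ord0) c.
- apply: fold_ineq; rewrite ?p0 ?mirror_sign_lo// k1/= heat_kernel_refl//.
  by rewrite mulr_ge0 ?subr_ge0.
- have PP : 0 <= heat_kernel t (x - y) <= heat_kernel t (x - sg y).
    rewrite k0/= heat_kernel_sym -(heat_kernel_sym t (sg y)) heat_kernel_reflC.
    by apply: heat_kernel_refl_opposite => //; rewrite mulr_ge0 ?subr_ge0// ltW.
  have := fold_ineq (p0 x) (p0 (sg x)) (p0 (sg y)) (p0 y) PP (mirror_sign_lo xc) (erefl _).
  rewrite (mirror_sign_hi (ltW cy)).
  by move=> h; apply: (le_trans h); rewrite le_eqVlt; apply/orP; left; apply/eqP; ring.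
- have PP : 0 <= heat_kernel t (x - y) <= heat_kernel t (x - sg y).
    by rewrite k0/=; apply: heat_kernel_refl_opposite => //; rewrite mulr_ge0 ?subr_ge0// ltW.
  have := fold_ineq (p0 (sg x)) (p0 x) (p0 y) (p0 (sg y)) PP (erefl _) (mirror_sign_lo yc).
  rewrite (mirror_sign_hi (ltW cx)).
  by move=> h; apply: (le_trans h); rewrite le_eqVlt; apply/orP; left; apply/eqP; ring.
- have PP : 0 <= heat_kernel t (x - sg y) <= heat_kernel t (x - y).
    rewrite k1/= heat_kernel_refl// -mulrNN mulr_ge0// opprB subr_ge0 ltW//.
  have := fold_ineq (p0 (sg x)) (p0 x) (p0 (sg y)) (p0 y) PP (erefl _) (erefl _).
  rewrite (mirror_sign_hi (ltW cx)) (mirror_sign_hi (ltW cy)).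
  by move=> h; apply: (le_trans h); rewrite le_eqVlt; apply/orP; left; apply/eqP; ring.
Qed.

Lemma L1_test_density t : 0 < t -> L1 (mu \x mu)%E (test_density t).
Proof. by move=> t0; apply: L1_heat_pair => //; exact: L2_mirror_test. Qed.

Lemma Rint_test_density t : 0 < t ->
  \int[mu]_x (mirror_test x * heat t phi x) = \int[(mu \x mu)%E]_z test_density t z.
Proof.
move=> t0; rewrite -(Rint_prod1 (L1_test_density t0)); apply: eq_Rintegral => x _.
rewrite /test_density/= RintegralZl//.
by apply: L1_L2M => //; exact: L2_heat_kernel.
Qed.

(** The integrand becomes nonnegative once summed over the group of symmetries of
    the integral. *)
Lemma mirror_test_heat_ge0 t : 0 < t -> 0 <= \int[mu]_x (mirror_test x * heat t phi x).
Proof.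
move=> t0; rewrite Rint_test_density//.
have [_ e] := fold8P c (L1_test_density t0).
have : 0 <= \int[(mu \x mu)%E]_z fold8 c (test_density t) z.
  by apply: Rintegral_ge0 => z _; exact: fold8_ge0.
by rewrite e pmulr_rge0.
Qed.

(** A minorant of the folded density that does not depend on t in [1, e]: it keeps
    the pairs of defect points, where the folded density is positive, with the
    peak at t = e and the exponent at t = 1. *)
Definition density_minorant (z : V * V) : R :=
  (defect z.1)%:R * (defect z.2)%:R *
  (2 * (heat_peak n.+1 (expR 1) * expR (- (4^-1) * dotp (z.1 - sg z.2) (z.1 - sg z.2)) *
    (phi (sg z.1) * phi (sg z.2) - phi z.1 * phi z.2))).

Lemma heat_kernel_minorant t (w : V) : 1 <= t -> t <= expR 1 ->
  heat_peak n.+1 (expR 1) * expR (- (4^-1) * dotp w w) <= heat_kernel t w.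
Proof.
move=> t1 te; have t0 : 0 < t by apply: lt_le_trans t1.
apply: ler_pM; rewrite ?expR_ge0 ?(ltW (heat_peak_gt0 _ _)) ?expR_gt0//.
  rewrite /heat_peak lef_pV2 ?posrE ?exprn_gt0 ?sqrtr_gt0 ?mulr_gt0 ?pi_gt0 ?expR_gt0//.
  by apply: lerXn2r; rewrite ?nnegrE ?sqrtr_ge0// ler_wsqrtr// ler_pM2l// mulr_gt0 ?pi_gt0.
rewrite ler_expR !mulNr lerN2 ler_wpM2r ?dotp_ge0// lef_pV2 ?posrE ?mulr_gt0//.
by rewrite ler_peMr.
Qed.

Lemma density_minorant_le t z : 1 <= t -> t <= expR 1 ->
  0 <= density_minorant z <= fold8 c (test_density t) z.
Proof.
move=> t1 te; have t0 : 0 < t by apply: lt_le_trans t1.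
have f0 := fold8_ge0 z t0; rewrite /density_minorant.
case: z f0 => x y f0 /=.
case: (boolP (defect x)) => dx; last by rewrite !mul0r lexx.
case: (boolP (defect y)) => dy; last by rewrite mulr0 !mul0r lexx.
rewrite !mul1r fold8E !defect_sign// subrr mulr0 add0r.
have /andP[_ ax] := dx; have /andP[_ ay] := dy.
have ax0 := phi_gt0 x; have ay0 := phi_gt0 y.
have d0 : 0 <= phi (sg x) * phi (sg y) - phi x * phi y by nra.
have hk := heat_kernel_minorant (x - sg y) t1 te.
have hk0 : 0 <= heat_peak n.+1 (expR 1) * expR (- (4^-1) * dotp (x - sg y) (x - sg y)).
  by rewrite mulr_ge0 ?expR_ge0 ?(ltW (heat_peak_gt0 _ _)) ?expR_gt0.
apply/andP; split; first by rewrite mulr_ge0// mulr_ge0.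
set D := _ - _ in d0 *.
have -> : heat_kernel t (x - sg y) * D * (1 + 1) = 2 * (heat_kernel t (x - sg y) * D) by ring.
by rewrite ler_pM2l// ler_wpM2r.
Qed.

Lemma measurable_density_minorant : measurable_fun setT density_minorant.
Proof.
have mp := phi_L2.1; have mpr := measurableT_comp mp (@measurable_refl R n c).
have md := measurable_defect.
apply: measurable_funM.
  by apply: measurable_funM; apply: measurable_natb;
    [exact: (measurableT_comp md measurable_fst)|exact: (measurableT_comp md measurable_snd)].
apply: measurable_funM => //; apply: measurable_funM.
  apply: measurable_funM => //; apply: measurable_expRM; apply: measurable_sqdist => //.
  exact: (measurableT_comp (measurable_refl c) measurable_snd).
apply: measurable_funB; apply: measurable_funM.
- exact: (measurableT_comp mpr measurable_fst).
- exact: (measurableT_comp mpr measurable_snd).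
- exact: (measurableT_comp mp measurable_fst).
- exact: (measurableT_comp mp measurable_snd).
Qed.

Lemma e_ge1 : 1 <= expR 1 :> R.
Proof. by have := expR_ge1Dx (1 : R); lra. Qed.

Lemma L1_density_minorant : L1 (mu \x mu)%E density_minorant.
Proof.
have [l _] := fold8P c (L1_test_density ltr01).
apply: (L1_le measurable_density_minorant _ l) => z.
by have /andP[h0 h1] := density_minorant_le z (lexx 1) e_ge1; rewrite ger0_norm.
Qed.

Lemma mirror_test_heat_ge t : 1 <= t -> t <= expR 1 ->
  \int[(mu \x mu)%E]_z density_minorant z / 8 <=
  \int[mu]_x (mirror_test x * heat t phi x).
Proof.
move=> t1 te; have t0 : 0 < t by apply: lt_le_trans t1.
have [l e] := fold8P c (L1_test_density t0).
rewrite Rint_test_density// ler_pdivrMr// mulrC -e.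
apply: le_Rint => //; first exact: L1_density_minorant.
by move=> z; have /andP[] := density_minorant_le z t1 te.
Qed.

(** The minorant is positive on the square of the defect set. *)
Lemma Rint_density_minorant_gt0 :
  (0 < mu [set x | defect x]%classic)%E -> 0 < \int[(mu \x mu)%E]_z density_minorant z.
Proof.
move=> D0; have lm := L1_density_minorant; have mm := measurable_density_minorant.
have m0 z : 0 <= density_minorant z.
  by have /andP[] := density_minorant_le z (lexx 1) e_ge1.
rewrite lt0r Rintegral_ge0// andbT; apply/eqP => e0.
have i0 : (\int[(mu \x mu)%E]_z `|(density_minorant z)%:E| = 0)%E.
  under eq_integral do rewrite gee0_abs ?lee_fin//.
  rewrite -[LHS]fineK; last exact: integrable_fin_num lm.
  by rewrite -[fine _]/(\int[(mu \x mu)%E]_z density_minorant z) e0.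
have mE : measurable_fun setT (EFin \o density_minorant) by exact/measurable_EFinP.
have [/(_ i0) + _] := ae_eq_integral_abs (mu \x mu)%E measurableT mE.
move=> [N [mN N0 sN]].
have mD : measurable [set x | defect x]%classic.
  have md := measurable_defect.
  by have := md measurableT [set true]%classic I; rewrite setTI.
have : (mu [set x | defect x]%classic * mu [set x | defect x]%classic <= 0)%E.
  rewrite -N0 -(product_measure1E mu mu mD mD).
  apply: le_measure; rewrite ?inE//; first exact: measurableX.
  move=> [x y] [/= dx dy]; apply: sN => /= /(_ Logic.I) /eqP.
  rewrite eqe /density_minorant /= dx dy !mul1r gt_eqF//.
  have /andP[_ ax] := dx; have /andP[_ ay] := dy.
  have ax0 := phi_gt0 x; have ay0 := phi_gt0 y.
  have d0 : 0 < phi (sg x) * phi (sg y) - phi x * phi y by nra.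
  by rewrite !mulr_gt0 ?expR_gt0 ?heat_peak_gt0 ?expR_gt0.
by rewrite leNgt mule_gt0.
Qed.

End antisymmetric_test.

(** * Truncation adapted to almost everywhere convergent sequences *)

Section approximation.
Context d (T : measurableType d) (R : realType).
Variable mu : {sigma_finite_measure set T -> \bar R}.
Implicit Types f g : T -> R.

Lemma cvg_bounded_nat (u : nat -> R) (l : R) : (u n @[n --> \oo] --> l)%classic ->
  exists N : nat, forall n, `|u n| <= N%:R.
Proof.
move=> c; have /cvg_seq_bounded : cvgn u by apply/cvg_ex; exists l.
move=> [M [Mr hM]]; exists (Num.truncn (`|M| + 1)).+1 => n.
apply: (le_trans _ (ltW (Num.Theory.truncnS_gt _))).
apply: hM => //; have := ler_norm M; lra.
Qed.

(** f is cut off outside a set of finite measure and wherever f or some term of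
    one of the sequences exceeds k. Where the sequences converge they are
    bounded, so the cut disappears in the limit; and for fixed k dominated
    convergence applies on the set that is kept. *)
Lemma good_truncation f (u v : nat -> T -> R) (u0 v0 : T -> R) : L2 mu f ->
  (forall n, measurable_fun setT (u n)) -> (forall n, measurable_fun setT (v n)) ->
  measurable_fun setT u0 -> measurable_fun setT v0 ->
  {ae mu, forall x, (u n x @[n --> \oo] --> u0 x)%classic} ->
  {ae mu, forall x, (v n x @[n --> \oo] --> v0 x)%classic} ->
  exists g : nat -> T -> R, [/\ (forall k x, `|g k x| <= `|f x|),
    (forall k, L1 mu (g k) /\ L2 mu (g k)),
    (nrm2 mu (fun x => g k x - f x) @[k --> \oo] --> (0 : R))%classic,
    (forall k, (\int[mu]_x (g k x * u n x) @[n --> \oo] --> \int[mu]_x (g k x * u0 x))%classic) &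
    (forall k, (\int[mu]_x (g k x * v n x) @[n --> \oo] --> \int[mu]_x (g k x * v0 x))%classic)].
Proof.
move=> [mf lf] mu_ mv mu0 mv0 cu cv.
have /sigma_finiteP[A [AT ndA Aoo]] := sigma_finiteT mu.
have mle (w : T -> R) (k : nat) : measurable_fun setT w -> measurable [set x | `|w x| <= k%:R]%classic.
  move=> mw; rewrite -[X in measurable X]setTI.
  by apply: measurable_fun_le => //; exact: measurableT_comp.
pose D k := (A k `&` [set x | `|f x| <= k%:R] `&`
  ((\bigcap_n [set x | `|u n x| <= k%:R]) `&` (\bigcap_n [set x | `|v n x| <= k%:R])))%classic.
have mD k : measurable (D k).
  apply: measurableI; first by apply: measurableI; [exact: (Aoo k).1|exact: mle].
  by apply: measurableI; apply: bigcap_measurable => // n _; exact: mle.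
pose g k x := \1_(D k) x * f x.
have mg k : measurable_fun setT (g k) by apply: measurable_funM.
have gf k x : `|g k x| <= `|f x|.
  by rewrite normrM ler_piMl// indicE; case: (_ \in _); rewrite ?normr1 ?normr0.
have l1D k : L1 mu (\1_(D k)).
  apply/integrableP; split; first exact/measurable_EFinP.
  under eq_integral do rewrite /= ger0_norm//.
  rewrite integral_indic// setIT.
  apply: (le_lt_trans _ (Aoo k).2); apply: le_measure; rewrite ?inE//.
    exact: (Aoo k).1.
  by move=> x [[]].
have gb k x : `|g k x| <= k%:R * \1_(D k) x.
  rewrite /g normrM indicE; case: (boolP (x \in D k)) => [|_]; last by rewrite normr0 mul0r mulr0.
  by rewrite inE => -[[_ fk] _]; rewrite normr1 mul1r mulr1.
have test (w : nat -> T -> R) (w0 : T -> R) k : (forall n, measurable_fun setT (w n)) ->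
    measurable_fun setT w0 -> {ae mu, forall x, (w n x @[n --> \oo] --> w0 x)%classic} ->
    (forall n x, D k x -> `|w n x| <= k%:R) ->
    (\int[mu]_x (g k x * w n x) @[n --> \oo] --> \int[mu]_x (g k x * w0 x))%classic.
  move=> mw mw0 cw wk.
  have lG : L1 mu (fun x => (k%:R * k%:R) * \1_(D k) x) by exact: L1Z.
  have mf_ n : measurable_fun setT (fun x => g k x * w n x) by exact: measurable_funM.
  have bf n x : `|g k x * w n x| <= (k%:R * k%:R) * \1_(D k) x.
    rewrite /g indicE; case: (boolP (x \in D k)) => [|_]; last by rewrite !mul0r normr0 mulr0.
    rewrite inE => Dx; rewrite mul1r mulr1 normrM; apply: ler_pM => //.
      by case: Dx => -[].
    exact: wk.
  have c : {ae mu, forall x, (g k x * w n x @[n --> \oo] --> g k x * w0 x)%classic}.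
    by apply: filterS cw => x cx; apply: cvgM => //; exact: cvg_cst.
  by have [_] := Rdominated mf_ (measurable_funM (mg k) mw0) c lG bf.
exists g; split => //.
- move=> k; split.
    by apply: (L1_le (mg k) (gb k)); exact: L1Z.
  apply: (@L2_le _ _ _ mu _ (fun x => `|f x|)) => //; split; first exact: measurableT_comp.
  by move: lf; congr (L1 _ _); apply/funext => x; rewrite real_normK ?num_real.
- apply: (@cvg_nrm2 _ _ _ mu g f mf mg (fun x => `|f x|)).
  + split; first exact: measurableT_comp.
    by move: lf; congr (L1 _ _); apply/funext => x; rewrite real_normK ?num_real.
  + move=> k x; rewrite /g indicE; case: (_ \in _); first by rewrite mul1r subrr normr0.
    by rewrite mul0r sub0r normrN.
  + move: cu cv; apply: filterS2 => x /cvg_bounded_nat[N1 h1] /cvg_bounded_nat[N2 h2].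
    have [K AK] : exists K, A K x.
      by have : (\bigcup_i A i)%classic x; [rewrite -AT|case=> K _ AK; exists K].
    apply: cvg_near_cst; exists (maxn (maxn K (Num.truncn `|f x|).+1) (maxn N1 N2)) => // k /=.
    rewrite !geq_max => /andP[/andP[Kk fk] /andP[N1k N2k]].
    rewrite /g indicE mem_set ?mul1r//; split; first split.
    * by move: x AK {h1 h2 fk}; exact/subsetPset/ndA.
    * apply: (@le_trans _ _ (Num.truncn `|f x|).+1%:R); first exact/ltW/Num.Theory.truncnS_gt.
      by rewrite ler_nat.
    * split => m _ /=.
        by apply: (le_trans (h1 m)); rewrite ler_nat.
      by apply: (le_trans (h2 m)); rewrite ler_nat.
- by move=> k; apply: test => // n x [_ [h _]]; exact: (h n).
- by move=> k; apply: test => // n x [_ [_ h]]; exact: (h n).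
Qed.

End approximation.

(** * Testing the eigenvalue equation *)

Section operator_form.
Local Open Scope complex_scope.
Context {R : realType} (d : nat).
Local Notation V := 'rV[R]_d.
Local Notation mu := (@lebesgue_rV R d).
Local Notation leb := (@lebesgue_measure R).
Local Notation cRe := (@complex.Re R).
Local Notation cIm := (@complex.Im R).
Context (b m M : R) (b01 : 0 < b < 1) (M0 : 0 <= M) (psi h F H : V -> R[i]).
Let q (xi : V) : R := dotp xi xi + M.
Hypothesis fpsi : is_fourier2 psi F.
Hypothesis fh : is_fourier2 h H.
Hypothesis HF : aeq H (fun xi => (q xi `^ b - m)%:C * F xi).
Implicit Types (xi x : V) (g : V -> R) (s : R).

Lemma q_ge0 xi : 0 <= q xi. Proof. by rewrite addr_ge0 ?dotp_ge0. Qed.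

Lemma measurable_q : measurable_fun setT q.
Proof. by apply: measurable_funD => //; exact: measurable_dotp. Qed.

Let L2F1 : L2 mu (cRe \o F). Proof. by case: fpsi => _ [mF lF] _; case: (L2_Re mF lF). Qed.
Let L2F2 : L2 mu (cIm \o F). Proof. by case: fpsi => _ [mF lF] _; case: (L2_Im mF lF). Qed.
Let L2H1 : L2 mu (cRe \o H). Proof. by case: fh => _ [mF lF] _; case: (L2_Re mF lF). Qed.
Let L2H2 : L2 mu (cIm \o H). Proof. by case: fh => _ [mF lF] _; case: (L2_Im mF lF). Qed.

Lemma cRe_mulC (k : R) (z : R[i]) : cRe (k%:C * z) = k * cRe z.
Proof. by case: z => x y /=; rewrite mul0r subr0. Qed.

Lemma cIm_mulC (k : R) (z : R[i]) : cIm (k%:C * z) = k * cIm z.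
Proof. by case: z => x y /=; rewrite mul0r addr0. Qed.

Let HF1 : {ae mu, forall xi, (cRe \o H) xi + m * (cRe \o F) xi = q xi `^ b * (cRe \o F) xi}.
Proof. by apply: filterS HF => xi /= ->; rewrite cRe_mulC; ring. Qed.

Let HF2 : {ae mu, forall xi, (cIm \o H) xi + m * (cIm \o F) xi = q xi `^ b * (cIm \o F) xi}.
Proof. by apply: filterS HF => xi /= ->; rewrite cIm_mulC; ring. Qed.

Lemma L2_powF1 : L2 mu (fun xi => q xi `^ b * (cRe \o F) xi).
Proof.
apply: (L2_ae (L2D L2H1 (L2Z m L2F1)) _ HF1).
by apply: measurable_funM; [exact: (measurable_powq b measurable_q)|exact: L2F1.1].
Qed.

Lemma L2_powF2 : L2 mu (fun xi => q xi `^ b * (cIm \o F) xi).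
Proof.
apply: (L2_ae (L2D L2H2 (L2Z m L2F2)) _ HF2).
by apply: measurable_funM; [exact: (measurable_powq b measurable_q)|exact: L2F2.1].
Qed.

Definition cut_error n : R :=
  nrm2 mu (fun xi => cut_power b n (q xi) * (cRe \o F) xi - q xi `^ b * (cRe \o F) xi) +
  nrm2 mu (fun xi => cut_power b n (q xi) * (cIm \o F) xi - q xi `^ b * (cIm \o F) xi).

Lemma cut_error_cvg : (cut_error n @[n --> \oo] --> (0 : R))%classic.
Proof.
rewrite -[X in (_ --> X)%classic](addr0 0); apply: cvgD.
  exact: (cut_power_cvgL2 b01 measurable_q q_ge0 L2_powF1 L2F1.1).
exact: (cut_power_cvgL2 b01 measurable_q q_ge0 L2_powF2 L2F2.1).
Qed.

Lemma L2_cutF n (F1 : V -> R) : L2 mu F1 -> L2 mu (fun xi => q xi `^ b * F1 xi) ->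
  L2 mu (fun xi => cut_power b n (q xi) * F1 xi).
Proof.
move=> [mF1 _] lF; apply: (@L2_le _ _ _ mu _ (fun xi => `|q xi `^ b * F1 xi|)).
- by apply: measurable_funM => //; apply: measurable_cut_power; exact: measurable_q.
- move=> xi; rewrite (normrM (cut_power _ _ _)) (normrM (_ `^ _)) ler_wpM2r//.
  rewrite (ger0_norm (cut_power_ge0 b01 n (q_ge0 xi))) (ger0_norm (powR_ge0 _ _)).
  exact: (cut_power_le b01 n (q_ge0 xi)).
- split; first by apply: measurableT_comp => //; exact: lF.1.
  by have := lF.2; congr (L1 _ _); apply/funext => xi; rewrite real_normK ?num_real.
Qed.

(** Here h + m psi is the image of psi under the multiplier (|xi|^2 + M)^b.
    Parseval's identity transfers the pairing with g to the frequency side,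
    the power is replaced by its truncation at the cost of cut_error, and
    each exponential exp(-t(|xi|^2 + M)), t = exp s, is transferred back as
    exp(-tM) times the heat average at time t. *)
Lemma operator_test g n : L1 mu g -> L2 mu g ->
  (\int[mu]_y (g y * heat k.+1%:R^-1 (cRe \o psi) y) @[k --> \oo] -->
   \int[mu]_y (g y * cRe (psi y)))%classic ->
  (\int[mu]_y (g y * heat k.+1%:R^-1 (cRe \o h) y) @[k --> \oo] -->
   \int[mu]_y (g y * cRe (h y)))%classic ->
  let A s := window n s * expR (- b * s) * (\int[mu]_y (g y * cRe (psi y)) -
      expR (- M * expR s) * \int[mu]_y (g y * heat (expR s) (cRe \o psi) y)) in
  L1 leb A /\
  \int[mu]_y (g y * (cRe (h y) + m * cRe (psi y))) <=
    (levy_cst b)^-1 * \int[leb]_s A s + cut_error n * nrm2 mu g.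
Proof.
move=> l1 l2 cpsi ch A.
have [lc ls nc ns] := bessel l1 l2.
have epsi := parseval fpsi l1 l2 cpsi.
have eh := parseval fh l1 l2 ch.
pose P xi := cRe (F xi) * costr g xi - cIm (F xi) * sintr g xi.
have lP : L1 mu P by apply: L1B; apply: L1_L2M.
have lps : L2 mu (cRe \o psi) by case: fpsi => [[mp fp] _ _]; case: (L2_Re mp fp).
have lhs : L2 mu (cRe \o h) by case: fh => [[mp fp] _ _]; case: (L2_Re mp fp).
have AE s : A s = window n s * expR (- b * s) * \int[mu]_xi ((1 - expR (- expR s * q xi)) * P xi).
  rewrite /A epsi (fourier2_heat_pairing (expR_gt0 s) fpsi l1); congr (_ * _).
  have lg : L1 mu (fun xi => gaussian (expR s) xi * P xi).
    apply: (@L1_bndM _ _ _ mu 1) => //; last by move=> xi; rewrite gaussian_le1// expR_gt0.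
    exact: (L1_meas (L1_gaussian d (expR_gt0 s))).
  rewrite -RintegralZl// -RintegralB//; last exact: L1Z.
  apply: eq_Rintegral => xi _; rewrite /gaussian mulrA -expRD.
  rewrite (_ : - M * expR s + _ = - expR s * q xi); last by rewrite /q; ring.
  by rewrite -/(P xi); ring.
have [lA cA] := cut_power_pairing b01 measurable_q q_ge0 n lP.
split; first by move: lA; congr (L1 _ _); apply/funext => s; rewrite AE.
have lS : L1 mu (fun xi => q xi `^ b * cRe (F xi) * costr g xi - q xi `^ b * cIm (F xi) * sintr g xi).
  by apply: L1B; apply: L1_L2M => //; [exact: L2_powF1|exact: L2_powF2].
have e1 : \int[mu]_y (g y * (cRe (h y) + m * cRe (psi y))) =
    \int[mu]_xi (q xi `^ b * cRe (F xi) * costr g xi - q xi `^ b * cIm (F xi) * sintr g xi).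
  have lgp : L1 mu (fun y => g y * cRe (psi y)) by exact: L1_L2M.
  have lgh : L1 mu (fun y => g y * cRe (h y)) by exact: L1_L2M.
  under eq_Rintegral do rewrite mulrDr mulrCA.
  rewrite RintegralD//; last exact: L1Z.
  rewrite RintegralZl// epsi eh -RintegralZl// -RintegralD//; last 2 first.
  - by apply: L1B; apply: L1_L2M.
  - exact: L1Z.
  apply: Rint_ae; last 2 first.
  - exact: L1_meas lS.
  - by move: HF1 HF2; apply: filterS2 => xi /= e1 e2; rewrite -e1 -e2 /P; ring.
  by apply: (@L1_meas _ _ _ mu); apply: L1D; [apply: L1B; apply: L1_L2M|exact: L1Z].
pose D1 xi := cut_power b n (q xi) * (cRe \o F) xi - q xi `^ b * (cRe \o F) xi.
pose D2 xi := cut_power b n (q xi) * (cIm \o F) xi - q xi `^ b * (cIm \o F) xi.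
have lD1 : L2 mu D1 by apply: L2B; [apply: L2_cutF => //|]; exact: L2_powF1.
have lD2 : L2 mu D2 by apply: L2B; [apply: L2_cutF => //|]; exact: L2_powF2.
have lcP : L1 mu (fun xi => cut_power b n (q xi) * P xi).
  have := L1B (L1_L2M (L2_cutF n L2F1 L2_powF1) lc) (L1_L2M (L2_cutF n L2F2 L2_powF2) ls).
  congr (L1 _ _); apply/funext => xi; rewrite /P/=; ring.
have ld1 := L1_L2M lD1 lc; have ld2 := L1_L2M lD2 ls.
have e2 : \int[mu]_y (g y * (cRe (h y) + m * cRe (psi y))) =
    \int[mu]_xi (cut_power b n (q xi) * P xi) -
    \int[mu]_xi (D1 xi * costr g xi) + \int[mu]_xi (D2 xi * sintr g xi).
  rewrite e1 -RintegralB// -RintegralD//; last exact: L1B.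
  by apply: eq_Rintegral => xi _; rewrite /P /D1 /D2/=; ring.
have -> : \int[leb]_s A s = \int[leb]_s (window n s * expR (- b * s) *
    \int[mu]_xi ((1 - expR (- expR s * q xi)) * P xi)).
  by apply: eq_Rintegral => s _; exact: AE.
rewrite -cA e2.
have c1 := cauchy_schwarz lD1 lc; have c2 := cauchy_schwarz lD2 ls.
have b1 : nrm2 mu D1 * nrm2 mu (costr g) <= nrm2 mu D1 * nrm2 mu g by rewrite ler_wpM2l ?nrm2_ge0.
have b2 : nrm2 mu D2 * nrm2 mu (sintr g) <= nrm2 mu D2 * nrm2 mu g by rewrite ler_wpM2l ?nrm2_ge0.
move: c1 c2; rewrite !ler_norml => /andP[c1 _] /andP[_ c2].
rewrite /cut_error -/D1 -/D2 mulrDl; lra.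
Qed.

End operator_form.

(** * The potential well and the mirror *)

Section continuity.
Context {R : realType}.

Lemma coord_sqr_le n (x : 'rV[R]_n) i : x ord0 i ^+ 2 <= dotp x x.
Proof.
rewrite /dotp (bigD1 i)//= -expr2 lerDl; apply: sumr_ge0 => j _; exact: sqr_ge0.
Qed.

Lemma econtinuous_cts n (psi : 'rV[R]_n -> R) x :
  {for x, continuous psi} -> econtinuous psi x.
Proof.
move=> cpsi e e0; have /cvgrPdist_le/(_ e e0)/nbhs_ballP[r /= r0 rb] := cpsi.
exists (r ^+ 2); first by rewrite exprn_gt0.
move=> y yr; rewrite distrC; apply: rb; split => // i j.
rewrite (ord1 i) /ball/= -(ltr_pXn2r (ltn0Sn 1)) ?nnegrE ?(ltW r0)// real_normK ?num_real//.
by apply: le_lt_trans yr; have := coord_sqr_le (x - y) j; rewrite !mxE.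
Qed.

Lemma continuous_sqnorm n : continuous (fun x : 'rV[R]_n => dotp x x).
Proof.
apply: (@continuous_big _ _ (@GRing.add R) 0); first exact: add_continuous.
by move=> i _ x; have h := @coord_continuous R 1 n ord0 i x; exact: (cvgM h h).
Qed.

Lemma mem_eball n (a : R) (x : 'rV[R]_n) : 0 < a ->
  (x \in eball a) = (dotp x x < a ^+ 2).
Proof.
move=> a0; rewrite -(ltr_sqrt (dotp x x)) ?exprn_gt0// sqrtr_sqr gtr0_norm//.
by apply/idP/idP; rewrite inE.
Qed.

(** Off the sphere the potential is locally constant, so that the product of the
    well with phi is continuous almost everywhere. *)
Lemma eball_locally_cst n (a : R) (x : 'rV[R]_n) : 0 < a -> dotp x x <> a ^+ 2 ->
  (\forall y \near x, \1_(eball a) y = \1_(eball a) x :> R)%classic.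
Proof.
move=> a0 xa; have cx := @continuous_sqnorm n x.
have [lt|gt] := ltP (dotp x x) (a ^+ 2).
  have : (\forall y \near x, dotp y y < a ^+ 2)%classic by exact: (cvgr_lt _ cx).
  by apply: filterS => y ya; rewrite !indicE !mem_eball// ya lt.
have {}gt : a ^+ 2 < dotp x x by rewrite lt_neqAle gt andbT eq_sym; apply/eqP.
have : (\forall y \near x, a ^+ 2 < dotp y y)%classic by exact: (cvgr_gt _ cx).
by apply: filterS => y ya; rewrite !indicE !mem_eball// !ltNge (ltW ya) (ltW gt).
Qed.

Lemma measurable_eball n (a : R) : 0 < a -> measurable (eball a : set 'rV[R]_n).
Proof.
move=> a0; have mf : measurable_fun setT (fun x : 'rV[R]_n => dotp x x < a ^+ 2).
  by apply: measurable_fun_ltr => //; exact: measurable_dotp.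
have := mf measurableT [set true]%classic I; rewrite setTI.
congr (measurable _); apply/seteqP; split => x /= xa.
  by apply/set_mem; rewrite mem_eball.
by rewrite -mem_eball//; exact/mem_set.
Qed.

Lemma well_continuous n (a k v : R) (phi : 'rV[R]_n -> R) x : 0 < a ->
  continuous phi -> dotp x x <> a ^+ 2 ->
  {for x, continuous (fun y => (k + v * \1_(eball a) y) * phi y)}.
Proof.
move=> a0 cphi xa; set K := k + v * \1_(eball a) x.
have FF : ProperFilter (nbhs x) by exact: nbhs_pfilter.
have cK : (K * phi y @[y --> nbhs x] --> K * phi x)%classic.
  by apply: (@cvgM _ _ (nbhs x)); [exact: cvg_cst|exact: cphi].
apply: cvg_trans cK; apply: (@near_eq_cvg _ _ (nbhs x)).
by move: (eball_locally_cst a0 xa); apply: filterS => y e; rewrite e.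
Qed.

End continuity.

Section mirror_well.
Context {R : realType} (n : nat).
Local Notation V := 'rV[R]_n.+1.
Local Notation mu := (@lebesgue_rV R n.+1).
Context (c : R) (phi : V -> R).
Hypothesis phi_gt0 : forall x, 0 < phi x.
Hypothesis phi_L2 : L2 mu phi.

(** After adding the reflected integrand only the difference of the potential
    between a point and its image remains; it has the sign of the test
    function since the well lies on the origin's side of the mirror. *)
Lemma mirror_test_potential (k v a : R) : 0 < c -> 0 < v -> 0 < a ->
  L2 mu (fun x => (k + v * \1_(eball a) x) * phi x) ->
  0 <= \int[mu]_x (mirror_test c phi x * ((k + v * \1_(eball a) x) * phi x)).
Proof.
move=> c0 v0 a0 lU.
have lf := L2_mirror_test c phi_L2.
set G := fun x => _; have lG : L1 mu G by exact: L1_L2M.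
rewrite -[Rintegral _ _ _]/(\int[mu]_x G x).
have lGr := L1_refl c lG.
suff : 0 <= \int[mu]_x (G x + G (refl c x)).
  rewrite RintegralD// (Rint_refl c (L1_meas lG)); lra.
apply: Rintegral_ge0 => x _; rewrite /G /mirror_test mirror_signN reflK.
have -> : mirror_sign c phi x * phi (refl c x) * ((k + v * \1_(eball a) x) * phi x) +
  - mirror_sign c phi x * phi x * ((k + v * \1_(eball a) (refl c x)) * phi (refl c x)) =
  phi x * phi (refl c x) * v * (mirror_sign c phi x * (\1_(eball a) x - \1_(eball a) (refl c x))) by ring.
apply: mulr_ge0; first by rewrite !mulr_ge0// ltW.
rewrite !indicE !mem_eball// sqnorm_refl.
have [xc|cx] := leP (x ord0 ord0) c.
  rewrite mirror_sign_lo// mulr_ge0// subr_ge0 ler_nat.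
  have h : 0 <= 4 * (c * (c - x ord0 ord0)) by rewrite !mulr_ge0 ?subr_ge0// ltW.
  case: (ltP (dotp x x + _) (a ^+ 2)) => //= h1; case: ltP => // h2; lra.
rewrite mirror_sign_hi ?(ltW cx)// mulNr -mulrN opprB mulr_ge0// subr_ge0 ler_nat.
have h : 4 * (c * (c - x ord0 ord0)) <= 0.
  by rewrite pmulr_rle0// pmulr_rle0// subr_le0 ltW.
case: (ltP (dotp x x) (a ^+ 2)) => //= h1; case: ltP => // h2; lra.
Qed.

End mirror_well.


(** * Order of a ground state under reflection *)

Section mirror_order.
Local Open Scope complex_scope.
Context {R : realType} (n : nat).
Local Notation V := 'rV[R]_n.+1.
Local Notation mu := (@lebesgue_rV R n.+1).
Local Notation leb := (@lebesgue_measure R).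
Local Notation cRe := (@complex.Re R).

(** By continuity the defect persists on a box around x. *)
Lemma defect_gt0 (c : R) (phi : V -> R) (x : V) : continuous phi -> L2 mu phi ->
  x ord0 ord0 < c -> phi x < phi (refl c x) ->
  (0 < mu [set y | defect c phi y]%classic)%E.
Proof.
move=> cphi lphi xc px.
pose e := (phi (refl c x) - phi x) / 2.
have e0 : 0 < e by rewrite divr_gt0// subr_gt0.
have /cvgrPdist_lt/(_ e e0)/nbhs_ballP[r1 /= r10 b1] := cphi x.
have /cvgrPdist_lt/(_ e e0)/nbhs_ballP[r2 /= r20 b2] := cphi (refl c x).
pose r := Num.min (c - x ord0 ord0) (Num.min r1 r2).
have r0 : 0 < r by rewrite !lt_min r10 r20 subr_gt0 xc.
have [B [mB Bx] B0] := box_gt0 x r0.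
have mD : measurable [set y | defect c phi y]%classic.
  have md := measurable_defect c lphi.
  by have := md measurableT [set true]%classic I; rewrite setTI.
apply: (lt_le_trans B0); apply: le_measure; rewrite ?inE//.
move=> y /Bx yx /=; rewrite /defect.
have rc : r <= c - x ord0 ord0 by rewrite ge_min lexx.
have rr1 : r <= r1 by rewrite !ge_min lexx orbT.
have rr2 : r <= r2 by rewrite !ge_min lexx !orbT.
have /ltr_normlP[h1 h2] := yx ord0.
have -> : y ord0 ord0 <= c by lra.
have /b1 /= p1 : ball x r1 y.
  by split => // i j; rewrite (ord1 i); apply: lt_le_trans (yx j) rr1.
have /b2 /= p2 : ball (refl c x) r2 (refl c y).
  split => // i j; rewrite (ord1 i) /ball/= !mxE; case: unliftP => [k _|_] /=.
    by rewrite !mxE; apply: lt_le_trans (yx _) rr2.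
  rewrite (_ : 2 * c - _ - _ = y ord0 ord0 - x ord0 ord0); last by ring.
  by rewrite distrC; apply: lt_le_trans (yx _) rr2.
move: p1 p2 => /ltr_normlP[q1 q2] /ltr_normlP[q3 q4].
rewrite /e in q1 q2 q3 q4; lra.
Qed.

(** If the inequality fails somewhere, the defect set has positive measure and
    testing the eigenvalue equation against mirror_test contradicts the sign of
    the potential. The test function is first truncated to g j, so that Parseval's
    identity holds for it, and the power is cut to the window [-i, i]. The strict
    gain eta' comes from the times between 1 and e and does not depend on i
    or j, while the errors vanish if first i and then j is taken large. *)
Lemma ground_state_mirror (alpha m v a lam c : R) (phi : V -> R) :
  0 < alpha < 2 -> 0 <= m -> 0 < v -> 0 < a -> 0 < c ->
  continuous phi -> (forall x, 0 < phi x) ->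
  in_eigenspace (rel_hamiltonian m alpha v a) lam%:C (fun x => (phi x)%:C) ->
  forall x : V, x ord0 ord0 < c -> phi (refl c x) <= phi x.
Proof.
move=> /andP[al0 al2] m0 v0 a0 c0 cphi phi0 [_ [h [[F [H [fF fH HF]]] eqn]]] x xc.
pose psi (x : V) : R[i] := (phi x)%:C.
pose b := alpha / 2; pose M := m `^ (2 / alpha).
have b01 : 0 < b < 1 by rewrite /b; apply/andP; split; lra.
have M0 : 0 <= M by exact: powR_ge0.
have HF' : aeq H (fun xi => ((dotp xi xi + M) `^ b - m)%:C * F xi).
  by apply: filterS HF => xi ->; rewrite /rel_symbol enorm_sqr.
have [[mpsi fpsi] _ _] := fF; have [[mh fh] _ _] := fH.
have lphi : L2 mu phi by have [] := L2_Re mpsi fpsi.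
have [lh _] := L2_Re mh fh.
rewrite leNgt; apply/negP => px.
have D0 := defect_gt0 cphi lphi xc px.
have eta0 := Rint_density_minorant_gt0 phi0 lphi D0.
set eta := Rintegral _ _ _ in eta0.
pose k y := (lam + v * \1_(eball a) y) * phi y.
have mE := @measurable_eball R n.+1 a a0.
have lk : L2 mu k.
  apply: (@L2_bndM _ _ _ mu (`|lam| + v)) => //.
    by apply: measurable_funD => //; apply: measurable_funM.
  move=> y; apply: (le_trans (ler_normD _ _)); rewrite lerD2l indicE.
  by case: (_ \in _); rewrite ?mulr1 ?mulr0 ?normr0 ?gtr0_norm// ltW.
have hk : {ae mu, forall y, (cRe \o h) y = k y}.
  apply: filterS eqn => y /(congr1 cRe); rewrite /k /=.
  by case: (h y) => h1 h2 /=; rewrite !mul0r !subr0 => e; rewrite mulrDl e; ring.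
have tn j : 0 < j.+1%:R^-1 :> R by rewrite invr_gt0.
pose u j := heat j.+1%:R^-1 phi; pose w j := heat j.+1%:R^-1 (cRe \o h).
have cu : {ae mu, forall y, (u j y @[j --> \oo] --> phi y)%classic}.
  by apply: aeW => y; apply: heat_cvg => //; exact/econtinuous_cts/cphi.
(* By the equation h agrees almost everywhere with the product of the well and
   phi, which is continuous off the sphere. *)
have cw : {ae mu, forall y, (w j y @[j --> \oo] --> (cRe \o h) y)%classic}.
  have sph : {ae mu, forall y : V, dotp y y <> a ^+ 2}.
    exists [set y : V | dotp y y = a ^+ 2]%classic; split.
    - have mf : measurable_fun setT (fun x : V => dotp x x) by exact: measurable_dotp.
      by have := mf measurableT [set a ^+ 2]%classic (measurable_set1 _); rewrite setTI.
    - exact: sphere_null.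
    - by move=> y /= /contrapT.
  move: (hk) sph; apply: filterS2 => y hy ya; rewrite hy.
  have := heat_cvg lk (econtinuous_cts (well_continuous a0 cphi ya)).
  apply: cvg_trans; apply: near_eq_cvg; apply: nearW => j.
  apply: Rint_ae.
  - by apply: measurable_funM; [exact: (L2_heat_kernel _ (tn j)).1|exact: lk.1].
  - by apply: measurable_funM; [exact: (L2_heat_kernel _ (tn j)).1|exact: lh.1].
  - by apply: filterS hk => z ->.
pose f := mirror_test c phi; have lf : L2 mu f by exact: L2_mirror_test.
have [g [gf lg cg cgu cgw]] := good_truncation lf (fun j => measurable_heat _ lphi.1)
  (fun j => measurable_heat _ lh.1) lphi.1 lh.1 cu cw.
pose U y := cRe (h y) + m * phi y.
have lU : L2 mu U by apply: L2D => //; exact: L2Z.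
have fU0 : 0 <= \int[mu]_y (f y * U y).
  have lk' : L2 mu (fun y => (lam + m + v * \1_(eball a) y) * phi y).
    have := L2D lk (L2Z m lphi); congr (L2 _ _); apply/funext => y; rewrite /k; ring.
  have := mirror_test_potential phi0 lphi c0 v0 a0 lk'.
  congr (0 <= _); apply: Rint_ae.
  - by apply: measurable_funM; [exact: lf.1|exact: lk'.1].
  - by apply: measurable_funM; [exact: lf.1|exact: lU.1].
  - apply: filterS hk => y /= e; rewrite /U e /k -/(f y); ring.
pose W i := \int[leb]_s (window i s * expR (- b * s)).
pose C := (levy_cst b)^-1; have C0 : 0 < C by rewrite invr_gt0 levy_cst_gt0.
pose eta' := eta / 8 * expR (- M * expR 1) * expR (- b).
have eta'0 : 0 < eta' by rewrite !mulr_gt0 ?expR_gt0.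
pose delta j := nrm2 mu (fun y => g j y - f y).
have main i j : (0 < i)%N -> - delta j * nrm2 mu U <=
    C * (2 * delta j * nrm2 mu phi * W i - eta') + cut_error b M F i * nrm2 mu f.
  move=> i0; have [lg1 lg2] := lg j.
  have ld : L2 mu (fun y => g j y - f y) by exact: L2B.
  have split_ip (G : V -> R) : L2 mu G ->
      `|\int[mu]_y (g j y * G y) - \int[mu]_y (f y * G y)| <= delta j * nrm2 mu G.
    move=> lG; rewrite -RintegralB//; [|exact: L1_L2M|exact: L1_L2M].
    under eq_Rintegral do rewrite -mulrBl.
    exact: cauchy_schwarz.
  have [lA test] := operator_test b01 M0 fF fH HF' i lg1 lg2 (cgu j) (cgw j).
  have gU : - delta j * nrm2 mu U <= \int[mu]_y (g j y * U y).
    by have := split_ip U lU; rewrite ler_norml => /andP[]; lra.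
  apply: (le_trans gU); apply: (le_trans test); apply: lerD; last first.
    rewrite ler_wpM2l//; first by rewrite addr_ge0// nrm2_ge0.
    have nf : L2 mu (fun y => `|f y|).
      split; first by apply: measurableT_comp => //; exact: lf.1.
      by have := lf.2; congr (L1 _ _); apply/funext => y; rewrite real_normK ?num_real.
    apply: (le_trans (nrm2_le lg2.1 (gf j) nf)); rewrite le_eqVlt; apply/orP; left.
    by apply/eqP; congr Num.sqrt; apply: eq_Rintegral => y _; rewrite real_normK ?num_real.
  rewrite ler_pM2l//.
  have d0 : 0 <= delta j by exact: nrm2_ge0.
  have n0 : 0 <= nrm2 mu phi by exact: nrm2_ge0.
  have lw := L1_window_exp b01 i.
  have l01 : L1 leb (fun s : R => \1_`[0, 1]%classic s) by exact: integrable_indic_itv.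
  have -> : 2 * delta j * nrm2 mu phi * W i - eta' =
      \int[leb]_s (2 * delta j * nrm2 mu phi * (window i s * expR (- b * s)) -
                   eta' * \1_`[0, 1]%classic s).
    rewrite RintegralB//; [|exact: (L1Z _ lw)|exact: (L1Z _ l01)].
    by rewrite RintegralZl// RintegralZl// Rint_unit_interval mulr1.
  apply: le_Rint => //; first by apply: L1B; [exact: (L1Z _ lw)|exact: (L1Z _ l01)].
  move=> s.
  have t0 : 0 < expR s by exact: expR_gt0.
  have e1 : \int[mu]_y (g j y * phi y) <= delta j * nrm2 mu phi.
    by have := split_ip phi lphi; rewrite mirror_test_orth// subr0 => /(le_trans (ler_norm _)).
  set Q := \int[mu]_y (g j y * heat (expR s) phi y).
  set Q0 := \int[mu]_y (f y * heat (expR s) phi y).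
  have e2 : Q0 - delta j * nrm2 mu phi <= Q.
    have h1 := split_ip _ (L2_heat t0 lphi).
    have h2 := ler_wpM2l d0 (nrm2_heat t0 lphi).
    by move: (le_trans h1 h2); rewrite ler_norml -/Q -/Q0 => /andP[]; lra.
  have Q00 : 0 <= Q0 by exact: mirror_test_heat_ge0.
  set E := expR (- M * expR s).
  have /andP[E0 E1] : 0 <= E <= 1.
    rewrite expR_ge0/= -expR0 ler_expR mulNr oppr_le0 mulr_ge0//; exact: ltW.
  have /andP[w0 w1] := @window01 R i s.
  have x0 : 0 < expR (- b * s) by exact: expR_gt0.
  (* Off [0, 1] the left side vanishes; on it every factor is bounded below. *)
  have low : eta' * \1_`[0, 1]%classic s <= window i s * expR (- b * s) * (E * Q0).
    have [s01|s01] := boolP (s \in `[0, 1]%classic); last first.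
      by rewrite indicE (negbTE s01) mulr0 !mulr_ge0// ltW.
    have /andP[s0 s1] : 0 <= s <= 1 by move: s01; rewrite inE/= in_itv.
    have ws : window i s = 1.
      rewrite /window indicE mem_set//= in_itv/=; apply/andP; split.
        by apply: le_trans s0; rewrite oppr_le0.
      by apply: (le_trans s1); rewrite ler1n.
    rewrite indicE s01 mulr1 ws mul1r /eta' mulrC.
    apply: ler_pM; rewrite ?mulr_ge0 ?expR_ge0 ?(ltW eta0)//.
      by rewrite ler_expR !mulNr lerN2 ler_piMr//; have [/ltW] := andP b01.
    rewrite mulrC; apply: ler_pM; rewrite ?expR_ge0 ?mulr_ge0 ?(ltW eta0)//.
      by rewrite ler_expR !mulNr lerN2 ler_wpM2l// ler_expR.
    apply: mirror_test_heat_ge => //; last by rewrite ler_expR.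
    by rewrite -expR0 ler_expR.
  set w' := window i s * expR (- b * s) in low *.
  have w'0 : 0 <= w' by rewrite mulr_ge0// ltW.
  apply: (@le_trans _ _ (w' * (2 * delta j * nrm2 mu phi - E * Q0))).
    apply: ler_wpM2l => //.
    have dn : 0 <= delta j * nrm2 mu phi by exact: mulr_ge0.
    have h1 := ler_wpM2l E0 e2; have h2 := ler_wpM2r dn E1.
    rewrite mulrBr in h1; rewrite mul1r in h2.
    change (\int[mu]_y (g j y * phi y) - E * Q <= 2 * delta j * nrm2 mu phi - E * Q0); lra.
  lra.
have ce : (cut_error b M F i * nrm2 mu f @[i --> \oo] --> (0 : R))%classic.
  rewrite -(mul0r (nrm2 mu f)); apply: cvgM; last exact: cvg_cst.
  exact: (cut_error_cvg b01 M0 fF fH HF').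
have e0 : 0 < C * eta' / 4 by rewrite divr_gt0// mulr_gt0.
have [i i0 ci] : exists2 i, (0 < i)%N & cut_error b M F i * nrm2 mu f < C * eta' / 4.
  have /cvgrPdist_lt/(_ _ e0)[N _ hN] := ce; exists N.+1 => //.
  have /= := hN N.+1 (leqnSn N); rewrite sub0r normrN; exact: le_lt_trans (ler_norm _).
(* The coefficient of delta j in main, once i is fixed. *)
pose K := nrm2 mu U + C * (2 * nrm2 mu phi * W i).
have cd : (delta j * K @[j --> \oo] --> (0 : R))%classic.
  by rewrite -(mul0r K); apply: cvgM; last exact: cvg_cst.
have [j cj] : exists j, delta j * K < C * eta' / 4.
  have /cvgrPdist_lt/(_ _ e0)[N _ hN] := cd; exists N.
  have /= := hN N (leqnn N); rewrite sub0r normrN; exact: le_lt_trans (ler_norm _).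
have := main i j i0; rewrite /K in cj.
have : 0 < C * eta' by rewrite mulr_gt0.
nra.
Qed.

End mirror_order.

Theorem theorem4p3 (R : realType) (d : nat) (alpha m v a : R)
    (phi : 'rV[R]_d -> R) (chi : R -> R) :
  (0 < d)%N -> 0 < alpha < 2 -> 0 <= m -> 0 < v -> 0 < a ->
  is_ground_state (rel_hamiltonian m alpha v a) phi ->
  (forall x : 'rV[R]_d, phi x = chi (enorm x)) ->
  forall r s : R, a <= r -> r <= s -> chi s <= chi r.
Proof.
move=> d0 al m0 v0 a0 [lam _ [cphi phi0 _ eig]] chiE r s ar rs.
case: d d0 phi cphi phi0 eig chiE => // n _ phi cphi phi0 eig chiE.
have [->//|rs'] := eqVneq r s.
have {rs' rs}rs : r < s by rewrite lt_neqAle rs'.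
have r0 : 0 < r by apply: lt_le_trans ar.
pose axis (z : R) : 'rV[R]_n.+1 := rV_cons (z : measurableTypeR R, 0).
have axisE z : 0 < z -> enorm (axis z) = z.
  move=> z0; rewrite /enorm dotp_cons (_ : dotp _ _ = 0); last first.
    by rewrite /dotp big1// => i _; rewrite mxE mul0r.
  by rewrite addr0 -expr2 sqrtr_sqr gtr0_norm.
have image : refl ((r + s) / 2) (axis r) = axis s.
  by rewrite refl_cons /=; congr (rV_cons (_, _)); field.
rewrite -(axisE r)// -(axisE s) ?(lt_trans r0)// -!chiE -image.
apply: (ground_state_mirror al m0 v0 a0 _ cphi phi0 eig).
  by rewrite divr_gt0// addr_gt0// (lt_trans r0).
by rewrite rV_coord0 /=; lra.
Qed.
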